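(* Let $(X,\phi)$ be a non-compact, connected calibrated manifold with $\phi$ parallel, and let $K$ be a compact subset of $X$. Suppose $T$ is a $\phi$-positive current with compact support in $X$. If $\partial_\phi\partial T$ is $\le 0$ (a non-positive measure) on $X-\widehat K$, then $$\mathrm{supp}\,T\ \subset\ \widehat K\cup\mathrm{Core}(X).$$
   Context: A calibrated manifold $(X,\phi)$ of degree $p\ge 1$ is a smooth riemannian manifold $X$ together with a closed smooth $p$-form $\phi$ such that $\phi(\xi)\le 1$ for every unit simple tangent $p$-vector $\xi$ on $X$; $\phi$ is parallel if $\nabla\phi=0$. $G_x(\phi)$ denotes the set of unit simple $p$-vectors $\xi$ at $x$ with $\phi(\xi)=1$ ($\phi$-planes). For $f\in C^\infty(X)$, set $d^\phi f=\nabla f\,\lrcorner\,\phi$ and $dd^\phi f=d(d^\phi f)$. $f$ is $\phi$-plurisubharmonic if $(dd^\phi f)(\xi)\ge 0$ for all $\phi$-planes $\xi$, and strictly $\phi$-plurisubharmonic at $x$ if $(dd^\phi f)(\xi)>0$ for all $\xi\in G_x(\phi)$. $\mathcal{PSH}(X,\phi)$ is the set of smooth $\phi$-plurisubharmonic functions on $X$. For compact $K\subset X$, $\widehat K=\{x\in X:f(x)\le\sup_Kf\ \text{for all }f\in\mathcal{PSH}(X,\phi)\}$. $\mathrm{Core}(X)$ is the set of points $x\in X$ at which no $f\in\mathcal{PSH}(X,\phi)$ is strictly $\phi$-plurisubharmonic. A $\phi$-positive (also called $\Lambda_+(\phi)$-positive) current is a $p$-dimensional current $T$ which is representable by integration,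 $T(\alpha)=\int\alpha(\vec T)\,d\|T\|$ for compactly supported smooth $p$-forms $\alpha$, where $\|T\|$ is a Radon measure and $\vec T_x$ lies in the convex hull of $G_x(\phi)\subset\Lambda_pT_xX$ for $\|T\|$-almost every $x$. Equivalently, $T(\alpha)\ge 0$ for every smooth compactly supported $p$-form $\alpha$ with $\alpha(\xi)\ge 0$ for all $\phi$-planes $\xi$. For a $p$-dimensional current $T$, $\partial_\phi\partial T$ is the $0$-dimensional current defined by $(\partial_\phi\partial T)(f)=T(dd^\phi f)$ for $f\in C^\infty_{\mathrm{cpt}}(X)$. *)

(* Defs.v *)
From HB Require Import structures.
From mathcomp Require Import all_boot all_order all_algebra.
From mathcomp Require Import all_classical all_reals all_analysis.

Set Implicit Arguments.
Unset Strict Implicit.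
Unset Printing Implicit Defensive.
Import Order.TTheory GRing.Theory Num.Theory.
Import numFieldNormedType.Exports.
Local Open Scope classical_set_scope.
Local Open Scope ring_scope.

Section Euclidean.
Context {R : realType} {n : nat}.

(* For s = [:: i1; ...; ik] this is d_i1 ( ... (d_ik f)). *)
Definition iter_partial (s : seq 'I_n) (f : 'rV[R]_n -> R) : 'rV[R]_n -> R :=
  foldr (fun i h => 'D_(delta_mx 0 i) h) f s.

Definition smooth_on (U : set 'rV[R]_n) (f : 'rV[R]_n -> R) : Prop :=
  forall (s : seq 'I_n) (y : 'rV[R]_n), U y ->
    {for y, continuous (iter_partial s f)} /\
    forall i : 'I_n, derivable (iter_partial s f) y (delta_mx 0 i).

End Euclidean.

(* [param] is only meaningful on the image of [coord]. *)
Record chart (R : realType) (n : nat) (X : topologicalType) := Chart {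
  cdom : set X;
  coord : X -> 'rV[R]_n;
  param : 'rV[R]_n -> X;
  cdom_open : open cdom;
  cimage_open : open (coord @` cdom);
  coordK : forall x, cdom x -> param (coord x) = x;
  coord_continuous : {within cdom, continuous coord};
  param_continuous : {within coord @` cdom, continuous param} }.

Definition smooth_transition (R : realType) (n : nat) (X : topologicalType)
    (c c' : chart R n X) : Prop :=
  forall j : 'I_n, smooth_on (coord c @` (cdom c `&` cdom c'))
                             (fun y => coord c' (param c y) 0 j).

(* [chart_at] chooses a chart of the atlas around each point. The tangent space
   at x is R^n, a vector being identified with its components in [chart_at x];
   hence a tensor field is a plain function of x, and its components in another
   chart are obtained through [tangent_change] below. The choice need not vary
   continuously with x, so regularity is always expressed in a fixed chart.
   The carrier is pointed because the library only equips pointed types with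
   generated sigma-algebras. *)
Record smooth_manifold (R : realType) (n : nat) := SmoothManifold {
  carrier :> ptopologicalType;
  atlas : set (chart R n carrier);
  chart_at : carrier -> chart R n carrier;
  manifold_hausdorff : hausdorff_space carrier;
  manifold_second_countable : @second_countable carrier;
  chart_at_atlas : forall x, atlas (chart_at x);
  chart_at_dom : forall x, cdom (chart_at x) x;
  atlas_smooth : forall c c', atlas c -> atlas c' -> smooth_transition c c' }.

Section Multivectors.
Context {R : realType} {n : nat}.

(* The rows of V are the k arguments v_1, ..., v_k. *)
Definition alternating_form (k : nat) (a : 'M[R]_(k, n) -> R) : Prop :=
  (forall (i : 'I_k) (A B C : 'M[R]_(k, n)) (b c : R),
     row i A = b *: row i B + c *: row i C ->
     row' i B = row' i A -> row' i C = row' i A ->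
     a A = b * a B + c * a C) /\
  (forall (A : 'M[R]_(k, n)) (i j : 'I_k), i != j -> row i A = row j A ->
     a A = 0).

(* Components, indexed by all multi-indices, of antisymmetric tensors. *)
Definition multivector (k : nat) := {ffun {ffun 'I_k -> 'I_n} -> R^o}.

(* v_1 /\ ... /\ v_k, whose components are the k x k minors. *)
Definition wedge (k : nat) (V : 'M[R]_(k, n)) : multivector k :=
  [ffun I : {ffun 'I_k -> 'I_n} => \det (colsub I V)].

(* The pairing for which [pairing a (wedge V) = a V] when a is alternating;
   [rowsub I 1%:M] has rows e_(I 0), ..., e_(I (k-1)). *)
Definition pairing (k : nat) (a : 'M[R]_(k, n) -> R) (xi : multivector k) : R :=
  (k`!%:R)^-1 * \sum_(I : {ffun 'I_k -> 'I_n}) xi I * a (rowsub I 1%:M).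

End Multivectors.
Arguments multivector : clear implicits.

Definition convex_hull (R : realType) (E : lmodType R) (A : set E) : set E :=
  smallest (@convex_set R E) A.

Section Manifold.
Context {R : realType} {n : nat} (X : smooth_manifold R n).

Definition cimage (c : chart R n X) : set 'rV[R]_n := coord c @` cdom c.

Definition smooth_fun (f : X -> R) : Prop :=
  forall c, atlas c -> smooth_on (cimage c) (f \o param c).

(* If a tangent vector has components v (a row) in c, its components in T_xX are
   v *m tangent_change c x. *)
Definition tangent_change (c : chart R n X) (x : X) : 'M[R]_n :=
  jacobian (coord (chart_at x) \o param c) (coord c x).

Definition diff_form (k : nat) := X -> 'M[R]_(k, n) -> R.

Definition local_form (k : nat) (c : chart R n X) (w : diff_form k)
    (y : 'rV[R]_n) (V : 'M[R]_(k, n)) : R :=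
  w (param c y) (V *m tangent_change c (param c y)).

Definition smooth_form (k : nat) (w : diff_form k) : Prop :=
  (forall x, alternating_form (w x)) /\
  (forall c, atlas c -> forall V, smooth_on (cimage c) (local_form c w ^~ V)).

(* dw(v_0,...,v_k) = sum_i (-1)^i D_(v_i) w(v_0,..,^v_i,..,v_k) for constant
   fields v_i in the chart at x. *)
Definition ext_d (k : nat) (w : diff_form k) : diff_form k.+1 := fun x V =>
  \sum_(i < k.+1) (-1) ^+ i *
    'D_(row i V) (local_form (chart_at x) w ^~ (row' i V))
                 (coord (chart_at x) x).

Definition closed_form (k : nat) (w : diff_form k) : Prop :=
  forall x V, ext_d w x V = 0.

(* g x is the Gram matrix: <u, v> = u *m g x *m v^T. *)
Definition metric_tensor := X -> 'M[R]_n.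

Definition local_metric (g : metric_tensor) (c : chart R n X) (y : 'rV[R]_n) :
    'M[R]_n :=
  let J := tangent_change c (param c y) in J *m g (param c y) *m J^T.

Definition riemannian (g : metric_tensor) : Prop :=
  [/\ forall x, (g x)^T = g x,
      forall x (v : 'rV[R]_n), v != 0 -> 0 < (v *m g x *m v^T) 0 0
    & forall c, atlas c ->
        forall i j, smooth_on (cimage c) (fun y => local_metric g c y i j)].

Definition gradient (g : metric_tensor) (f : X -> R) (x : X) : 'rV[R]_n :=
  (\row_i 'D_(delta_mx 0 i) (f \o param (chart_at x)) (coord (chart_at x) x))
  *m invmx (g x).

(* Levi-Civita connection: nabla_u v at x, for the fields with constant
   components u and v in the chart at x (Christoffel symbols). *)
Definition christoffel (g : metric_tensor) (x : X) (u v : 'rV[R]_n) :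
    'rV[R]_n :=
  let D (a b d : 'rV[R]_n) : R :=
    'D_a (fun y => (b *m local_metric g (chart_at x) y *m d^T) 0 0)
         (coord (chart_at x) x) in
  (\row_k (2^-1 * (D u v (delta_mx 0 k) + D v u (delta_mx 0 k)
                   - D (delta_mx 0 k) u v))) *m invmx (g x).

Definition covariant_derivative (g : metric_tensor) (k : nat) (w : diff_form k)
    (x : X) (u : 'rV[R]_n) (V : 'M[R]_(k, n)) : R :=
  'D_u (local_form (chart_at x) w ^~ V) (coord (chart_at x) x)
  - \sum_(a < k) w x (\matrix_(i < k)
      if i == a then christoffel g x u (row a V) else row i V).

Definition parallel_form (g : metric_tensor) (k : nat) (w : diff_form k) : Prop :=
  forall x u V, covariant_derivative g w x u V = 0.

(* |v_1 /\ ... /\ v_k|^2 is the Gram determinant. *)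
Definition unit_simple (g : metric_tensor) (k : nat) (x : X) :
    set (multivector R n k) :=
  [set wedge V | V in [set V : 'M[R]_(k, n) | \det (V *m g x *m V^T) = 1]].

Definition calibration (g : metric_tensor) (k : nat) (phi : diff_form k) : Prop :=
  [/\ smooth_form phi, closed_form phi
    & forall x xi, unit_simple g x xi -> pairing (phi x) xi <= 1].

Definition phi_planes (g : metric_tensor) (k : nat) (phi : diff_form k) (x : X) :
    set (multivector R n k) :=
  [set xi | unit_simple g x xi /\ pairing (phi x) xi = 1].

Section Plurisubharmonic.
Context (g : metric_tensor) (p : nat) (phi : diff_form p.+1).

Definition dphi (f : X -> R) : diff_form p := fun x V =>
  phi x (col_mx (gradient g f x) V).

Definition ddphi (f : X -> R) : diff_form p.+1 := ext_d (dphi f).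

Definition PSH : set (X -> R) :=
  [set f | smooth_fun f /\
    forall x xi, phi_planes g phi x xi -> 0 <= pairing (ddphi f x) xi].

Definition strictly_psh_at (f : X -> R) (x : X) : Prop :=
  forall xi, phi_planes g phi x xi -> 0 < pairing (ddphi f x) xi.

(* The supremum is taken in the extended reals: it is -oo if K is empty. *)
Definition psh_hull (K : set X) : set X :=
  [set x | forall f, PSH f ->
    ((f x)%:E <= ereal_sup [set (f y)%:E | y in K])%E].

Definition Core : set X :=
  [set x | ~ exists2 f, PSH f & strictly_psh_at f x].

End Plurisubharmonic.

Definition fun_support (f : X -> R) : set X := closure [set x | f x != 0].

Definition test_fun (f : X -> R) : Prop :=
  smooth_fun f /\ compact (fun_support f).

Definition form_support (k : nat) (w : diff_form k) : set X :=
  closure [set x | exists V, w x V != 0].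

Definition test_form (k : nat) (w : diff_form k) : Prop :=
  smooth_form w /\ compact (form_support w).

(* Convergence to 0 in the space of test forms: supports in a fixed compact
   set, and local uniform convergence of all derivatives of all components. *)
Definition test_cvg0 (k : nat) (w : nat -> diff_form k) : Prop :=
  [/\ forall j, test_form (w j),
      exists2 C : set X, compact C & forall j, form_support (w j) `<=` C
    & forall c, atlas c -> forall (L : set 'rV[R]_n), compact L ->
        L `<=` cimage c -> forall (s : seq 'I_n) (V : 'M[R]_(k, n)),
        {uniform L, (fun j => iter_partial s (local_form c (w j) ^~ V)) @ \oo
                    --> (fun=> 0 : R)}].

(* Only the values on test forms matter. *)
Definition current (k : nat) (T : diff_form k -> R) : Prop :=
  (forall (a : R) (w w' : diff_form k), test_form w -> test_form w' ->
     T (fun x V => a * w x V + w' x V) = a * T w + T w') /\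
  (forall w : nat -> diff_form k, test_cvg0 w -> T (w j) @[j --> \oo] --> (0 : R)).

Definition current_support (k : nat) (T : diff_form k -> R) : set X :=
  [set x | forall U : set X, open U -> U x ->
    exists w, [/\ test_form w, form_support w `<=` U & T w != 0]].

Definition borel := g_sigma_algebraType (@open X).

Definition positive_current (g : metric_tensor) (k : nat) (phi : diff_form k)
    (T : diff_form k -> R) : Prop :=
  current T /\
  exists (mu : {measure set borel -> \bar R})
         (Tvec : X -> multivector R n k),
  [/\ forall C : set X, compact C -> (mu C < +oo)%E,
      {ae mu, forall x : X, convex_hull (phi_planes g phi x) (Tvec x)}
    & forall w : diff_form k, test_form w ->
        mu.-integrable setT (fun x : borel => (pairing (w x) (Tvec x))%:E) /\
        (T w)%:E = (\int[mu]_(x in setT) (pairing (w x) (Tvec x))%:E)%E].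

(* The 0-dimensional current d_phi d T. *)
Definition dphi_d (g : metric_tensor) (p : nat) (phi : diff_form p.+1)
    (T : diff_form p.+1 -> R) (f : X -> R) : R := T (ddphi g phi f).

Definition nonpositive_on (U : set X) (S : (X -> R) -> R) : Prop :=
  forall f : X -> R, test_fun f -> fun_support f `<=` U ->
    (forall x, 0 <= f x) -> S f <= 0.

End Manifold.

(* Main.v *)
From Pilot Require Import Defs.
From mathcomp Require Import all_boot all_order all_algebra all_fingroup.
From mathcomp Require Import all_classical all_reals all_analysis.
From mathcomp Require Import measurable_realfun.
From mathcomp Require Import ring lra zify.
Set Implicit Arguments.
Unset Strict Implicit.
Unset Printing Implicit Defensive.
Import Order.TTheory GRing.Theory Num.Theory.
Import numFieldNormedType.Exports.
(* [coord] below is the chart map, not the coordinates of a vector in a basis. *)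
Import Pilot.Defs.
Local Open Scope classical_set_scope.
Local Open Scope ring_scope.

(** Suppose that x lies in the support of T but neither in the hull of K nor in
    the core. Then some plurisubharmonic function f satisfies f x > sup_K f, and
    some plurisubharmonic h is strict at x. As h is bounded on the compact set K,
    the function F = f + e h with e > 0 small is plurisubharmonic, strict at x,
    and still separates: F <= a on K and a < b < F x for some a and b
    ([strict_separation]). Composing F with a smooth convex function which
    vanishes on ]-oo, b] and increases strictly afterwards gives a nonnegative
    plurisubharmonic function u which vanishes where F <= b, hence near the
    hull, and is strict near x ([psh_truncation]).

    Multiply u by a cutoff eta >= 0 which equals 1 on a neighbourhood of the
    compact set supp T. The product psi has compact support off the hull, so
    T(dd^phi psi) <= 0. On the other hand the measure ||T|| is carried by supp T
    ([null_off_support]), where dd^phi psi = dd^phi u, and the direction of T is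
    almost everywhere a convex combination of phi-planes, on which dd^phi u is
    nonnegative. A nonnegative function whose integral is nonpositive vanishes
    almost everywhere; but the integrand is positive near x. Hence some
    neighbourhood of x is ||T||-null, T vanishes on the forms supported there
    ([current_null_open]), and x is not in supp T.

    The geometry enters in two places. First, for theta smooth,
      dd^phi (theta o F) = theta'(F) dd^phi F + theta''(F) dF /\ d^phi F
    ([ddphi_comp1]), and dF /\ d^phi F is nonnegative on every phi-plane
    ([first_cousin_ge0]). Indeed let the orthonormal v_1, ..., v_p span a
    phi-plane. As phi attains there its maximum on unit simple vectors, phi
    vanishes to first order when some v_i is replaced by a vector orthogonal to
    the plane ([first_cousin]); so only the projection of the gradient of F to
    the plane contributes, and the value is its squared length. Secondly,
    strictness at a point is an open condition, because phi-planes at points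
    near x are spanned by orthonormal frames, which stay in a compact set
    ([strict_positivity_open], [strictly_psh_open]).

    All this takes place in charts chosen point by point, so that a large part
    of the work consists in showing that the forms d^phi f and dd^phi f are
    smooth: gradients and exterior derivatives computed in the chosen charts
    agree with those computed in a fixed chart ([gradient_local],
    [local_form_ext]). *)

(** * Multilinear and alternating functions of the rows of a matrix *)

Section SetRow.
Context {R : realType} {n : nat}.

Definition set_row k (i : 'I_k) (u : 'rV[R]_n) (V : 'M[R]_(k, n)) : 'M[R]_(k, n) :=
  \matrix_(j < k) if j == i then u else row j V.

Lemma row_set_row k (i j : 'I_k) u (V : 'M[R]_(k, n)) :
  row j (set_row i u V) = if j == i then u else row j V.
Proof. by rewrite rowK. Qed.

Lemma set_rowE k (i : 'I_k) u (V : 'M[R]_(k, n)) r j :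
  set_row i u V r j = if r == i then u 0 j else V r j.
Proof. by rewrite mxE; case: eqP => // _; rewrite mxE. Qed.

Lemma row'_set_row k (i : 'I_k) u (V : 'M[R]_(k, n)) :
  row' i (set_row i u V) = row' i V.
Proof.
by apply/matrixP => r j; rewrite !mxE eq_sym (negPf (neq_lift _ _)) mxE.
Qed.

Lemma set_row_id k (i : 'I_k) (V : 'M[R]_(k, n)) : set_row i (row i V) V = V.
Proof. by apply/row_matrixP => j; rewrite row_set_row; case: eqP => // ->. Qed.

Lemma set_row_eq k (i : 'I_k) (A B : 'M[R]_(k, n)) :
  row' i B = row' i A -> A = set_row i (row i A) B.
Proof.
move=> E; apply/row_matrixP => j; rewrite row_set_row.
case: (unliftP i j) => [j' ->|->]; last by rewrite eqxx.
rewrite eq_sym (negPf (neq_lift _ _)).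
by apply/rowP => l; move/matrixP/(_ j' l): E; rewrite !mxE.
Qed.

Lemma set_row_comm k (i j : 'I_k) u v (V : 'M[R]_(k, n)) : i != j ->
  set_row i u (set_row j v V) = set_row j v (set_row i u V).
Proof.
move=> ij; apply/row_matrixP => l; rewrite !row_set_row.
by case: (eqVneq l i) => [->|//]; rewrite (negPf ij).
Qed.

Definition multilinear k (a : 'M[R]_(k, n) -> R) := forall i b c u v V,
  a (set_row i (b *: u + c *: v) V) = b * a (set_row i u V) + c * a (set_row i v V).

Lemma alternating_multilinear k (a : 'M[R]_(k, n) -> R) :
  alternating_form a -> multilinear a.
Proof.
move=> [lin _] i b c u v V; apply: (lin i); rewrite ?row'_set_row //.
by rewrite !row_set_row eqxx.
Qed.

(** The definition relates three matrices which agree off one row; here that row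
    alone varies, in an otherwise shared matrix. *)
Lemma alternatingP k (a : 'M[R]_(k, n) -> R) :
  multilinear a ->
  (forall A i j, i != j -> row i A = row j A -> a A = 0) -> alternating_form a.
Proof.
move=> lin alt; split=> [i A B C b c rA rB rC|A i j ij]; last exact: alt ij.
have -> : A = set_row i (b *: row i B + c *: row i C) B.
  by rewrite -rA; exact: set_row_eq.
by rewrite lin set_row_id -(set_row_eq (etrans rB (esym rC))).
Qed.

Lemma multilinear_sum k (a : 'M[R]_(k, n) -> R) (i : 'I_k) (I : Type) (s : seq I)
    (c : I -> R) (u : I -> 'rV[R]_n) V : multilinear a ->
  a (set_row i (\sum_(j <- s) c j *: u j) V) =
  \sum_(j <- s) c j * a (set_row i (u j) V).
Proof.
move=> lin; elim: s => [|j s IHs].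
  have := lin i 0 0 0 0 V.
  by rewrite !big_nil !scale0r addr0 !mul0r addr0.
rewrite !big_cons -IHs.
by have := lin i (c j) 1 (u j) (\sum_(j <- s) c j *: u j) V; rewrite scale1r mul1r.
Qed.

(** By induction on m, the value is 0 at matrices whose rows from the m-th on are
    basis vectors; the inductive step expands row m. *)
Lemma multilinear_eq0 k (a : 'M[R]_(k, n) -> R) : multilinear a ->
  (forall I : {ffun 'I_k -> 'I_n}, a (rowsub I 1%:M) = 0) -> forall V, a V = 0.
Proof.
move=> lin a0 V.
suff H m : forall W : 'M[R]_(k, n),
    (forall i : 'I_k, (m <= i)%N -> exists j : 'I_n, row i W = delta_mx 0 j) ->
    a W = 0.
  by apply: (H k) => i; rewrite leqNgt ltn_ord.
elim: m => [|m IHm] {}V HV.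
  have {}HV (i : 'I_k) : exists j : 'I_n, row i V = delta_mx 0 j by exact: HV.
  pose I := [ffun i => sval (cid (HV i))].
  rewrite -(a0 I); congr a; apply/row_matrixP => i.
  rewrite (svalP (cid (HV i))); apply/rowP => j.
  by rewrite !mxE eqxx /= ffunE eq_sym.
have [mk|mk] := ltnP m k; last first.
  by apply: IHm => i /(leq_trans mk); rewrite leqNgt ltn_ord.
rewrite -(set_row_id (Ordinal mk) V) [row _ V]row_sum_delta multilinear_sum //.
rewrite big1 // => j _; rewrite IHm ?mulr0 // => i; rewrite row_set_row.
case: eqP => [_ _|/eqP im]; first by exists j.
rewrite leq_eqVlt => /orP[/eqP E|]; last exact: HV.
by case/negP: im; apply/eqP/val_inj.
Qed.

Lemma multilinear_prod k (I : {ffun 'I_k -> 'I_n}) :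
  multilinear (fun V : 'M[R]_(k, n) => \prod_i V i (I i)).
Proof.
move=> i b c u v V.
have E w : \prod_j set_row i w V j (I j) =
    w 0 (I i) * \prod_(j | j != i) V j (I j).
  rewrite (bigD1 i) //= set_rowE eqxx; congr (_ * _).
  by apply: eq_bigr => j /negPf ji; rewrite set_rowE ji.
by rewrite !E !mxE mulrDl !mulrA.
Qed.

(** The difference of the two sides is multilinear and vanishes on basis vectors. *)
Lemma multilinear_expand k (a : 'M[R]_(k, n) -> R) : multilinear a ->
  forall V, a V = \sum_(I : {ffun 'I_k -> 'I_n})
    (\prod_i V i (I i)) * a (rowsub I 1%:M).
Proof.
move=> lin V; apply/eqP; rewrite -subr_eq0; apply/eqP.
pose b (V : 'M[R]_(k, n)) := a V - \sum_(I : {ffun 'I_k -> 'I_n})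
    (\prod_i V i (I i)) * a (rowsub I 1%:M).
rewrite -/(b V); apply: multilinear_eq0 => [i x y u v W|I].
  rewrite /b lin.
  under [X in _ - X = _]eq_bigr => J _
    do rewrite (multilinear_prod J) mulrDl -!mulrA.
  rewrite big_split /= -!mulr_sumr.
  by rewrite !mulrBr opprD addrACA.
rewrite /b (bigD1 I) //= big1 => [|i _]; last by rewrite !mxE eqxx.
rewrite mul1r big1 => [|J JI]; first by rewrite addr0 subrr.
have [i Ii] : exists i, I i != J i.
  apply/existsP; rewrite -negb_forall; apply: contra JI => /forallP E.
  by apply/eqP/ffunP => i; rewrite (eqP (E i)).
by rewrite (bigD1 i) //= !mxE (negPf Ii) mul0r mul0r.
Qed.

Section Alternating.
Context {k : nat} (a : 'M[R]_(k, n) -> R) (alt : alternating_form a).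

Let lin : multilinear a := alternating_multilinear alt.

(** Polarization: expand the value, which is 0, at the matrix both of whose rows i
    and j are the sum of the two rows. *)
Lemma alternating_xrow i j A : i != j -> a (xrow i j A) = - a A.
Proof.
move=> ij; apply/eqP; rewrite -addr_eq0; apply/eqP.
pose M u v := set_row i u (set_row j v A).
have M0 u : a (M u u) = 0.
  by apply: (alt.2 _ i j ij); rewrite !row_set_row eqxx eq_sym (negPf ij) eqxx.
have D u v w : a (M (u + v) w) = a (M u w) + a (M v w).
  by rewrite -[u]scale1r -[v in LHS]scale1r /M lin !scale1r !mul1r.
have D' u v w : a (M w (u + v)) = a (M w u) + a (M w v).
  rewrite /M !(set_row_comm _ _ _ ij) -[u]scale1r -[v in LHS]scale1r lin.
  by rewrite !scale1r !mul1r.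
have := M0 (row i A + row j A); rewrite D !D' !M0 add0r addr0 => E.
have -> : a A = a (M (row i A) (row j A)) by rewrite /M !set_row_id.
have -> : xrow i j A = M (row j A) (row i A) => //; last by rewrite addrC.
apply/row_matrixP => l; rewrite !row_set_row.
apply/rowP => m; rewrite !mxE; case: tpermP => [->|->|].
- by rewrite eqxx mxE.
- by rewrite eq_sym (negPf ij) eqxx mxE.
- by move=> /eqP/negPf-> /eqP/negPf->; rewrite mxE.
Qed.

Lemma alternating_row_perm (s : 'S_k) A : a (row_perm s A) = (-1) ^+ s * a A.
Proof.
case: (prod_tpermP s) => ts -> {s}.
elim: ts A => [A _|[i j] ts IHts A /= /andP[ij Hts]].
  by rewrite big_nil row_perm1 odd_perm1 mul1r.
rewrite big_cons row_permM alternating_xrow // IHts //.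
by rewrite odd_permM odd_tperm ij addTb signrN mulNr.
Qed.

(** Expand the minors in the components of the wedge as sums over permutations.
    After reindexing the multi-indices, the sign of the permutation cancels and
    each of the k! terms is the expansion of [a V]; the normalization of
    [pairing] divides by k!. *)
Lemma pairing_wedge V : pairing a (wedge V) = a V.
Proof.
rewrite /pairing [in RHS](multilinear_expand lin).
have fact0 : (k`!%:R : R) != 0 by rewrite pnatr_eq0 -lt0n fact_gt0.
apply: (mulfI fact0); rewrite mulVKf //.
under eq_bigr => I _ do rewrite ffunE big_distrl /=.
rewrite exchange_big /=.
rewrite (eq_bigr (fun=> \sum_(I : {ffun 'I_k -> 'I_n})
    (\prod_i V i (I i)) * a (rowsub I 1%:M))) => [|s _].
  by rewrite sumr_const card_Sn mulr_natl.
pose h (t : 'S_k) (I : {ffun 'I_k -> 'I_n}) := [ffun i => I (t i)].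
have hK t : cancel (h t) (h t^-1)%g.
  by move=> I; apply/ffunP => i; rewrite !ffunE permKV.
rewrite (reindex (h s^-1)%g) /=; last first.
  exists (h s) => I _; first by rewrite -{1}[s]invgK hK.
  by rewrite hK.
apply: eq_bigr => I _.
have -> : rowsub (h s^-1 I)%g 1%:M = row_perm s^-1 (rowsub I (1%:M : 'M[R]_n)).
  by apply/matrixP => i j; rewrite !mxE ffunE.
rewrite alternating_row_perm odd_permV.
under eq_bigr => i _ do rewrite mxE ffunE permK.
by rewrite mulrACA -expr2 sqrr_sign mul1r.
Qed.

(** By [pairing_wedge], it is enough to compare the wedges, whose components are
    minors: there it is multiplicativity of determinants. *)
Lemma alternating_mulmx (A : 'M[R]_k) V : a (A *m V) = \det A * a V.
Proof.
rewrite -!pairing_wedge /pairing [in RHS]mulrCA; congr (_ * _).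
rewrite mulr_sumr; apply: eq_bigr => I _.
rewrite !ffunE mulrA -det_mulmx; congr (\det _ * _).
by apply/matrixP => i j; rewrite !mxE; apply: eq_bigr => l _; rewrite mxE.
Qed.

End Alternating.

(** The sign is that of the cycle which brings row j to the front. *)
Lemma alternating_front k (a : 'M[R]_(k.+1, n) -> R) (j : 'I_k.+1) u V :
  alternating_form a ->
  a (set_row j u V) = (-1) ^+ j * a (col_mx u (row' j V)).
Proof.
move=> alt.
have -> : col_mx u (row' j V) = row_perm (lift_perm 0 j 1%g) (set_row j u V).
  apply/row_matrixP => i; apply/rowP => l.
  rewrite [RHS]mxE [RHS]mxE set_rowE mxE; case: (unliftP 0 i) => [i'|] ->.
    rewrite lift_perm_lift perm1 eq_sym (negPf (neq_lift _ _)).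
    have -> : lift 0 i' = rshift 1 i' by apply: val_inj.
    by rewrite col_mxEd !mxE.
  have -> : 0 = lshift k (0 : 'I_1) by apply: val_inj.
  by rewrite col_mxEu lift_perm_id eqxx.
rewrite alternating_row_perm // odd_lift_perm odd_perm1 addbF addFb signr_odd.
by rewrite mulrA -expr2 sqrr_sign mul1r.
Qed.

End SetRow.

(** * Faces and antisymmetrization *)

Section Simplicial.
Context {R : realType} {n : nat}.

(** Deleting row i and then row j amounts to deleting the same two rows in the
    other order, with shifted indices. This is the involution of pairs of
    indices behind the identity d o d = 0. *)
Definition swap_faces k (x : 'I_k.+2 * 'I_k.+1) : 'I_k.+2 * 'I_k.+1 :=
  (lift x.1 x.2, inord (if (x.2 < x.1)%N then x.1.-1 else x.1)).

Lemma swap_faces2 k (x : 'I_k.+2 * 'I_k.+1) :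
  (swap_faces x).2 = (if (x.2 < x.1)%N then x.1.-1 else x.1) :> nat.
Proof.
case: x => i j /=; rewrite inordK //.
by case: (ltnP j i) => h; have := ltn_ord i; have := ltn_ord j; lia.
Qed.

Lemma lift_swap_faces k (x : 'I_k.+2 * 'I_k.+1) :
  lift (swap_faces x).1 (swap_faces x).2 = x.1.
Proof.
apply: val_inj; rewrite /= /bump swap_faces2; case: x => i j /=; rewrite /bump.
by case: (ltnP j i) => h; case: (leqP i j) => h'; lia.
Qed.

Lemma swap_facesK k : involutive (@swap_faces k).
Proof.
move=> x; rewrite [LHS]surjective_pairing [RHS]surjective_pairing.
congr pair; first exact: lift_swap_faces.
apply: val_inj; rewrite [LHS]swap_faces2 swap_faces2; case: x => i j /=.
by rewrite /bump; case: (ltnP j i) => h; case: (leqP i j) => h'; case: ifP; lia.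
Qed.

Lemma odd_swap_faces k (x : 'I_k.+2 * 'I_k.+1) :
  odd ((swap_faces x).1 + (swap_faces x).2) = ~~ odd (x.1 + x.2).
Proof.
rewrite swap_faces2; case: x => i j /=; rewrite /bump.
case: (ltnP j i) => h; case: (leqP i j) => h'; lia.
Qed.

Lemma row'_swap_faces k (x : 'I_k.+2 * 'I_k.+1) (A : 'M[R]_(k.+2, n)) :
  row' (swap_faces x).2 (row' (swap_faces x).1 A) = row' x.2 (row' x.1 A).
Proof.
apply/matrixP => r l; rewrite !mxE; congr (A _ l); apply: val_inj => /=.
rewrite swap_faces2; case: x => i j /=; rewrite /bump.
by case: (ltnP j i) => h; do !case: leqP => ?; lia.
Qed.

Lemma row_row'_pred k (i : 'I_k) (j : 'I_k.-1) (A : 'M[R]_(k, n)) :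
  row j (row' i A) = row (lift i j) A.
Proof. by apply/rowP => l; rewrite !mxE. Qed.

Lemma row_row' k (i : 'I_k.+1) (j : 'I_k) (A : 'M[R]_(k.+1, n)) :
  row j (row' i A) = row (lift i j) A.
Proof. exact: row_row'_pred. Qed.

(** Move the remaining one of the two equal rows to the front of each face: the
    two matrices become equal, and [odd_swap_faces] makes the signs opposite. *)
Lemma alternating_faces k (a : 'M[R]_(k, n) -> R) (A : 'M[R]_(k.+1, n)) i j :
  alternating_form a -> i != j -> row i A = row j A ->
  (-1) ^+ i * a (row' i A) + (-1) ^+ j * a (row' j A) = 0.
Proof.
case: k a A i j => [a A i j _|k a A i j alt].
  by rewrite (ord1 i) (ord1 j) eqxx.
case: (unliftP i j) => [j1 ->|->]; last by rewrite eqxx.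
move=> _ E.
have face (l : 'I_k.+2) (m : 'I_k.+1) : a (row' l A) =
    (-1) ^+ m * a (col_mx (row (lift l m) A) (row' m (row' l A))).
  by rewrite -alternating_front // -row_row' set_row_id.
rewrite (face i j1) (face _ (swap_faces (i, j1)).2).
rewrite -[lift i j1]/((swap_faces (i, j1)).1) lift_swap_faces.
rewrite row'_swap_faces /= -E !mulrA -!exprD -mulrDl.
rewrite -signr_odd -[X in _ + X]signr_odd.
have /= -> := odd_swap_faces (i, j1).
by rewrite signrN subrr mul0r.
Qed.

(** The common shape of exterior derivatives, where b differentiates along its
    first argument, and of wedge products with a 1-form. *)
Definition alt_sum k (b : 'rV[R]_n -> 'M[R]_(k, n) -> R) (V : 'M[R]_(k.+1, n)) :=
  \sum_(i < k.+1) (-1) ^+ i * b (row i V) (row' i V).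

Lemma alternating_alt_sum k (b : 'rV[R]_n -> 'M[R]_(k, n) -> R) :
  (forall u, alternating_form (b u)) ->
  (forall c d u v W, b (c *: u + d *: v) W = c * b u W + d * b v W) ->
  alternating_form (alt_sum b).
Proof.
move=> alt lin; split=> [r A B C c d rA rB rC|A i j ij E].
  rewrite /alt_sum !mulr_sumr -big_split /=; apply: eq_bigr => i _.
  have same (D : 'M[R]_(k.+1, n)) j : row' r D = row' r A -> j != r ->
      row j D = row j A.
    move=> E; case: (unliftP r j) => [j' -> _|->]; last by rewrite eqxx.
    by apply/rowP => l; move/matrixP/(_ j' l): E; rewrite !mxE.
  case: (unliftP i r) => [r' rE|rE]; last by rewrite -rE rB rC rA lin; ring.
  have ir : i != r by rewrite rE neq_lift.
  rewrite (same B i rB ir) (same C i rC ir).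
  rewrite mulrCA [X in _ + X]mulrCA -mulrDr; congr (_ * _).
  apply: ((alt (row i A)).1 r'); first by rewrite !row_row' -rE.
    apply/row_matrixP => l; rewrite !row_row'_pred !row_row'; apply: same => //.
    by rewrite rE (inj_eq lift_inj) eq_sym neq_lift.
  apply/row_matrixP => l; rewrite !row_row'_pred !row_row'; apply: same => //.
  by rewrite rE (inj_eq lift_inj) eq_sym neq_lift.
rewrite /alt_sum (bigD1 i) //= (bigD1 j) 1?eq_sym //= big1 => [|l /andP[li lj]].
  by rewrite addr0 -E; exact: alternating_faces.
case: (unliftP l i) li => [i' iE _|->]; last by rewrite eqxx.
case: (unliftP l j) lj => [j' jE _|->]; last by rewrite eqxx.
rewrite ((alt (row l A)).2 _ i' j') ?mulr0 ?row_row' -?iE -?jE //.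
by apply: contra ij => /eqP; rewrite iE jE => ->.
Qed.

(** The involution [swap_faces] pairs the terms with opposite signs. Taking for B
    the second derivative of a change of charts shows that the exterior
    derivative does not depend on the chart. *)
Lemma alt_sum_symmetric k (a : 'M[R]_(k, n) -> R)
    (B : 'rV[R]_n -> 'rV[R]_n -> 'rV[R]_n) (V : 'M[R]_(k.+1, n)) :
  alternating_form a -> (forall u v, B u v = B v u) ->
  alt_sum (fun u W => \sum_(j < k) a (set_row j (B u (row j W)) W)) V = 0.
Proof.
move=> alt symB; rewrite /alt_sum; case: k a V alt => [|k] a V alt.
  by rewrite big1 // => i _; rewrite big_ord0 mulr0.
under eq_bigr => i _ do rewrite mulr_sumr.
rewrite pair_bigA /=; set S := \sum_(_ | _) _.
suff : S = - S by move/eqP; rewrite -addr_eq0 -mulr2n mulrn_eq0 => /eqP.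
rewrite {1}/S (reindex_inj (can_inj (@swap_facesK k))) /S -sumrN.
apply: eq_bigr => x _.
rewrite !alternating_front // !row_row' lift_swap_faces row'_swap_faces.
rewrite symB !mulrA -!exprD -signr_odd odd_swap_faces signrN mulNr.
by rewrite signr_odd.
Qed.

End Simplicial.

(** * Gram matrices and the first cousin principle *)

Section InnerProduct.
Context {R : realType}.

Definition posdef n (G : 'M[R]_n) :=
  G^T = G /\ forall v : 'rV[R]_n, v != 0 -> 0 < (v *m G *m v^T) 0 0.

Definition gram n k (G : 'M[R]_n) (V : 'M[R]_(k, n)) : 'M[R]_k := V *m G *m V^T.

Lemma gram_mulmx n k l (G : 'M[R]_n) (A : 'M[R]_(l, k)) (V : 'M[R]_(k, n)) :
  gram G (A *m V) = A *m gram G V *m A^T.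
Proof. by rewrite /gram trmx_mul !mulmxA. Qed.

Definition inner n (G : 'M[R]_n) (u v : 'rV[R]_n) : R := (u *m G *m v^T) 0 0.

Lemma gram_inner n k (G : 'M[R]_n) (V : 'M[R]_(k, n)) i j :
  gram G V i j = inner G (row i V) (row j V).
Proof.
rewrite /inner -row_mul [LHS]mxE [RHS]mxE; apply: eq_bigr => l _.
by congr (_ * _); [rewrite [RHS]mxE|rewrite !mxE].
Qed.

Lemma innerDl n (G : 'M[R]_n) u v w :
  inner G (u + v) w = inner G u w + inner G v w.
Proof. by rewrite /inner !mulmxDl mxE. Qed.

Lemma innerDr n (G : 'M[R]_n) u v w :
  inner G w (u + v) = inner G w u + inner G w v.
Proof. by rewrite /inner [_^T]linearD /= !mulmxDr mxE. Qed.

Lemma innerZl n (G : 'M[R]_n) c u w : inner G (c *: u) w = c * inner G u w.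
Proof. by rewrite /inner -!scalemxAl mxE. Qed.

Lemma innerZr n (G : 'M[R]_n) c u w : inner G w (c *: u) = c * inner G w u.
Proof. by rewrite /inner [_^T]linearZ /= -scalemxAr mxE. Qed.

Lemma posdef_ge0 n (G : 'M[R]_n) (v : 'rV[R]_n) : posdef G -> 0 <= (v *m G *m v^T) 0 0.
Proof.
move=> [_ pos]; have [->|/pos/ltW//] := eqVneq v 0.
by rewrite !mul0mx mxE.
Qed.

Lemma gram_sym n k (G : 'M[R]_n) (V : 'M[R]_(k, n)) :
  G^T = G -> (gram G V)^T = gram G V.
Proof. by move=> sG; rewrite /gram !trmx_mul trmxK sG mulmxA. Qed.

Lemma posdef_unit n (G : 'M[R]_n) : posdef G -> G \in unitmx.
Proof.
move=> [_ pos]; rewrite -row_free_unit -kermx_eq0; apply/eqP/row_matrixP => i.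
rewrite row0; apply/eqP; apply: contraT => /pos.
have /sub_kermxP-> : (row i (kermx G) <= kermx G)%MS by exact: row_sub.
by rewrite mul0mx mxE ltxx.
Qed.

Lemma posdef_gram n k (G : 'M[R]_n) (V : 'M[R]_(k, n)) : posdef G ->
  (forall v : 'rV[R]_k, v != 0 -> v *m V != 0) -> posdef (gram G V).
Proof.
move=> [sG pos] inj; split=> [|v /inj /pos]; first exact: gram_sym.
by rewrite trmx_mul !mulmxA.
Qed.

(** Gram-Schmidt: clear the first row and column of M, normalize its corner, and
    proceed with the Schur complement. *)
Lemma posdef_orthonormalize k (M : 'M[R]_k) : posdef M ->
  exists2 A : 'M[R]_k, 0 < \det A & A *m M *m A^T = 1%:M.
Proof.
elim: k M => [|k IHk] M pM.
  by exists 1%:M; [rewrite det1|apply/matrixP => -[]].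
pose m := M 0 0.
pose N : 'M[R]_(1 + k) := M.
have m0 : 0 < m.
  have := pM.2 (delta_mx 0 0); rewrite -rowE trmx_delta -colE !mxE; apply.
  by apply/eqP => /matrixP/(_ 0 0)/eqP; rewrite !mxE !eqxx oner_eq0.
have ulE : ulsubmx N = m%:M.
  apply/matrixP => i j; rewrite !ord1 !mxE eqxx mulr1n; congr (M _ _);
  exact: val_inj.
pose b := ursubmx N.
have dlE : dlsubmx N = b^T by rewrite /b trmx_ursub [N^T](pM.1).
pose L : 'M[R]_(1 + k) := block_mx 1%:M 0 (- m^-1 *: b^T) 1%:M.
have detL : \det L = 1 by rewrite det_lblock !det1 mulr1.
have pL : posdef (gram N L).
  apply: posdef_gram => // v; apply: contra_neq => vL.
  have uL : L \in unitmx by rewrite unitmxE detL unitr1.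
  by rewrite -(mulmxK uL v) vL mul0mx.
(* The Schur complement of the corner m in M. *)
pose S := drsubmx N - m^-1 *: (b^T *m b).
have LE : gram N L = block_mx m%:M 0 0 S.
  rewrite /gram /L tr_block_mx -{1}(submxK N) ulE dlE -/b !mulmx_block.
  rewrite !mul1mx !mul0mx !trmx1 !trmx0 !mulmx1 !mulmx0 !addr0 ?add0r.
  rewrite !linearZ /= !trmxK !(mul_scalar_mx, mul_mx_scalar, scalerA) mulrN.
  rewrite mulfV ?gt_eqF // !scaleN1r mulNr mulVf ?gt_eqF // scaleN1r.
  by rewrite !addNr mul0mx scaler0 add0r scaleNr mulNmx -scalemxAl addrC.
have pS : posdef S.
  split.
    have := pL.1; rewrite LE tr_block_mx => /eq_block_mx[_ _ _ ->] //.
  move=> v v0; have := pL.2 (row_mx 0 v).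
  rewrite LE mul_row_block tr_row_mx !mul0mx !mulmx0 !add0r mul_row_col.
  rewrite trmx0 mulmx0 add0r; apply; apply: contra_neq v0 => /matrixP E.
  by apply/matrixP => i j; have := E i (rshift 1 j); rewrite row_mxEr !mxE.
have [B B0 BS] := IHk S pS.
pose r := Num.sqrt m.
have r0 : 0 < r by rewrite sqrtr_gt0.
pose D : 'M[R]_(1 + k) := block_mx (r^-1)%:M 0 0 B.
have detD : \det D = r^-1 * \det B by rewrite det_lblock det_scalar1.
exists (D *m L).
  have -> : \det (D *m L) = r^-1 * \det B by rewrite det_mulmx detL mulr1.
  by rewrite mulr_gt0 ?invr_gt0.
rewrite -[LHS]/(gram N (D *m L)) gram_mulmx LE tr_block_mx !mulmx_block.
rewrite !mul0mx !mulmx0 !trmx0 !mulmx0 !addr0 ?add0r !mul0mx BS.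
rewrite tr_scalar_mx -!scalar_mxM.
have -> : r^-1 * m * r^-1 = 1.
  by rewrite -[m]sqr_sqrtr ?ltW // -/r expr2 mulKf ?mulfV ?gt_eqF.
exact: (esym (@scalar_mx_block R 1 k 1)).
Qed.

(** The Gram-Schmidt matrix has determinant 1 because the frame spans a unit simple
    vector already. *)
Lemma orthonormal_frame n k (G : 'M[R]_n) (V : 'M[R]_(k, n)) : posdef G ->
  \det (gram G V) = 1 ->
  exists2 A : 'M[R]_k, \det A = 1 & gram G (A *m V) = 1%:M.
Proof.
move=> pG d1; have : posdef (gram G V).
  apply: posdef_gram => // v; apply: contra_neq => vV.
  have uV : gram G V \in unitmx by rewrite unitmxE d1 unitr1.
  by rewrite -(mulmxK uV v) /gram !mulmxA vV !mul0mx.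
move=> /posdef_orthonormalize[A A0 AV]; exists A; last by rewrite gram_mulmx.
have /eqP := congr1 determinant AV.
rewrite !det_mulmx d1 det_tr det1 mulr1 -expr2 sqrf_eq1 => /orP[/eqP//|/eqP E].
by move: A0; rewrite E ltr0N1.
Qed.

(** Cauchy-Schwarz with the vector z representing the j-th coordinate, written as
    the nonnegativity of the squared length of z - v_j v. *)
Lemma unit_vector_bound n (G : 'M[R]_n) (v : 'rV[R]_n) j : posdef G ->
  (v *m G *m v^T) 0 0 = 1 -> v 0 j ^+ 2 <= invmx G j j.
Proof.
move=> pG v1; have uG := posdef_unit pG.
pose z := row j (invmx G).
have zG : z *m G = delta_mx 0 j by rewrite /z -row_mul mulVmx // rowE mulmx1.
have Gz : G *m z^T = delta_mx j 0.
  by rewrite -[LHS]trmxK trmx_mul trmxK pG.1 zG trmx_delta.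
have := posdef_ge0 (z - v 0 j *: v) pG.
have -> : ((z - v 0 j *: v) *m G *m (z - v 0 j *: v)^T) =
    z *m G *m z^T - v 0 j *: (z *m G *m v^T) - v 0 j *: (v *m (G *m z^T))
    + (v 0 j ^+ 2) *: (v *m G *m v^T).
  rewrite [(_ - _)^T]linearB /= [(_ *: _)^T]linearZ /=.
  rewrite !mulmxBl !mulmxBr -!scalemxAl -!scalemxAr scalerA.
  by rewrite opprB addrA addrAC !mulmxA -expr2 addrAC.
rewrite zG Gz mxE [X in X + _]mxE [X in X + _ + _]mxE.
have -> : ((delta_mx 0 j : 'rV_n) *m z^T) 0 0 = invmx G j j.
  by rewrite -rowE !mxE.
have -> : (- (v 0 j *: ((delta_mx 0 j : 'rV_n) *m v^T))) 0 0 = - v 0 j ^+ 2.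
  by rewrite -rowE !mxE expr2.
have -> : (- (v 0 j *: (v *m (delta_mx j 0 : 'cV_n)))) 0 0 = - v 0 j ^+ 2.
  by rewrite -colE !mxE expr2.
by rewrite [X in _ + X]mxE v1 mulr1 subrK subr_ge0.
Qed.


(** A line which passes through (0, 1) and stays below the graph of the square root
    of 1 + C t^2, near t = 0, is tangent to it there. *)
Lemma slope_eq0 (b C : R) :
  (forall t, 0 < 1 + C * t ^+ 2 -> 0 <= 1 + t * b ->
     (1 + t * b) ^+ 2 <= 1 + C * t ^+ 2) -> b = 0.
Proof.
move=> key; apply/eqP; apply: contraT => b0.
have b2 : 0 < b ^+ 2 by rewrite exprn_even_gt0.
pose D : R := `|C|.
have D0 : 0 <= D by exact: normr_ge0.
have /andP[CD CD'] : - D <= C <= D by rewrite -ler_norml.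
(* The inequality is violated at t = b e, where e is so small that
   |C| e (1 + b^2) < 1. *)
pose c := 1 + D * (1 + b ^+ 2).
have Db : 0 <= D * b ^+ 2 by rewrite mulr_ge0 // ltW.
have c1 : 1 <= c by rewrite /c; lra.
have c0 : 0 < c by lra.
pose e := c^-1.
have e0 : 0 < e by rewrite invr_gt0.
have e1 : e <= 1 by rewrite invf_le1.
have ce : c * e = 1 by rewrite mulfV // gt_eqF.
have ce' : e + D * e + (D * b ^+ 2) * e = 1 by rewrite -ce /c; ring.
have De0 : 0 <= D * e by rewrite mulr_ge0 // ltW.
have Dbe0 : 0 <= (D * b ^+ 2) * e by rewrite mulr_ge0 // ltW.
have Ce : C * e <= D * e by rewrite ler_wpM2r // ltW.
have Ce' : - (D * e) <= C * e by rewrite -mulNr ler_wpM2r // ltW.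
have be0 : 0 < b ^+ 2 * e by rewrite mulr_gt0.
have E : C * (b * e) ^+ 2 = (b ^+ 2 * e) * (C * e) by ring.
have lo : - ((D * b ^+ 2) * e) <= (b ^+ 2 * e) * (C * e).
  have -> : - ((D * b ^+ 2) * e) = (b ^+ 2 * e) * - D by ring.
  rewrite ler_wpM2l ?(ltW be0) // (le_trans _ Ce') // lerN2.
  by rewrite ler_piMr.
have hi : (b ^+ 2 * e) * (C * e) < b ^+ 2 * e by rewrite gtr_pMr //; lra.
have := key (b * e); rewrite E.
have -> : b * e * b = b ^+ 2 * e by ring.
have sq : 0 <= (b ^+ 2 * e) ^+ 2 by rewrite sqr_ge0.
move=> /(_ _ _)/le_trans; have -> : (1 + b ^+ 2 * e) ^+ 2 =
  1 + 2 * (b ^+ 2 * e) + (b ^+ 2 * e) ^+ 2 by ring.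
move=> H.
have h1 : 0 < 1 + b ^+ 2 * e * (C * e) by lra.
have h2 : 0 <= 1 + b ^+ 2 * e by lra.
by have := H _ h1 h2 (lexx _); lra.
Qed.

Section FirstCousin.
Context {n p : nat} (G : 'M[R]_n) (a : 'M[R]_(p.+1, n) -> R).
Hypotheses (pG : posdef G) (alt : alternating_form a).
Hypothesis comass : forall W, \det (gram G W) = 1 -> a W <= 1.

(** Homogeneity: divide one row by the volume of the frame. *)
Lemma comass_sqrt W : 0 < \det (gram G W) -> a W <= Num.sqrt (\det (gram G W)).
Proof.
set q := \det _ => q0; set r := Num.sqrt q.
have r0 : 0 < r by rewrite sqrtr_gt0.
pose A : 'M[R]_p.+1 := diag_mx (\row_i if i == 0 then r^-1 else 1).
have dA : \det A = r^-1.
  rewrite det_diag (bigD1 0) //= !mxE eqxx big1 ?mulr1 // => i /negPf i0.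
  by rewrite !mxE i0.
have := @comass (A *m W).
rewrite gram_mulmx !det_mulmx det_tr alternating_mulmx // dA -/q.
have -> : q = r * r by rewrite -expr2 sqr_sqrtr ?ltW.
rewrite mulKf ?gt_eqF //.
by rewrite mulfV ?gt_eqF // mulrC ler_pdivrMr // mul1r; apply.
Qed.

Variables (V : 'M[R]_(p.+1, n)).
Hypotheses (V1 : \det (gram G V) = 1) (aV : a V = 1).

(** Tilting the i-th vector by t w, with w orthogonal to the plane, multiplies the
    squared volume by 1 + O(t^2), while [a] varies linearly in t. As [a] is at
    most the volume, with equality at t = 0, its slope is 0. *)
Lemma first_cousin i (w : 'rV[R]_n) :
  w *m G *m V^T = 0 -> a (set_row i w V) = 0.
Proof.
move=> wV; set b := a _.
pose C := inner G w w * cofactor (gram G V) i i.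
pose W t := set_row i (row i V + t *: w) V.
have aW t : a (W t) = 1 + t * b.
  rewrite /W -[row i V]scale1r (alternating_multilinear alt) set_row_id aV.
  by rewrite mul1r.
have Vw : V *m G *m w^T = 0.
  by apply: trmx_inj; rewrite !trmx_mul trmxK pG.1 mulmxA wV trmx0.
have wl l : inner G w (row l V) = 0.
  move/matrixP/(_ 0 l): wV; rewrite [RHS]mxE => <-.
  by rewrite /inner [LHS]mxE [RHS]mxE; apply: eq_bigr => m _; rewrite !mxE.
have lw l : inner G (row l V) w = 0.
  by rewrite /inner -row_mul -[_ *m w^T]row_mul Vw !mxE.
have gW t : \det (gram G (W t)) = 1 + C * t ^+ 2.
  have gE l m : gram G (W t) l m =
     gram G V l m + ((l == i) && (m == i))%:R * (t ^+ 2 * inner G w w).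
    rewrite !gram_inner !row_set_row -/(inner G w w).
    case: (l == i) / eqP => [->|_]; case: (m == i) / eqP => [->|_] /=.
    + by rewrite innerDl !innerDr !innerZl !innerZr !(wl, lw); ring.
    + by rewrite innerDl innerZl wl; ring.
    + by rewrite innerDr innerZr lw; ring.
    + by rewrite mul0r addr0.
  rewrite (expand_det_row _ i) -V1 (expand_det_row (gram G V) i).
  have cof m : cofactor (gram G (W t)) i m = cofactor (gram G V) i m.
    congr (_ * \det _); apply/matrixP => l m'.
    rewrite [LHS]mxE [LHS]mxE [RHS]mxE [RHS]mxE gE.
    by rewrite eq_sym (negPf (neq_lift _ _)) mul0r addr0.
  rewrite (bigD1 i) //= [X in _ = X + _](bigD1 i) //= addrAC.
  rewrite (eq_bigr (fun m => gram G V i m * cofactor (gram G V) i m)).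
    by rewrite gE cof !eqxx /= mul1r mulrDl; congr (_ + _ + _); rewrite -mulrA mulrC.
  by move=> m /negPf mi; rewrite gE mi andbF mul0r addr0 cof.
have key t : 0 < 1 + C * t ^+ 2 -> 0 <= 1 + t * b ->
    (1 + t * b) ^+ 2 <= 1 + C * t ^+ 2.
  move=> q0 b0; have := @comass_sqrt (W t); rewrite gW aW => /(_ q0) le.
  by rewrite -[X in _ <= X](sqr_sqrtr (ltW q0)) ler_pXn2r // nnegrE sqrtr_ge0.
exact: slope_eq0 key.
Qed.

(** By the first cousin principle only the projection of w to the plane matters;
    the alternating sum is then the squared length of this projection. *)
Lemma first_cousin_ge0 (w : 'rV[R]_n) :
  0 <= alt_sum (fun u W => (u *m G *m w^T) 0 0 * a (col_mx w W)) V.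
Proof.
(* The row c holds the coordinates in V of the projection of w to the plane. *)
pose c := w *m G *m V^T *m invmx (gram G V).
have uV : gram G V \in unitmx by rewrite unitmxE V1 unitr1.
pose w' := w - c *m V.
have w'V : w' *m G *m V^T = 0.
  rewrite /w' !mulmxBl -!mulmxA [V *m (G *m _)]mulmxA -/(gram G V).
  by rewrite mulVmx // mulmx1 subrr.
have aw i : a (set_row i w V) = c 0 i.
  have wE : w = 1 *: (c *m V) + 1 *: w' by rewrite !scale1r /w' addrC subrK.
  rewrite {1}wE (alternating_multilinear alt) !mul1r (first_cousin _ w'V) addr0.
  rewrite mulmx_sum_row multilinear_sum; last exact: alternating_multilinear.
  rewrite (bigD1 i) //= set_row_id aV mulr1 big1 ?addr0 // => j ji.
  by rewrite (alt.2 _ i j) ?mulr0 1?eq_sym // !row_set_row eqxx (negPf ji).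
rewrite /alt_sum (eq_bigr (fun i => (V *m G *m w^T) i 0 * c 0 i)) => [|i _].
  have -> : \sum_i (V *m G *m w^T) i 0 * c 0 i = (c *m V *m G *m (c *m V)^T) 0 0.
    have Vw : V *m G *m w^T = gram G V *m c^T.
      apply: trmx_inj; rewrite [RHS]trmx_mul trmxK (gram_sym _ pG.1) [LHS]trmx_mul.
      by rewrite trmxK trmx_mul pG.1 mulmxA mulmxKV.
    have -> : c *m V *m G *m (c *m V)^T = c *m (V *m G *m w^T).
      by rewrite Vw /gram trmx_mul !mulmxA.
    rewrite [RHS]mxE.
    by apply: eq_bigr => i _; rewrite mulrC.
  exact: posdef_ge0.
rewrite mulrCA -alternating_front // aw; congr (_ * _).
by rewrite -row_mul -[_ *m w^T]row_mul mxE.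
Qed.

End FirstCousin.

End InnerProduct.

(** * Differentiability from continuous partial derivatives *)

Section Differentiability.
Context {R : realType} {n : nat}.
Implicit Types (f g : 'rV[R]_n -> R) (y v h : 'rV[R]_n).

Let e (i : 'I_n) : 'rV[R]_n := delta_mx 0 i.

Lemma coord_le_norm (v : 'rV[R]_n) i : `|v 0 i| <= `|v|.
Proof.
by rewrite [leRHS]/Num.Def.normr /= mx_normrE; exact: (le_bigmax _ _ (0, i)).
Qed.

Lemma norm_le_coord (v : 'rV[R]_n) (r : R) :
  0 <= r -> (forall i, `|v 0 i| <= r) -> `|v| <= r.
Proof.
move=> r0 vr; rewrite [leLHS]/Num.Def.normr /= mx_normrE.
by apply: bigmax_le => // -[a i] _ /=; rewrite ord1.
Qed.

Lemma derive_along f y v (s : R) : derivable f (y + s *: v) v ->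
  is_derive s (1 : R) (fun t : R => f (y + t *: v)) ('D_v f (y + s *: v)).
Proof.
have E : (fun h : R => h^-1 *: (f (y + (h *: 1 + s) *: v) - f (y + s *: v)))
    = (fun h : R => h^-1 *: (f (h *: v + (y + s *: v)) - f (y + s *: v))).
  apply/funext => h; congr (_ *: (f _ - _)).
  by rewrite scalerDl addrCA /GRing.scale /= mulr1.
by move=> fv; apply: DeriveDef; rewrite /derivable /derive /= E.
Qed.

Lemma MVT_along f y v (t : R) :
  (forall s : R, `|s| <= `|t| -> derivable f (y + s *: v) v) ->
  exists2 s : R, `|s| <= `|t| & f (y + t *: v) - f y = t * 'D_v f (y + s *: v).
Proof.
move=> fd; pose F (s : R) := f (y + s *: v).
have Fd (s : R) : `|s| <= `|t| -> is_derive (s : R) (1 : R) F ('D_v f (y + s *: v)).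
  by move=> /fd; exact: derive_along.
have F0 : F 0 = f y by rewrite /F scale0r addr0.
have Fc (s : R) : `|s| <= `|t| -> {for s, continuous F}.
  move=> /Fd[Fs _]; apply: differentiable_continuous.
  exact/derivable1_diffP.
have [t0|t0] := leP 0 t.
  have st (s : R) : s \in `[0, t]%R -> `|s| <= `|t|.
    by rewrite in_itv /= => /andP[s0 st]; rewrite !ger0_norm.
  have [s sI E] := @MVT_segment R F (fun s => 'D_v f (y + s *: v)) 0 t t0
      (fun s sI => Fd s (st s (subset_itv_oo_cc sI)))
      (continuous_in_subspaceT (fun s sI => Fc s (st s (set_mem sI)))).
  exists s; first exact: st.
  by rewrite -F0 -/(F t) E subr0 mulrC.
have st (s : R) : s \in `[t, 0]%R -> `|s| <= `|t|.
  by rewrite in_itv /= => /andP[s0 s1]; rewrite !ler0_norm ?lerN2 // ltW.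
have [s sI E] := @MVT_segment R F (fun s => 'D_v f (y + s *: v)) t 0 (ltW t0)
    (fun s sI => Fd s (st s (subset_itv_oo_cc sI)))
    (continuous_in_subspaceT (fun s sI => Fc s (st s (set_mem sI)))).
exists s; first exact: st.
by rewrite -F0 -/(F t) -opprB E sub0r mulrN opprK mulrC.
Qed.

(** Move from y to y + h along the axes, one coordinate at a time, applying the
    mean value theorem to each step. *)
Lemma lipschitz_partials g y (r c : R) : 0 <= c ->
  (forall z i, `|z - y| < r -> derivable g z (e i)) ->
  (forall z i, `|z - y| < r -> `|'D_(e i) g z| <= c) ->
  forall h, `|h| < r -> `|g (y + h) - g y| <= n%:R * (c * `|h|).
Proof.
move=> c0 gd gc h hr.
pose P m : 'rV[R]_n := \row_i (if (i < m)%N then h 0 i else 0).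
suff H m : (m <= n)%N -> `|g (y + P m) - g y| <= m%:R * (c * `|h|).
  have Pn : P n = h by apply/rowP => i; rewrite mxE ltn_ord.
  by rewrite -{1}Pn; exact: H.
elim: m => [_|m IHm mn].
  have -> : P 0%N = 0 by apply/rowP => i; rewrite !mxE.
  by rewrite addr0 subrr normr0 mul0r.
pose i := Ordinal mn.
have PS : P m.+1 = P m + h 0 i *: e i.
  apply/rowP => j; rewrite !mxE eqxx /= ltnS leq_eqVlt.
  have [->|ji] := eqVneq j i; first by rewrite eqxx /= ltnn mulr1 add0r.
  by rewrite (_ : (_ == m :> nat) = false) ?mulr0 ?addr0 //; apply/negbTE.
have Ps (s : R) : `|s| <= `|h 0 i| -> `|y + P m + s *: e i - y| < r.
  move=> sh; rewrite addrAC (addrAC y) subrr add0r.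
  apply: le_lt_trans hr; apply: norm_le_coord => // j; rewrite !mxE eqxx /=.
  have [->|ji] := eqVneq j i.
    by rewrite /= ltnn add0r mulr1 (le_trans sh) // coord_le_norm.
  by rewrite mulr0 addr0; case: ifP => _; rewrite ?normr0 ?coord_le_norm.
have [s sh E] := @MVT_along g (y + P m) (e i) (h 0 i)
  (fun s sh => gd _ _ (Ps s sh)).
rewrite PS addrA -[g _](subrK (g (y + P m))) E -addrA.
rewrite (le_trans (ler_normD _ _)) // -natr1 mulrDl mul1r [leRHS]addrC lerD //.
  by rewrite normrM mulrC ler_pM // ?coord_le_norm // gc // Ps.
by apply: IHm; exact: ltnW.
Qed.

(** After subtraction of the linear map l built from the partial derivatives at y,
    the partial derivatives become small near y; [lipschitz_partials] then
    bounds the remainder. *)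
Lemma C1_differentiable f y :
  (\forall z \near y, forall i, derivable f z (e i)) ->
  (forall i, {for y, continuous ('D_(e i) f)}) -> differentiable f y.
Proof.
move=> fd fc.
pose l (z : 'rV[R]_n) : R := \sum_(i < n) 'D_(e i) f y *: z 0 i.
have lE : l = \sum_(i < n) ('D_(e i) f y *: (fun z : 'rV[R]_n => z 0 i : R)).
  by apply/funext => z; rewrite fct_sumE.
have dl z : differentiable l z.
  rewrite lE; apply: differentiable_sum => i; apply: differentiableZ.
  exact: differentiable_coord.
have Dl i z : 'D_(e i) l z = 'D_(e i) f y.
  rewrite lE derive_sum => [|j]; last first.
    by apply: derivableZ; apply: diff_derivable; exact: differentiable_coord.
  rewrite (bigD1 i) //= big1 ?addr0 => [|j ji]; last first.
    rewrite deriveZ; last by apply: diff_derivable; exact: differentiable_coord.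
    have /derive_mx := @derivable_id R _ z (e i).
    rewrite derive_id => /matrixP/(_ 0 j); rewrite [RHS]mxE => <-.
    by rewrite mxE (negPf ji) andbF scaler0.
  rewrite deriveZ; last by apply: diff_derivable; exact: differentiable_coord.
  have /derive_mx := @derivable_id R _ z (e i).
  rewrite derive_id => /matrixP/(_ 0 i); rewrite [RHS]mxE => <-.
  by rewrite mxE !eqxx /GRing.scale /= mulr1.
pose g : 'rV[R]_n -> R := f - l.
suff dg : differentiable g y.
  by rewrite (_ : f = g + l); [exact: differentiableD|rewrite /g subrK].
have gd : \forall z \near y, forall i, derivable g z (e i).
  near=> z => i; apply: derivableB; last exact: diff_derivable.
  by move: i; near: z.
have gD : \forall z \near y, forall i, 'D_(e i) g z = 'D_(e i) f z - 'D_(e i) f y.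
  apply: filterS fd => z fz i.
  by rewrite -(Dl i z) -(deriveB (fz i) (diff_derivable (dl z))).
pose z0 : {linear 'rV[R]_n -> R} := \0.
have c0 : continuous z0 by move=> z; exact: cst_continuous.
have U := @diff_unique R 'rV[R]_n R g z0 y c0.
(* The hypothesis of [diff_unique]: the increment of g is a little-o of h. *)
suff E0 : ltac:(match type of U with ?P -> _ => exact P end).
  by apply/diff_locallyP; rewrite (U E0).
move=> {U}.
apply/eqaddoP => _/posnumP[eps].
have n0 : 0 < n%:R + 1 :> R by rewrite ltr_wpDl.
pose c := eps%:num / (n%:R + 1).
have k0 : 0 < c by rewrite divr_gt0.
have near_ci i : \forall z \near y, `|'D_(e i) f z - 'D_(e i) f y| <= c.
  have /cvgrPdist_le/(_ c k0) := fc i.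
  by apply: filterS => z; rewrite distrC.
have near_c : \forall z \near y, forall i, `|'D_(e i) f z - 'D_(e i) f y| <= c.
  exact: (filter_forall _ near_ci).
have /nbhs_ballP[r /= r0 Hr] : \forall z \near y,
   forall i, derivable g z (e i) /\ `|'D_(e i) g z| <= c.
  near=> z => i; split; first by move: i; near: z.
  have -> : 'D_(e i) g z = 'D_(e i) f z - 'D_(e i) f y by move: i; near: z.
  by move: i; near: z.
apply/nbhs_ballP; exists r => //= h; rewrite -ball_normE /= sub0r normrN => hr.
rewrite !fctE /= addr0 addrC [h + y]addrC.
have Hz z : `|z - y| < r -> ball y r z by rewrite -ball_normE /= distrC.
have := @lipschitz_partials g y r c (ltW k0)
  (fun z i zr => (Hr z (Hz z zr) i).1) (fun z i zr => (Hr z (Hz z zr) i).2) h hr.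
rewrite addrC => /le_trans; apply.
rewrite mulrA ler_wpM2r // /c mulrCA ger_pMr //.
by rewrite ler_pdivrMr // mul1r lerDl.
Unshelve. all: by end_near. Qed.

End Differentiability.

(** * Symmetry of second derivatives, chain rule *)

Section Partials.
Context {R : realType} {n : nat}.
Implicit Types (f g : 'rV[R]_n -> R) (y v h : 'rV[R]_n) (U : set 'rV[R]_n).

Let e (i : 'I_n) : 'rV[R]_n := delta_mx 0 i.

Lemma smooth_partial U f i : smooth_on U f -> smooth_on U ('D_(e i) f).
Proof.
move=> sf s y Uy; rewrite (_ : iter_partial s _ = iter_partial (rcons s i) f).
  exact: sf.
by rewrite /iter_partial foldr_rcons.
Qed.

Lemma smooth_continuous U f y : smooth_on U f -> U y -> {for y, continuous f}.
Proof. by move=> sf Uy; have [] := sf [::] y Uy. Qed.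

Lemma smooth_differentiable U f y : open U -> smooth_on U f -> U y ->
  differentiable f y.
Proof.
move=> oU sf Uy; apply: C1_differentiable => [|i].
  apply: filterS (open_nbhs_nbhs (conj oU Uy)) => z Uz i.
  by have [_] := sf [::] z Uz; exact.
by have [] := sf [:: i] y Uy.
Qed.

Lemma smooth_derivable U f y v : open U -> smooth_on U f -> U y ->
  derivable f y v.
Proof. by move=> oU sf Uy; exact/diff_derivable/(smooth_differentiable oU sf). Qed.

Lemma is_derive_translate f z c v : derivable f (z + c) v ->
  is_derive z v (fun z => f (z + c)) ('D_v f (z + c)).
Proof.
have E : (fun h : R => h^-1 *: (f ((h *: v + z) + c) - f (z + c)))
    = (fun h : R => h^-1 *: (f (h *: v + (z + c)) - f (z + c))).
  by apply/funext => h; rewrite addrA.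
by move=> fv; apply: DeriveDef; rewrite /derivable /derive /= E.
Qed.

(** The mean value theorem in direction i for the increment of f in direction j,
    then in direction j for the i-th partial derivative. *)
Lemma second_difference f y i j (t r : R) : 0 < t -> t + t < r ->
  (forall z, `|z - y| < r ->
     derivable f z (e i) /\ derivable ('D_(e i) f) z (e j)) ->
  exists2 z, `|z - y| < r &
    f (y + t *: e i + t *: e j) - f (y + t *: e i) - (f (y + t *: e j) - f y) =
    t * (t * 'D_(e j) ('D_(e i) f) z).
Proof.
move=> t0 tr fd.
have ne k : `|e k| <= 1.
  apply: norm_le_coord => // l; rewrite mxE eqxx /=.
  by case: (l == k); rewrite ?normr1 ?normr0.
have nse k (s : R) : `|s| <= `|t| -> `|s *: e k| <= t.
  move=> st; rewrite normrZ (le_trans (ler_pM _ _ st (ne k))) //.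
  by rewrite mulr1 gtr0_norm.
have nr k l (s s' : R) : `|s| <= `|t| -> `|s'| <= `|t| ->
    `|y + s *: e k + s' *: e l - y| < r.
  move=> ss ss'; rewrite addrAC (addrAC y) subrr add0r.
  by apply: le_lt_trans tr; rewrite (le_trans (ler_normD _ _)) // lerD // nse.
have nr1 k (s : R) : `|s| <= `|t| -> `|y + s *: e k - y| < r.
  move=> ss; have := nr k k s 0 ss; rewrite scale0r addr0; apply.
  by rewrite normr0.
pose F z := f (z + t *: e j) - f z.
have Fd (s : R) : `|s| <= `|t| -> is_derive (y + s *: e i) (e i) F
   ('D_(e i) f (y + s *: e i + t *: e j) - 'D_(e i) f (y + s *: e i)).
  move=> st; apply: is_deriveB.
    by apply: is_derive_translate; exact: (fd _ (nr i j s t st (lexx _))).1.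
  by apply: derivableP; exact: (fd _ (nr1 i s st)).1.
have [s st E] := MVT_along (fun s st => @ex_derive _ _ _ _ _ _ _ (Fd s st)).
have [s' st' E'] := @MVT_along R n ('D_(e i) f) (y + s *: e i) (e j) t
  (fun s' st' => (fd _ (nr i j s s' st st')).2).
exists (y + s *: e i + s' *: e j); first exact: nr.
by rewrite -E' -(@derive_val _ _ _ _ _ _ _ (Fd s st)) -E.
Qed.

(** The second difference is symmetric in the two directions, so the two mixed
    derivatives agree at two points close to y; let these tend to y. *)
Lemma partialC U f y i j : open U -> smooth_on U f -> U y ->
  'D_(e i) ('D_(e j) f) y = 'D_(e j) ('D_(e i) f) y.
Proof.
move=> oU sf Uy; apply/eqP; rewrite -subr_eq0 -normr_eq0; apply: contraT => ab.
set a := 'D_(e i) _ y in ab *; set b := 'D_(e j) _ y in ab *.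
pose eps := `|a - b| / 2.
have eps0 : 0 < eps by rewrite divr_gt0 // lt_def ab /=.
have [cij _] := sf [:: i; j] y Uy.
have [cji _] := sf [:: j; i] y Uy.
have /nbhs_ballP[r /= r0 Hr] : \forall z \near y,
    [/\ U z, `|a - 'D_(e i) ('D_(e j) f) z| < eps
           & `|b - 'D_(e j) ('D_(e i) f) z| < eps].
  have /cvgrPdist_lt/(_ eps eps0) na := cij.
  have /cvgrPdist_lt/(_ eps eps0) nb := cji.
  have nU := open_nbhs_nbhs (conj oU Uy).
  apply: filterS3 nU na nb => z h1 h2 h3; exact: (And3 h1 h2 h3).
have {}Hr z : `|z - y| < r -> [/\ U z, `|a - 'D_(e i) ('D_(e j) f) z| < eps
           & `|b - 'D_(e j) ('D_(e i) f) z| < eps].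
  by move=> zr; apply: Hr; rewrite -ball_normE /= distrC.
have Hd k l z : `|z - y| < r ->
     derivable f z (e k) /\ derivable ('D_(e k) f) z (e l).
  move=> /Hr[Uz _ _].
  exact: (conj ((sf [::] z Uz).2 k) ((sf [:: k] z Uz).2 l)).
pose t := r / 3.
have t0 : 0 < t by rewrite divr_gt0.
have tr : t + t < r by rewrite /t; lra.
have [z1 /Hr[_ _ z1b] E1] := second_difference t0 tr (Hd i j).
have [z2 /Hr[_ z2a _] E2] := second_difference t0 tr (Hd j i).
have E : 'D_(e i) ('D_(e j) f) z2 = 'D_(e j) ('D_(e i) f) z1.
  have t1 : t != 0 by rewrite gt_eqF.
  apply: (mulfI t1); apply: (mulfI t1).
  apply: etrans (esym E2) (etrans _ E1).
  by rewrite [y + t *: e j + _]addrAC; ring.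
have := ler_normB (a - 'D_(e i) ('D_(e j) f) z2) (b - 'D_(e i) ('D_(e j) f) z2).
rewrite opprB addrA subrK => /le_lt_trans/(_ (ltrD z2a _)).
by rewrite {1}E => /(_ _ z1b); rewrite /eps -splitr ltxx.
Qed.

Lemma derive_coord f y v : differentiable f y ->
  'D_v f y = \sum_j v 0 j * 'D_(e j) f y.
Proof.
move=> df; rewrite deriveE // {1}(row_sum_delta v) linear_sum /=.
by apply: eq_bigr => j _; rewrite linearZ deriveE.
Qed.

Lemma derive_linear f y (a b : R) u v : differentiable f y ->
  'D_(a *: u + b *: v) f y = a * 'D_u f y + b * 'D_v f y.
Proof. by move=> df; rewrite !deriveE // linearD !linearZ. Qed.

Lemma derive_coordinate (i : 'I_n) y v :
  is_derive y v (fun z : 'rV[R]_n => z 0 i) (v 0 i).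
Proof.
have D : derivable (fun z : 'rV[R]_n => z 0 i : R) y v.
  by apply: diff_derivable; exact: differentiable_coord.
apply: DeriveDef => //.
have /derive_mx := @derivable_id R _ y v.
by rewrite derive_id => /matrixP/(_ 0 i); rewrite [RHS]mxE => <-.
Qed.

Lemma derivable_bigsum (I : Type) (r : seq I) (F : I -> 'rV[R]_n -> R) y v :
  (forall i, derivable (F i) y v) ->
  is_derive y v (fun z => \sum_(i <- r) F i z) (\sum_(i <- r) 'D_v (F i) y).
Proof.
move=> Fd; elim: r => [|i r IHr].
  rewrite big_nil (_ : (fun _ => _) = cst 0); first exact: is_derive_cst.
  by apply/funext => z; rewrite big_nil.
rewrite big_cons (_ : (fun _ => _) = F i + (fun z => \sum_(i <- r) F i z)).
  by apply: is_deriveD => //; exact: derivableP.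
by apply/funext => z; rewrite big_cons.
Qed.

End Partials.

Section Chain.
Context {R : realType} {n m : nat}.
Implicit Types (F : 'rV[R]_n -> 'rV[R]_m) (f : 'rV[R]_m -> R) (y v : 'rV[R]_n).

Lemma differentiable_rV F y :
  (forall j, differentiable (fun z => F z 0 j) y) -> differentiable F y.
Proof.
move=> dF.
rewrite (_ : F = \sum_(j < m) (fun z => F z 0 j *: (delta_mx 0 j : 'rV[R]_m))).
  by apply: differentiable_sum => j; exact: differentiableZl.
by apply/funext => z; rewrite fct_sumE [LHS]row_sum_delta.
Qed.

Lemma derive_rV F y v : differentiable F y ->
  'D_v F y = \row_j 'D_v (fun z => F z 0 j) y.
Proof.
move=> dF; rewrite derive_mx; last exact: diff_derivable.
by apply/rowP => j; rewrite !mxE.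
Qed.

Lemma derive_comp F f y v : differentiable F y -> differentiable f (F y) ->
  'D_v (f \o F) y = 'D_('D_v F y) f (F y).
Proof.
move=> dF df; rewrite !deriveE //; last exact: differentiable_comp.
by rewrite diff_comp.
Qed.

Lemma jacobianE F y i j : differentiable F y ->
  jacobian F y i j = 'D_(delta_mx 0 i) (fun z => F z 0 j) y.
Proof.
move=> dF; have := deriveEjacobian (delta_mx 0 i) dF.
by rewrite -rowE derive_rV // => /rowP/(_ j); rewrite !mxE.
Qed.

End Chain.

Lemma is_derive_comp1 (R : realType) n (theta : R -> R) (f : 'rV[R]_n -> R) y v :
  derivable theta (f y) 1 -> differentiable f y ->
  is_derive y v (theta \o f) (theta^`()%classic (f y) * 'D_v f y).
Proof.
move=> dt df; have dt' : differentiable theta (f y) by exact/derivable1_diffP.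
apply: DeriveDef; first exact/diff_derivable/differentiable_comp.
rewrite deriveE; last exact: differentiable_comp.
by rewrite diff_comp //= deriveE // deriv1E // mulrC.
Qed.

(** * Closure properties of smooth functions *)

Section SmoothClosure.
Context {R : realType}.

Lemma derive_eq_on n (U : set 'rV[R]_n) (f g : 'rV[R]_n -> R) y v : open U ->
  (forall z, U z -> f z = g z) -> U y -> 'D_v f y = 'D_v g y.
Proof.
move=> oU fg Uy; apply: near_eq_derive.
exact: filterS fg (open_nbhs_nbhs (conj oU Uy)).
Qed.

Lemma continuous_near_eq (V : topologicalType) (f g : V -> R) (y : V) :
  {near y, g =1 f} -> {for y, continuous g} -> {for y, continuous f}.
Proof.
move=> E cg; have cg' : g z @[z --> y] --> g y by exact: cg.
have : f z @[z --> y] --> f y; last by [].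
rewrite -(nbhs_singleton E); apply: cvg_trans cg'.
by apply: near_eq_cvg; apply: filterS E => z ->.
Qed.

(** Smoothness speaks of all iterated partial derivatives at once. It is enough to
    find a class of differentiable functions which is stable under partial
    derivatives, up to equality on U. *)
Lemma smooth_on_coind n (U : set 'rV[R]_n) (P : ('rV[R]_n -> R) -> Prop) :
  open U -> (forall f, P f -> forall y, U y -> differentiable f y) ->
  (forall f, P f -> forall i, exists2 g, P g &
     forall y, U y -> 'D_(delta_mx 0 i) f y = g y) ->
  forall f, P f -> smooth_on U f.
Proof.
move=> oU dP DP f Pf.
have key s : exists2 g, P g & forall y, U y -> iter_partial s f y = g y.
  elim: s => [|i s [g Pg fg]]; first by exists f.
  have [h Ph gh] := DP g Pg i; exists h => // y Uy.
  rewrite -(gh y Uy) /=; exact: (derive_eq_on _ oU fg Uy).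
move=> s y Uy; have [g Pg fg] := key s.
have E : {near y, g =1 iter_partial s f}.
  apply: filterS (open_nbhs_nbhs (conj oU Uy)) => z Uz; exact: esym (fg z Uz).
split=> [|i].
  exact: (continuous_near_eq E (differentiable_continuous (dP g Pg y Uy))).
exact: (near_eq_derivable E (diff_derivable (dP g Pg y Uy))).
Qed.

Lemma smooth_on_eq n (U : set 'rV[R]_n) (f g : 'rV[R]_n -> R) : open U ->
  (forall y, U y -> f y = g y) -> smooth_on U g -> smooth_on U f.
Proof.
move=> oU fg sg.
have key s y : U y -> iter_partial s f y = iter_partial s g y.
  elim: s y => [|i s IHs] y Uy /=; first exact: fg.
  exact: (derive_eq_on _ oU IHs Uy).
move=> s y Uy; have [cg dg] := sg s y Uy.
have E : {near y, iter_partial s g =1 iter_partial s f}.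
  apply: filterS (open_nbhs_nbhs (conj oU Uy)) => z Uz; exact: esym (key s z Uz).
split=> [|i]; first exact: (continuous_near_eq E cg).
exact: (near_eq_derivable E (dg i)).
Qed.

Lemma smooth_on_local n (U : set 'rV[R]_n) f :
  (forall y, U y -> exists2 V, V y & smooth_on V f) -> smooth_on U f.
Proof. by move=> H s y /H[V Vy sf]; exact: sf. Qed.

Definition smooth1 (theta : R -> R) :=
  forall k x, derivable (derive1n k theta) x 1.

Lemma smooth1_derive theta : smooth1 theta -> smooth1 (theta^`()%classic).
Proof. by move=> st k x; rewrite -derive1Sn; exact: st. Qed.

(** The chain and Leibniz rules express the derivative of a composite through sums,
    products and other composites; so no single closure property can be proved
    by coinduction on its own, but all of them together can. *)
Inductive generated n (U : set 'rV[R]_n) : ('rV[R]_n -> R) -> Prop :=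
| Gen_smooth f of smooth_on U f : generated U f
| Gen_cst c : generated U (cst c)
| Gen_coord i : generated U (fun y => y 0 i)
| Gen_add f g of generated U f & generated U g : generated U (f + g)
| Gen_mul f g of generated U f & generated U g : generated U (f * g)
| Gen_inv f of generated U f & (forall y, U y -> f y != 0) :
    generated U (fun y => (f y)^-1)
| Gen_comp1 theta f of smooth1 theta & generated U f : generated U (theta \o f)
| Gen_comp m (V : set 'rV[R]_m) f (F : 'rV[R]_n -> 'rV[R]_m) of
    open V & smooth_on V f & (forall y, U y -> V (F y)) &
    (forall j, smooth_on U (fun y => F y 0 j)) : generated U (f \o F).

Section Generated.
Context {n : nat} (U : set 'rV[R]_n) (oU : open U).
Implicit Types f g : 'rV[R]_n -> R.

Lemma generated_differentiable f y : generated U f -> U y -> differentiable f y.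
Proof.
move=> gf Uy; elim: gf => {f}.
- by move=> f sf; exact: smooth_differentiable Uy.
- by move=> c; exact: differentiable_cst.
- by move=> i; exact: differentiable_coord.
- by move=> f g _ df _ dg; exact: differentiableD.
- by move=> f g _ df _ dg; exact: differentiableM.
- by move=> f _ df f0; apply: differentiableV => //; exact: f0.
- move=> theta f st _ df; apply: differentiable_comp => //.
  exact/derivable1_diffP/(st 0%N).
- move=> m V f F oV sf FV sF; apply: differentiable_comp.
    by apply: differentiable_rV => j; exact: smooth_differentiable (sF j) Uy.
  by apply: smooth_differentiable sf _ => //; exact: FV.
Qed.

Lemma generated_sum (I : Type) (r : seq I) (F : I -> 'rV[R]_n -> R) :
  (forall i, generated U (F i)) -> generated U (fun y => \sum_(i <- r) F i y).
Proof.
move=> gF; elim: r => [|i r IHr].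
  rewrite (_ : (fun _ => _) = cst 0); first exact: Gen_cst.
  by apply/funext => y; rewrite big_nil.
rewrite (_ : (fun _ => _) = F i + (fun y => \sum_(i <- r) F i y)).
  exact: Gen_add.
by apply/funext => y; rewrite big_cons.
Qed.

Lemma generated_partial f i : generated U f ->
  exists2 g, generated U g & forall y, U y -> 'D_(delta_mx 0 i) f y = g y.
Proof.
have der h y : generated U h -> U y -> derivable h y (delta_mx 0 i).
  by move=> gh Uy; exact/diff_derivable/generated_differentiable.
elim=> {f}.
- move=> f sf; exists ('D_(delta_mx 0 i) f) => //.
  exact/Gen_smooth/smooth_partial.
- by move=> c; exists (cst 0) => [|y Uy]; [exact: Gen_cst|exact: derive_cst].
- move=> j; exists (cst ((delta_mx 0 i : 'rV[R]_n) 0 j)) => [|y Uy].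
    exact: Gen_cst.
  exact: (@derive_val _ _ _ _ _ _ _ (derive_coordinate j y (delta_mx 0 i))).
- move=> f g gf [f' gf' ff'] gg [g' gg' gg''].
  exists (f' + g'); first exact: Gen_add.
  by move=> y Uy; rewrite deriveD ?ff' ?gg'' //; exact: der.
- move=> f g gf [f' gf' ff'] gg [g' gg' gg''].
  exists (f * g' + g * f'); first by apply: Gen_add; exact: Gen_mul.
  by move=> y Uy; rewrite deriveM ?ff' ?gg'' //; exact: der.
- move=> f gf [f' gf' ff'] f0.
  (* The derivative of 1/f is - (1/f) (1/f) f'. *)
  exists (cst (-1) * (fun y => (f y)^-1) * (fun y => (f y)^-1) * f').
    apply: Gen_mul => //; apply: Gen_mul; last exact: Gen_inv.
    by apply: Gen_mul; [exact: Gen_cst|exact: Gen_inv].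
  move=> y Uy; rewrite deriveV ?f0 ?ff' //; last exact: der.
  rewrite -[RHS]/(-1 * (f y)^-1 * (f y)^-1 * f' y) mulN1r mulNr -exprVn expr2.
  by rewrite -scaleNr.
- move=> theta f st gf [f' gf' ff'].
  exists ((theta^`()%classic \o f) * f').
    by apply: Gen_mul => //; apply: Gen_comp1 => //; exact: smooth1_derive.
  move=> y Uy; rewrite -[RHS]/(theta^`()%classic (f y) * f' y) -ff' //.
  have := @is_derive_comp1 R n theta f y (delta_mx 0 i) (st 0%N _)
    (generated_differentiable gf Uy).
  by case.
- move=> m V f F oV sf FV sF.
  exists (fun y => \sum_j ((fun y => 'D_(delta_mx 0 i) (fun z => F z 0 j) y) *
                           ('D_(delta_mx 0 j) f \o F)) y).
    apply: generated_sum => j; apply: Gen_mul.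
      exact/Gen_smooth/smooth_partial.
    by apply: (@Gen_comp _ _ _ V) => //; exact: smooth_partial.
  move=> y Uy.
  have dF : differentiable F y.
    by apply: differentiable_rV => j; exact: smooth_differentiable (sF j) Uy.
  have df : differentiable f (F y).
    by apply: smooth_differentiable sf _ => //; exact: FV.
  rewrite derive_comp // derive_coord //; apply: eq_bigr => j _.
  by rewrite derive_rV // mxE.
Qed.

Lemma generated_smooth f : generated U f -> smooth_on U f.
Proof.
apply: (smooth_on_coind oU); last by move=> *; exact: generated_partial.
by move=> *; exact: generated_differentiable.
Qed.

Lemma smooth_cst (c : R) : smooth_on U (cst c).
Proof. exact/generated_smooth/Gen_cst. Qed.

Lemma smooth_coord i : smooth_on U (fun y : 'rV[R]_n => y 0 i).
Proof. exact/generated_smooth/Gen_coord. Qed.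

Lemma smoothD f g : smooth_on U f -> smooth_on U g ->
  smooth_on U (fun y => f y + g y).
Proof.
by move=> sf sg; apply: generated_smooth; apply: Gen_add; exact: Gen_smooth.
Qed.

Lemma smoothM f g : smooth_on U f -> smooth_on U g ->
  smooth_on U (fun y => f y * g y).
Proof.
by move=> sf sg; apply: generated_smooth; apply: Gen_mul; exact: Gen_smooth.
Qed.

Lemma smoothV f : smooth_on U f -> (forall y, U y -> f y != 0) ->
  smooth_on U (fun y => (f y)^-1).
Proof.
by move=> sf f0; apply: generated_smooth; apply: Gen_inv => //; exact: Gen_smooth.
Qed.

Lemma smooth_comp1 theta f : smooth1 theta -> smooth_on U f ->
  smooth_on U (theta \o f).
Proof.
by move=> st sf; apply: generated_smooth; apply: Gen_comp1 => //; exact: Gen_smooth.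
Qed.

Lemma smooth_comp m (V : set 'rV[R]_m) (f : 'rV[R]_m -> R) (F : 'rV[R]_n -> 'rV[R]_m) :
  open V -> smooth_on V f -> (forall y, U y -> V (F y)) ->
  (forall j, smooth_on U (fun y => F y 0 j)) -> smooth_on U (f \o F).
Proof. by move=> *; apply: generated_smooth; exact: (@Gen_comp _ _ _ V). Qed.

Lemma smooth_sum (I : Type) (r : seq I) (F : I -> 'rV[R]_n -> R) :
  (forall i, smooth_on U (F i)) -> smooth_on U (fun y => \sum_(i <- r) F i y).
Proof.
by move=> sF; apply/generated_smooth/generated_sum => i; exact: Gen_smooth.
Qed.

Lemma smooth_prod (I : Type) (r : seq I) (F : I -> 'rV[R]_n -> R) :
  (forall i, smooth_on U (F i)) -> smooth_on U (fun y => \prod_(i <- r) F i y).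
Proof.
move=> sF; elim: r => [|i r IHr].
  rewrite (_ : (fun _ => _) = cst 1); first exact: smooth_cst.
  by apply/funext => y; rewrite big_nil.
rewrite (_ : (fun _ => _) = (fun y => F i y * \prod_(i <- r) F i y)).
  exact: smoothM.
by apply/funext => y; rewrite big_cons.
Qed.

End Generated.

End SmoothClosure.

(** * A smooth convex function vanishing on a half-line *)

Section Flat.
Context {R : realType}.
Implicit Types (p : {poly R}) (t : R).

(** For s = 1/t these are the functions p(s) exp(t - s), extended by 0. The family is
    stable under derivation, which makes them smooth; the factor exp(t) makes
    exp(t - 1/t) convex on the whole half-line, which exp(-1/t) is not. *)
Definition flat p t : R := if 0 < t then p.[t^-1] * expR (t - t^-1) else 0.

(** With s = 1/t, the derivative of p(s) exp(t - s) in t is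
    (p(s) (1 + s^2) - s^2 p'(s)) exp(t - s). *)
Definition dflat p : {poly R} := p * (1 + 'X^2) - 'X^2 * p^`().

Lemma flat_le0 p t : t <= 0 -> flat p t = 0.
Proof. by rewrite /flat leNgt => /negPf->. Qed.

Lemma horner_bound p : exists2 M : R, 0 <= M &
  forall s : R, 1 <= s -> `|p.[s]| <= M * s ^+ size p.
Proof.
exists (\sum_(i < size p) `|p`_i|); first by apply: sumr_ge0.
move=> s s1; rewrite horner_coef mulr_suml (le_trans (ler_norm_sum _ _ _)) //.
apply: ler_sum => i _; rewrite normrM ler_wpM2l // ger0_norm.
  by rewrite ler_weXn2l // ltnW.
by rewrite exprn_ge0 // (le_trans _ s1).
Qed.

(** The exponential of s = 1/t dominates the power of s which is one more than
    needed to bound p(s), and the spare factor 1/s is t. *)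
Lemma flat_bound p : exists2 C : R, 0 <= C &
  forall t, `|t| < 1 -> `|flat p t| <= C * `|t|.
Proof.
have [M M0 HM] := horner_bound p.
pose N : R := (size p).+1`!%:R.
have N0 : 0 < N by rewrite ltr0n fact_gt0.
exists (M * expR 1 * N); first by rewrite !mulr_ge0 ?expR_ge0 // ltW.
move=> t; have [t0|t0] := leP t 0.
  by rewrite flat_le0 // normr0 !mulr_ge0 ?expR_ge0 // ltW.
rewrite gtr0_norm // => t1; rewrite /flat t0 normrM (ger0_norm (expR_ge0 _)).
pose s := t^-1.
have s0 : 0 < s by rewrite invr_gt0.
have s1 : 1 <= s by rewrite invf_ge1 // ltW.
have es : expR (- s) <= N / s ^+ (size p).+1.
  rewrite expRN -[leRHS]invrK lef_pV2 ?posrE ?expR_gt0 //; last first.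
    by rewrite invr_gt0 divr_gt0 // exprn_gt0.
  rewrite invf_div (le_trans _ (expR_ge1Dxn (size p) (ltW s0))) //.
  by rewrite lerDr.
have et : expR (t - s) <= expR 1 * (N / s ^+ (size p).+1).
  by rewrite expRD; apply: ler_pM es; rewrite ?expR_ge0 // ler_expR (ltW t1).
rewrite (le_trans (ler_pM _ _ (HM s s1) et)) ?expR_ge0 //.
rewrite exprSr invfM [N * _]mulrA !mulrA [in leLHS]mulrC invrK.
have sp : s ^+ size p != 0 by rewrite expf_neq0 // gt_eqF.
have -> : t * (M * s ^+ size p * expR 1 * N / s ^+ size p) =
  M * expR 1 * N * t * (s ^+ size p / s ^+ size p) by ring.
by rewrite divff // mulr1.
Qed.

Lemma flat_cvg0 p : flat p t @[t --> 0] --> 0.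
Proof.
have [C C0 HC] := flat_bound p.
apply/cvgrPdist_le => eps eps0.
apply/nbhs_ballP; exists (Num.min 1 (eps / (C + 1))) => /=.
  by rewrite lt_min ltr01 divr_gt0 // ltr_wpDl.
move=> t; rewrite /ball /= !sub0r !normrN lt_min => /andP[/HC t1 t2].
rewrite (le_trans t1) // -[leRHS](@divfK _ (C + 1)) ?gt_eqF ?ltr_wpDl //.
by rewrite mulrC ler_pM // ?(ltW t2) // lerDl.
Qed.

Lemma is_derive_flat p t : is_derive t 1 (flat p) (flat (dflat p) t).
Proof.
have [t0|t0|->] := ltgtP t 0.
- rewrite (flat_le0 _ (ltW t0)).
  have H0 : is_derive t (1 : R) (cst 0 : R -> R) 0 by exact: is_derive_cst.
  apply: near_eq_is_derive H0.
  by apply: filterS (lt_nbhsl t0) => z /ltW z0; rewrite flat_le0.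
- pose G : R -> R := (horner p \o GRing.inv) * (expR \o (id - GRing.inv)).
  have tN0 : t != 0 by rewrite gt_eqF.
  have H1 : is_derive t 1 (GRing.inv : R -> R) (- t ^- 2).
    apply: DeriveDef; first exact: (@derivableV _ _ id t 1).
    by rewrite (@deriveV _ _ id) // derive_id /GRing.scale /= mulr1.
  have H2 : is_derive t 1 (horner p \o GRing.inv) (p^`().[t^-1] * - t ^- 2).
    by have H := is_derive_poly p t^-1; exact: is_derive1_comp.
  have H3 : is_derive t 1 (expR \o (id - GRing.inv : R -> R))
      (expR (t - t^-1) * (1 - - t ^- 2)).
    have H := is_derive_expR (t - t^-1).
    apply: is_derive1_comp; exact: is_deriveB.
  have H4 := is_deriveM H2 H3.
  have E : \forall z \near t, G z = flat p z.
    by apply: filterS (lt_nbhsr t0) => z z0; rewrite /flat z0.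
  apply: (is_derive_eq (near_eq_is_derive E H4)).
  rewrite /flat t0 /dflat /GRing.scale /= !hornerE /=.
  by rewrite -!exprVn -[(id - _) t]/(t - t^-1); ring.
(* At t = 0 the difference quotient of [flat p] is [flat ('X * p)]. *)
- rewrite flat_le0 //.
  have cv : h^-1 *: (flat p (h *: 1 + 0) - flat p 0) @[h --> 0^'] --> (0 : R).
    have : flat ('X * p) h @[h --> 0^'] --> (0 : R).
      exact: (cvg_trans (cvg_app _ (cvg_within _)) (flat_cvg0 _)).
    apply: cvg_trans; apply: near_eq_cvg; near=> h.
    rewrite [in RHS](flat_le0 p (lexx 0)) subr0 addr0 /GRing.scale /= mulr1 /flat.
    by case: ifP => _; rewrite ?mulr0 // hornerM hornerX mulrA.
  by apply: DeriveDef; [apply/cvg_ex; exists 0|exact: cvg_lim cv].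
Unshelve. all: by end_near. Qed.

Lemma derive1n_flat k p : derive1n k (flat p) = flat (iter k dflat p).
Proof.
elim: k => [|k IHk] //; rewrite derive1nS IHk; apply/funext => t /=.
by rewrite derive1E; have [] := is_derive_flat (iter k dflat p) t.
Qed.

Lemma smooth1_flat p : smooth1 (flat p).
Proof. by move=> k t; rewrite derive1n_flat; have [] := is_derive_flat (iter k dflat p) t. Qed.

Definition ramp : R -> R := flat 1.

Lemma ramp_smooth : smooth1 ramp. Proof. exact: smooth1_flat. Qed.

Lemma ramp_eq0 t : t <= 0 -> ramp t = 0. Proof. exact: flat_le0. Qed.

Lemma ramp_gt0 t : 0 < t -> 0 < ramp t.
Proof. by move=> t0; rewrite /ramp /flat t0 hornerC mul1r expR_gt0. Qed.

Lemma ramp_ge0 t : 0 <= ramp t.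
Proof. by have [/ramp_eq0->|/ramp_gt0/ltW] := leP t 0. Qed.

Lemma drampE : ramp^`()%classic = flat (1 + 'X^2).
Proof.
rewrite -derive1n1 derive1n_flat /= /dflat mul1r.
by rewrite -polyC1 derivC mulr0 subr0.
Qed.

Lemma dramp_gt0 t : 0 < t -> 0 < ramp^`()%classic t.
Proof.
move=> t0; rewrite drampE /flat t0 !hornerE mulr_gt0 ?expR_gt0 //.
by rewrite ltr_pwDl // sqr_ge0.
Qed.

Lemma dramp_ge0 t : 0 <= ramp^`()%classic t.
Proof. by have [t0|/dramp_gt0/ltW//] := leP t 0; rewrite drampE flat_le0. Qed.

(** With s = 1/t, the second derivative is exp(t - s) times
    (1 + s^2)^2 - 2 s^3 = 1 + s^2 ((s - 1)^2 + 1). *)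
Lemma ddramp_ge0 t : 0 <= ramp^`()%classic^`()%classic t.
Proof.
rewrite drampE -derive1n1 derive1n_flat /= /flat; case: ifP => // t0.
rewrite mulr_ge0 ?expR_ge0 // /dflat derivD derivXn /=.
rewrite -polyC1 derivC add0r !hornerE /=.
set s := t^-1.
have -> : (1 + s ^+ 2) * (1 + s ^+ 2) - s ^+ 2 * (s *+ 2) =
  1 + s ^+ 2 * ((s - 1) ^+ 2 + 1) by ring.
by rewrite addr_ge0 // mulr_ge0 ?sqr_ge0 // addr_ge0 ?sqr_ge0.
Qed.

End Flat.

Section ShiftedRamp.
Context {R : realType}.

Lemma derive1_translate (q : R -> R) b :
  (fun t => q (t - b))^`()%classic = (fun t => q^`()%classic (t - b)).
Proof.
apply/funext => t; rewrite /derive1.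
by under eq_fun do rewrite -addrA.
Qed.

Lemma smooth1_translate (q : R -> R) b : smooth1 q -> smooth1 (fun t => q (t - b)).
Proof.
move=> sq k t.
have -> : derive1n k (fun t => q (t - b)) = (fun t => derive1n k q (t - b)).
  by elim: k => [//|k IHk]; rewrite !derive1nS IHk derive1_translate.
have := sq k (t - b); rewrite /derivable.
set u := fun _ => _; set v := fun _ => _; suff -> : u = v by [].
by apply/funext => h; rewrite /u /v /= addrA.
Qed.

End ShiftedRamp.

(** * Smooth matrices, derivative of a form along moving arguments *)

Section SmoothMatrices.
Context {R : realType} {n : nat} (U : set 'rV[R]_n) (oU : open U).

Lemma smoothZ (c : R) (f : 'rV[R]_n -> R) :
  smooth_on U f -> smooth_on U (fun y => c * f y).
Proof. by move=> sf; exact: (smoothM oU (smooth_cst oU c) sf). Qed.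

Lemma smooth_det k (A : 'rV[R]_n -> 'M[R]_k) :
  (forall i j, smooth_on U (fun y => A y i j)) ->
  smooth_on U (fun y => \det (A y)).
Proof.
move=> sA; apply: (smooth_sum oU) => s; apply: smoothZ.
by apply: (smooth_prod oU) => i; exact: sA.
Qed.

Lemma smooth_invmx k (A : 'rV[R]_n -> 'M[R]_k) :
  (forall i j, smooth_on U (fun y => A y i j)) ->
  (forall y, U y -> A y \in unitmx) ->
  forall i j, smooth_on U (fun y => invmx (A y) i j).
Proof.
move=> sA uA i j.
have E y : U y -> invmx (A y) i j = (\det (A y))^-1 * cofactor (A y) j i.
  by move=> Uy; rewrite /invmx (uA y Uy) mxE [X in _ * X]mxE.
apply: (smooth_on_eq oU E).
apply: (smoothM oU).
  apply: (smoothV oU); first exact: smooth_det.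
  by move=> y /uA; rewrite unitmxE unitfE.
apply: smoothZ; apply: smooth_det => a b.
by under eq_fun do rewrite 2!mxE; exact: sA.
Qed.

Lemma smooth_derive (f : 'rV[R]_n -> R) (v : 'rV[R]_n) :
  smooth_on U f -> smooth_on U ('D_v f).
Proof.
move=> sf.
have E y : U y -> 'D_v f y = \sum_j v 0 j * 'D_(delta_mx 0 j) f y.
  by move=> Uy; rewrite derive_coord //; exact: smooth_differentiable Uy.
apply: (smooth_on_eq oU E).
by apply: (smooth_sum oU) => j; apply: smoothZ; exact: smooth_partial.
Qed.

End SmoothMatrices.

Section Leibniz.
Context {R : realType} {n : nat}.
Implicit Types (y v : 'rV[R]_n).

Lemma is_derive_prod (I : eqType) (r : seq I) (F : I -> 'rV[R]_n -> R) y v :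
  uniq r -> (forall i, derivable (F i) y v) ->
  is_derive y v (fun z => \prod_(i <- r) F i z)
    (\sum_(k <- r) 'D_v (F k) y * \prod_(i <- r | i != k) F i y).
Proof.
move=> + dF; elim: r => [_|a r IHr /= /andP[ar ur]].
  rewrite big_nil (_ : (fun _ => _) = cst 1); first exact: is_derive_cst.
  by apply/funext => z; rewrite big_nil.
have E : (fun z => \prod_(i <- a :: r) F i z) =
    F a * (fun z => \prod_(i <- r) F i z).
  by apply/funext => z; rewrite big_cons.
rewrite E; apply: is_derive_eq (is_deriveM (derivableP (dF a)) (IHr ur)) _.
rewrite big_cons big_cons eqxx /= addrC /GRing.scale /=; congr (_ + _).
  rewrite mulrC; congr (_ * _); rewrite [RHS]big_seq_cond [LHS]big_seq.
  by apply: eq_bigl => i; case: eqVneq => [->|]; rewrite ?andbT // (negPf ar).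
rewrite mulr_sumr; apply: eq_big_seq => k kr.
have ak : a != k by apply: contraNneq ar => ->.
rewrite big_cons ak; exact: mulrCA.
Qed.

(** The form and its arguments both vary: the Leibniz rule for the expansion of A
    in the components of U. *)
Lemma derive_form k m (A : 'rV[R]_n -> 'M[R]_(k, m) -> R)
    (U : 'rV[R]_n -> 'M[R]_(k, m)) y v :
  (forall z, multilinear (A z)) -> (forall W, derivable (A ^~ W) y v) ->
  (forall i j, derivable (fun z => U z i j) y v) ->
  'D_v (fun z => A z (U z)) y = 'D_v (A ^~ (U y)) y +
    \sum_(i < k) A y (set_row i (\row_j 'D_v (fun z => U z i j) y) (U y)).
Proof.
move=> linA dA dU.
pose P (I : {ffun 'I_k -> 'I_m}) z := \prod_i U z i (I i).
have dP I : is_derive y v (P I) (\sum_i 'D_v (fun z => U z i (I i)) y *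
    \prod_(j | j != i) U y j (I j)).
  apply: is_derive_prod => [|i]; last exact: dU.
  exact: index_enum_uniq.
pose E (I : {ffun 'I_k -> 'I_m}) : 'M[R]_(k, m) := rowsub I 1%:M.
have D1 : 'D_v (fun z => A z (U z)) y = \sum_I 'D_v (P I * (A ^~ (E I))) y.
  rewrite (_ : (fun z => A z (U z)) =
     (fun z => \sum_I (P I * (A ^~ (E I))) z)); last first.
    by apply/funext => z; rewrite (multilinear_expand (linA z)).
  apply: (@derive_val _ _ _ _ _ _ _ (derivable_bigsum _ _)) => I.
  by apply: derivableM => //; case: (dP I).
have D2 : 'D_v (A ^~ (U y)) y = \sum_I P I y * 'D_v (A ^~ (E I)) y.
  rewrite (_ : A ^~ (U y) =
     (fun z => \sum_I (cst (P I y) * (A ^~ (E I))) z)); last first.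
    by apply/funext => z; rewrite (multilinear_expand (linA z)).
  rewrite (@derive_val _ _ _ _ _ _ _ (derivable_bigsum _ _)) => [|I].
    apply: eq_bigr => I _; rewrite (deriveM (derivable_cst (P I y) y v) (dA _)).
    by rewrite derive_cst scaler0 addr0.
  by apply: derivableM => //; exact: derivable_cst.
have D3 I : 'D_v (P I * (A ^~ (E I))) y = P I y * 'D_v (A ^~ (E I)) y +
    A y (E I) * \sum_i 'D_v (fun z => U z i (I i)) y *
      \prod_(j | j != i) U y j (I j).
  have [dPI PIE] := dP I.
  by rewrite (deriveM dPI (dA _)) PIE.
rewrite D1 D2 (eq_bigr _ (fun I _ => D3 I)).
rewrite big_split /=; congr (_ + _).
under [RHS]eq_bigr => i _ do rewrite (multilinear_expand (linA y)).
rewrite exchange_big /=; apply: eq_bigr => I _.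
rewrite mulr_sumr; apply: eq_bigr => i _.
rewrite mulrC; congr (_ * _).
rewrite [RHS](bigD1 i) //= set_rowE eqxx mxE; congr (_ * _).
by apply: eq_bigr => j /negPf ji; rewrite set_rowE ji.
Qed.

End Leibniz.

(** * Changes of charts *)

Section Charts.
Context {R : realType} {n : nat} (X : smooth_manifold R n).
Implicit Types (c : chart R n X) (x : X) (y : 'rV[R]_n).

Lemma cimageP c y : cimage c y -> cdom c (param c y) /\ coord c (param c y) = y.
Proof. by move=> [x xc <-]; rewrite coordK. Qed.

Lemma cimage_coord c x : cdom c x -> cimage c (coord c x).
Proof. by exists x. Qed.

Lemma cimage_isopen c : open (cimage c).
Proof. exact: cimage_open. Qed.
Arguments cimage_isopen c : clear implicits.

Lemma continuous_coord c x : cdom c x -> {for x, continuous (coord c)}.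
Proof.
move=> xc; have := @coord_continuous _ _ _ c.
by rewrite continuous_open_subspace; [apply; exact: mem_set|exact: cdom_open].
Qed.

Lemma continuous_param c y : cimage c y -> {for y, continuous (param c)}.
Proof.
move=> yc; have := @param_continuous _ _ _ c.
by rewrite continuous_open_subspace; [apply; exact: mem_set|exact: cimage_open].
Qed.

Definition overlap c c' : set 'rV[R]_n :=
  [set y | cimage c y /\ cdom c' (param c y)].

Definition transition c c' : 'rV[R]_n -> 'rV[R]_n := coord c' \o param c.

Lemma overlapE c c' : overlap c c' = coord c @` (cdom c `&` cdom c').
Proof.
apply/seteqP; split=> [y [yc yc']|_ [x [xc xc'] <-]].
  have [d e] := cimageP yc; by exists (param c y).
by split; [exact: cimage_coord|rewrite coordK].
Qed.

Lemma overlap_open c c' : open (overlap c c').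
Proof.
rewrite openE => y [yc yc']; rewrite /interior.
have n1 : \forall z \near y, cimage c z.
  exact: (open_nbhs_nbhs (conj (cimage_isopen c) yc)).
have n2 : \forall z \near y, cdom c' (param c z).
  have := continuous_param yc; apply.
  exact: (open_nbhs_nbhs (conj (@cdom_open _ _ _ c') yc')).
exact: (filterI n1 n2).
Qed.
Arguments overlap_open c c' : clear implicits.

Lemma overlap_transition c c' y : overlap c c' y ->
  overlap c' c (transition c c' y).
Proof.
move=> [yc yc']; split; first exact: cimage_coord.
by rewrite /transition /= coordK //; have [] := cimageP yc.
Qed.

Lemma overlap_cimage c c' y : overlap c c' y -> cimage c' (transition c c' y).
Proof. by move=> /overlap_transition[]. Qed.

Lemma param_transition c c' y : overlap c c' y ->
  param c' (transition c c' y) = param c y.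
Proof. by move=> [yc yc']; rewrite /transition /= coordK. Qed.

Lemma overlap_self c : overlap c c = cimage c.
Proof.
by apply/seteqP; split=> [y []//|y yc]; split => //; have [] := cimageP yc.
Qed.

Lemma smooth_transition_coord c c' j : atlas c -> atlas c' ->
  smooth_on (overlap c c') (fun y => transition c c' y 0 j).
Proof. by move=> ac ac'; rewrite overlapE; exact: atlas_smooth. Qed.

Lemma differentiable_transition c c' y : atlas c -> atlas c' ->
  overlap c c' y -> differentiable (transition c c') y.
Proof.
move=> ac ac' yo; apply: differentiable_rV => j.
exact: (smooth_differentiable (overlap_open c c')
  (smooth_transition_coord j ac ac') yo).
Qed.

Definition jac c c' y : 'M[R]_n := jacobian (transition c c') y.

Lemma derive_transition c c' y v : atlas c -> atlas c' -> overlap c c' y ->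
  'D_v (transition c c') y = v *m jac c c' y.
Proof.
by move=> ac ac' yo; exact/deriveEjacobian/differentiable_transition.
Qed.

(** The cocycle rule from which the tensorial behaviour of local expressions is
    derived. *)
Lemma jac_chain c c1 c2 y : atlas c -> atlas c1 -> atlas c2 ->
  overlap c c1 y -> overlap c c2 y ->
  jac c c2 y = jac c c1 y *m jac c1 c2 (transition c c1 y).
Proof.
move=> ac a1 a2 y1 y2.
have z2 : overlap c1 c2 (transition c c1 y).
  split; first exact: overlap_cimage.
  by rewrite param_transition //; case: y2.
have dF := differentiable_transition ac a1 y1.
have dG := differentiable_transition a1 a2 z2.
apply/row_matrixP => i; rewrite !rowE mulmxA.
apply: etrans (esym (derive_transition _ ac a2 y2)) _.
apply: etrans (derive_transition _ a1 a2 z2).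
have E : \forall z \near y,
    transition c c2 z = (transition c1 c2 \o transition c c1) z.
  apply: filterS (open_nbhs_nbhs (conj (overlap_open c c1) y1)) => z z1.
  by rewrite [RHS]/= /transition /= coordK //; case: z1.
apply: etrans (near_eq_derive _ E) _.
apply: etrans (deriveE _ (differentiable_comp dF dG)) _.
apply: etrans _ (esym (deriveE _ dG)).
have E1 : 'd (transition c c1) y (delta_mx 0 i) = delta_mx 0 i *m jac c c1 y.
  exact: etrans (esym (deriveE _ dF)) (derive_transition _ ac a1 y1).
rewrite -E1; exact: (congr1 (fun h => h (delta_mx 0 i)) (diff_comp dF dG)).
Qed.

Lemma jac_self c y : atlas c -> cimage c y -> jac c c y = 1%:M.
Proof.
move=> ac yc; apply/row_matrixP => i.
have yo : overlap c c y by rewrite overlap_self.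
have E : \forall z \near y, transition c c z = id z.
  apply: filterS (open_nbhs_nbhs (conj (cimage_isopen c) yc)) => z zc.
  by have [] := cimageP zc.
rewrite !rowE mulmx1; apply: etrans (esym (derive_transition _ ac ac yo)) _.
by apply: etrans (near_eq_derive _ E) _; rewrite derive_id.
Qed.

Lemma jac_inv c c' y : atlas c -> atlas c' -> overlap c c' y ->
  jac c c' y *m jac c' c (transition c c' y) = 1%:M.
Proof.
move=> ac ac' yo; rewrite -jac_chain //; first exact: jac_self (proj1 yo).
by rewrite overlap_self; case: yo.
Qed.

Lemma jac_unit c c' y : atlas c -> atlas c' -> overlap c c' y ->
  jac c c' y \in unitmx.
Proof. by move=> ac ac' yo; exact: (mulmx1_unit (jac_inv ac ac' yo)).1. Qed.

Lemma smooth_jac c c' i j : atlas c -> atlas c' ->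
  smooth_on (overlap c c') (fun y => jac c c' y i j).
Proof.
move=> ac ac'; have oO := overlap_open c c'.
have E y : overlap c c' y -> jac c c' y i j =
    'D_(delta_mx 0 i) (fun z => transition c c' z 0 j) y.
  by move=> yo; rewrite /jac jacobianE //; exact: differentiable_transition.
apply: (smooth_on_eq oO E); apply: smooth_partial.
exact: smooth_transition_coord.
Qed.

Lemma tangent_changeE c y : cimage c y ->
  tangent_change c (param c y) = jac c (chart_at (param c y)) y.
Proof. by move=> yc; rewrite /tangent_change; have [_ ->] := cimageP yc. Qed.

Lemma overlap_chart_at c y : cimage c y -> overlap c (chart_at (param c y)) y.
Proof. by move=> yc; split => //; exact: chart_at_dom. Qed.

Lemma tangent_change_chain c c' y : atlas c -> atlas c' -> overlap c c' y ->
  tangent_change c (param c y) = jac c c' y *m tangent_change c' (param c y).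
Proof.
move=> ac ac' yo; have yc := proj1 yo; have yc' := overlap_cimage yo.
rewrite tangent_changeE // -{2}(param_transition yo) tangent_changeE //.
rewrite param_transition //; apply: jac_chain => //.
  exact: chart_at_atlas.
exact: overlap_chart_at.
Qed.

Lemma tangent_change_unit c y : atlas c -> cimage c y ->
  tangent_change c (param c y) \in unitmx.
Proof.
move=> ac yc; rewrite tangent_changeE //; apply: jac_unit => //.
  exact: chart_at_atlas.
exact: overlap_chart_at.
Qed.

Lemma tangent_change_self x : tangent_change (chart_at x) x = 1%:M.
Proof.
have xc := chart_at_dom x.
by apply: jac_self; [exact: chart_at_atlas|exact: cimage_coord].
Qed.

Lemma local_form_self k (w : diff_form X k) x V :
  local_form (chart_at x) w (coord (chart_at x) x) V = w x V.
Proof.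
by rewrite /local_form coordK ?tangent_change_self ?mulmx1 //; exact: chart_at_dom.
Qed.

Lemma local_form_change k (w : diff_form X k) c c' y V :
  atlas c -> atlas c' -> overlap c c' y ->
  local_form c w y V = local_form c' w (transition c c' y) (V *m jac c c' y).
Proof.
move=> ac ac' yo; rewrite /local_form (param_transition yo).
by rewrite (tangent_change_chain ac ac' yo) mulmxA.
Qed.

Lemma alternating_precomp k (a : 'M[R]_(k, n) -> R) (A : 'M[R]_n) :
  alternating_form a -> alternating_form (fun V => a (V *m A)).
Proof.
move=> alt; split=> [i A1 B C b d rA rB rC|B i j ij E].
  apply: (alt.1 i).
  - by rewrite !row_mul rA mulmxDl -!scalemxAl.
  - by apply/row_matrixP => l; rewrite !row_row'_pred !row_mul -!row_row'_pred rB.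
  - by apply/row_matrixP => l; rewrite !row_row'_pred !row_mul -!row_row'_pred rC.
by apply: (alt.2 _ i j ij); rewrite !row_mul E.
Qed.

Lemma alternating_local k (w : diff_form X k) c y :
  (forall x, alternating_form (w x)) -> alternating_form (local_form c w y).
Proof. by move=> alt; exact: alternating_precomp. Qed.

End Charts.

Arguments cimage_isopen {R n X} c.
Arguments overlap_open {R n X} c c'.

(** * Gradients in charts *)

Section LocalForms.
Context {R : realType} {n : nat} (X : smooth_manifold R n).
Implicit Types (c : chart R n X) (x : X) (y : 'rV[R]_n) (f : X -> R).

Lemma alternating_tail k (a : 'M[R]_(k.+1, n) -> R) (u : 'rV[R]_n) :
  alternating_form a -> alternating_form (fun V : 'M[R]_(k, n) => a (col_mx u V)).
Proof.
move=> alt.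
have rowd (i : 'I_k) (V : 'M[R]_(k, n)) :
    row (rshift 1 i : 'I_k.+1) (col_mx u V) = row i V.
  by apply/rowP => l; rewrite [LHS]mxE [RHS]mxE; exact: col_mxEd.
have rowu (V : 'M[R]_(k, n)) : row (lshift k (0 : 'I_1) : 'I_k.+1) (col_mx u V) = u.
  by apply/rowP => l; rewrite [LHS]mxE; exact: col_mxEu.
apply: alternatingP => [i b d v w V|V i j ij E].
  have S z : col_mx u (set_row i z V) = set_row (rshift 1 i : 'I_k.+1) z (col_mx u V).
    apply/row_matrixP => l; rewrite row_set_row.
    case: (splitP (l : 'I_(1 + k))) => [m lm|m lm].
      have -> : l = lshift k (0 : 'I_1) by apply: val_inj; rewrite /= lm ord1.
      by rewrite !rowu.
    have -> : l = rshift 1 m by apply: val_inj.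
    rewrite !rowd row_set_row; congr (if _ then _ else _).
  by rewrite !S (alternating_multilinear alt).
apply: (alt.2 _ (rshift 1 i : 'I_k.+1) (rshift 1 j)); rewrite ?rowd //.
Qed.

Definition drow c f y : 'rV[R]_n :=
  \row_i 'D_(delta_mx 0 i) (f \o param c) y.

Section Functions.
Context (f : X -> R) (sf : smooth_fun f).

Lemma differentiable_local c y : atlas c -> cimage c y ->
  differentiable (f \o param c) y.
Proof.
by move=> ac yc; exact: (smooth_differentiable (cimage_isopen c) (sf ac) yc).
Qed.

Lemma derive_drow c y v : atlas c -> cimage c y ->
  'D_v (f \o param c) y = (v *m (drow c f y)^T) 0 0.
Proof.
move=> ac yc; rewrite (derive_coord _ (differentiable_local ac yc)) [RHS]mxE.
by apply: eq_bigr => j _; rewrite !mxE.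
Qed.

Lemma drow_change c c' y : atlas c -> atlas c' -> overlap c c' y ->
  drow c f y = drow c' f (transition c c' y) *m (jac c c' y)^T.
Proof.
move=> ac ac' yo.
have dF := differentiable_transition ac ac' yo.
have df := differentiable_local ac' (overlap_cimage yo).
have E : \forall z \near y, (f \o param c) z = ((f \o param c') \o transition c c') z.
  apply: filterS (open_nbhs_nbhs (conj (overlap_open c c') yo)) => z zo.
  by rewrite /= (param_transition zo).
apply/rowP => i; rewrite [LHS]mxE.
apply: etrans (near_eq_derive _ E) _.
apply: etrans (derive_comp _ dF df) _.
apply: etrans (derive_drow _ ac' (overlap_cimage yo)) _.
have -> : 'D_(delta_mx 0 i) (transition c c') y = delta_mx 0 i *m jac c c' y.
  exact: derive_transition.
rewrite -rowE !mxE; apply: eq_bigr => j _; rewrite !mxE mulrC; congr (_ * _).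
Qed.

Lemma smooth_drow c i : atlas c -> smooth_on (cimage c) (fun y => drow c f y 0 i).
Proof.
move=> ac; apply: (@smooth_on_eq _ _ _ _ ('D_(delta_mx 0 i) (f \o param c))).
- exact: cimage_isopen.
- by move=> y _; rewrite mxE.
- exact/smooth_partial/sf.
Qed.

Lemma smooth_fun_continuous : continuous f.
Proof.
move=> x; have xc := chart_at_dom x; have ac := chart_at_atlas x.
set c := chart_at x in xc ac.
have E : {near x, (f \o param c) \o coord c =1 f}.
  apply: filterS (open_nbhs_nbhs (conj (@cdom_open _ _ _ c) xc)) => z zc.
  by rewrite /= coordK.
apply: (continuous_near_eq E); apply: continuous_comp.
  exact: continuous_coord.
exact: (smooth_continuous (sf ac) (cimage_coord xc)).
Qed.

End Functions.

Section Metric.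
Context (g : metric_tensor X) (rg : riemannian g).

Lemma posdef_metric x : posdef (g x).
Proof. by case: rg => s p _; split; [exact: s|exact: p]. Qed.

Lemma posdef_local_metric c y : atlas c -> cimage c y -> posdef (local_metric g c y).
Proof.
move=> ac yc; apply: posdef_gram; first exact: posdef_metric.
move=> v; apply: contra_neq => vJ.
by rewrite -(mulmxK (tangent_change_unit ac yc) v) vJ mul0mx.
Qed.

Lemma smooth_local_metric c i j : atlas c ->
  smooth_on (cimage c) (fun y => local_metric g c y i j).
Proof. by case: rg => _ _ sg ac; exact: sg. Qed.

Definition local_gradient c f y : 'rV[R]_n :=
  drow c f y *m invmx (local_metric g c y).

Lemma smooth_local_gradient f c i : smooth_fun f -> atlas c ->
  smooth_on (cimage c) (fun y => local_gradient c f y 0 i).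
Proof.
move=> sf ac; have oc := cimage_isopen c.
apply: (@smooth_on_eq _ _ _ _
  (fun y => \sum_j drow c f y 0 j * invmx (local_metric g c y) j i)) => //.
  by move=> y _; rewrite mxE.
apply: (smooth_sum oc) => j; apply: (smoothM oc); first exact: smooth_drow.
apply: (smooth_invmx oc) => [a b|y yc]; first exact: smooth_local_metric.
exact/posdef_unit/posdef_local_metric.
Qed.

(** The gradient is defined in a chart which depends on the point; by
    contravariance it can be computed in any fixed chart, where its smoothness
    can be seen. *)
Lemma gradient_local f c y : smooth_fun f -> atlas c -> cimage c y ->
  gradient g f (param c y) = local_gradient c f y *m tangent_change c (param c y).
Proof.
move=> sf ac yc; set x := param c y.
have yo : overlap c (chart_at x) y by exact: overlap_chart_at.
have uT : tangent_change c x \in unitmx by exact: tangent_change_unit.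
have uG : g x \in unitmx by apply: posdef_unit; exact: posdef_metric.
have TE : tangent_change c x = jac c (chart_at x) y by exact: tangent_changeE.
rewrite /local_gradient (drow_change sf ac (chart_at_atlas x) yo) -TE.
have -> : transition c (chart_at x) y = coord (chart_at x) x by [].
rewrite -[gradient g f x]/(drow (chart_at x) f (coord (chart_at x) x) *m invmx (g x)).
have uTt : (tangent_change c x)^T \in unitmx by rewrite unitmx_tr.
rewrite -!mulmxA; congr (_ *m _).
have uL : local_metric g c y \in unitmx.
  by apply: posdef_unit; exact: posdef_local_metric.
have gB : g x *m ((tangent_change c x)^T *m
    (invmx (local_metric g c y) *m tangent_change c x)) = 1%:M.
  rewrite !mulmxA; apply: mulmx1C; rewrite !mulmxA.
  exact: (mulmxV uL).
by rewrite -[LHS]mulmx1 -gB mulKmx.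
Qed.

End Metric.
End LocalForms.

(** * Exterior derivatives in charts *)

Lemma derive_lincomb (R : realType) n (f g h : 'rV[R]_n -> R) (a b : R) y u :
  (forall z, h z = a * f z + b * g z) -> derivable f y u -> derivable g y u ->
  'D_u h y = a * 'D_u f y + b * 'D_u g y.
Proof.
move=> hE df dg.
have -> : h = (cst a * f) + (cst b * g) by apply/funext => z; rewrite hE.
have D (e : R) (q : 'rV[R]_n -> R) : derivable q y u ->
    is_derive y u (cst e * q) (e * 'D_u q y).
  move=> dq; apply: is_derive_eq (is_deriveM (is_derive_cst e y u) (derivableP dq)) _.
  by rewrite scaler0 addr0.
by have [] := is_deriveD (D a f df) (D b g dg).
Qed.

Section ExteriorDerivative.
Context {R : realType} {n : nat} (X : smooth_manifold R n).
Implicit Types (c : chart R n X) (x : X) (y : 'rV[R]_n).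

Lemma set_row_mulmx k m (i : 'I_k) (u : 'rV[R]_n) (V : 'M[R]_(k, n)) (A : 'M[R]_(n, m)) :
  set_row i u V *m A = set_row i (u *m A) (V *m A).
Proof.
by apply/row_matrixP => j; rewrite row_mul !row_set_row row_mul; case: ifP.
Qed.

(** The second derivative of the change of charts, read back in the chart c. It is
    the inhomogeneous term by which derivatives of tensors fail to be tensors. *)
Definition second_jac c c' y (u v : 'rV[R]_n) : 'rV[R]_n :=
  (\row_l \sum_m v 0 m * 'D_u (fun z => jac c c' z m l) y) *m invmx (jac c c' y).

(** Symmetry of the second derivatives of the change of charts. *)
Lemma second_jacC c c' y u v : atlas c -> atlas c' -> overlap c c' y ->
  second_jac c c' y u v = second_jac c c' y v u.
Proof.
move=> ac ac' yo; have oO := overlap_open c c'.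
apply: (congr1 (mulmx^~ (invmx (jac c c' y)))).
apply/rowP => l; rewrite [LHS]mxE [RHS]mxE.
pose h z := transition c c' z 0 l.
have sh : smooth_on (overlap c c') h by exact: smooth_transition_coord.
have D m q : 'D_(delta_mx 0 q) (fun z => jac c c' z m l) y =
    'D_(delta_mx 0 q) ('D_(delta_mx 0 m) h) y.
  apply: (derive_eq_on _ oO _ yo) => z zo.
  by rewrite /jac jacobianE //; exact: differentiable_transition.
have dJ m : differentiable (fun z => jac c c' z m l) y.
  exact: (smooth_differentiable oO (smooth_jac m l ac ac') yo).
have S (a b : 'rV[R]_n) : \sum_m b 0 m * 'D_a (fun z => jac c c' z m l) y =
   \sum_m \sum_q b 0 m * (a 0 q * 'D_(delta_mx 0 q) ('D_(delta_mx 0 m) h) y).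
  apply: eq_bigr => m _; rewrite -mulr_sumr; congr (_ * _).
  apply: etrans (derive_coord _ (dJ m)) _.
  by apply: eq_bigr => q _; rewrite D.
apply: etrans (S u v) (etrans _ (esym (S v u))).
apply: etrans (exchange_big _ _ _ _ _ _) _ => /=.
apply: eq_bigr => m _; apply: eq_bigr => q _; apply: etrans (mulrCA _ _ _) _.
exact: (congr1 (fun t => u 0 m * (v 0 q * t)) (partialC m q oO sh yo)).
Qed.

Section Form.
Context {k : nat} (w : diff_form X k) (sw : smooth_form w).

Lemma smooth_local_form c V : atlas c -> smooth_on (cimage c) (local_form c w ^~ V).
Proof. by case: sw => _ s ac; exact: s. Qed.

Lemma derivable_local_form c V y v : atlas c -> cimage c y ->
  derivable (local_form c w ^~ V) y v.
Proof.
move=> ac yc.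
exact: (smooth_derivable (cimage_isopen c) (smooth_local_form V ac) yc).
Qed.

Lemma differentiable_local_form c V y : atlas c -> cimage c y ->
  differentiable (local_form c w ^~ V) y.
Proof.
move=> ac yc.
exact: (smooth_differentiable (cimage_isopen c) (smooth_local_form V ac) yc).
Qed.

Lemma alternating_local_form c y : alternating_form (local_form c w y).
Proof. by apply: alternating_local; case: sw. Qed.

Lemma alternating_derive_local c y u : atlas c -> cimage c y ->
  alternating_form (fun W => 'D_u (local_form c w ^~ W) y).
Proof.
move=> ac yc; apply: alternatingP => [i b d u1 u2 V|V i j ij E].
  apply: derive_lincomb => [z||]; last 2 first.
  - exact: derivable_local_form.
  - exact: derivable_local_form.
  - exact: (alternating_multilinear (alternating_local_form c z)).
rewrite (_ : local_form c w ^~ V = cst 0) ?derive_cst //.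
by apply/funext => z; apply: ((alternating_local_form c z).2 V i j ij E).
Qed.

Definition local_ext c y (V : 'M[R]_(k.+1, n)) : R :=
  alt_sum (fun u W => 'D_u (local_form c w ^~ W) y) V.

Lemma alternating_local_ext c y : atlas c -> cimage c y ->
  alternating_form (local_ext c y).
Proof.
move=> ac yc; apply: alternating_alt_sum => [u|b d u v W].
  exact: alternating_derive_local.
exact/derive_linear/differentiable_local_form.
Qed.

Lemma ext_dE x V : ext_d w x V = local_ext (chart_at x) (coord (chart_at x) x) V.
Proof. by []. Qed.

(** Differentiate the transformation rule of w. The terms with [second_jac] come
    from the derivative of the Jacobian applied to the arguments. *)
Lemma derive_local_change c c' y u W :
  atlas c -> atlas c' -> overlap c c' y ->
  'D_u (local_form c w ^~ W) y =
    'D_(u *m jac c c' y) (local_form c' w ^~ (W *m jac c c' y)) (transition c c' y)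
    + \sum_(j < k) local_form c' w (transition c c' y)
        (set_row j (second_jac c c' y u (row j W)) W *m jac c c' y).
Proof.
move=> ac ac' yo; have oO := overlap_open c c'.
pose A z : 'M[R]_(k, n) -> R := local_form c' w (transition c c' z).
pose U z : 'M[R]_(k, n) := W *m jac c c' z.
have dtr := differentiable_transition ac ac' yo.
have E : \forall z \near y, local_form c w z W = A z (U z).
  apply: filterS (open_nbhs_nbhs (conj oO yo)) => z zo.
  exact: local_form_change.
have dw V : differentiable (local_form c' w ^~ V) (transition c c' y).
  exact: differentiable_local_form (overlap_cimage yo).
have dA V : derivable (A ^~ V) y u.
  exact: diff_derivable (differentiable_comp dtr (dw V)).
have dJ m l : derivable (fun z => jac c c' z m l) y u.
  exact: (smooth_derivable oO (smooth_jac m l ac ac') yo).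
have dU i j : is_derive y u (fun z => U z i j)
    (\sum_m W i m * 'D_u (fun z => jac c c' z m j) y).
  rewrite (_ : (fun z => U z i j) =
      (fun z => \sum_m (cst (W i m) * (fun z => jac c c' z m j)) z)); last first.
    by apply/funext => z; rewrite /U mxE.
  have D m : is_derive y u (cst (W i m) * (fun z => jac c c' z m j))
      (W i m * 'D_u (fun z => jac c c' z m j) y).
    apply: is_derive_eq (is_deriveM (is_derive_cst (W i m) y u) (derivableP (dJ m j))) _.
    by rewrite scaler0 addr0.
  have := derivable_bigsum (index_enum 'I_n) (fun m => @ex_derive _ _ _ _ _ _ _ (D m)).
  move=> H; apply: (is_derive_eq H).
  by apply: eq_bigr => m _; exact: (@derive_val _ _ _ _ _ _ _ (D m)).
apply: etrans (near_eq_derive _ E) _.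
apply: etrans (derive_form _ dA (fun i j => @ex_derive _ _ _ _ _ _ _ (dU i j))) _.
  by move=> z; exact: (alternating_multilinear (alternating_local_form c' _)).
have uJ := jac_unit ac ac' yo.
have H1 : 'D_u (A ^~ (U y)) y =
    'D_(u *m jac c c' y) (local_form c' w ^~ (U y)) (transition c c' y).
  apply: etrans (derive_comp _ dtr (dw _)) _.
  exact: (congr1 (fun t => 'D_t (local_form c' w ^~ (U y)) (transition c c' y))
    (derive_transition u ac ac' yo)).
have H2 j : A y (set_row j (\row_l 'D_u (fun z => U z j l) y) (U y)) =
    local_form c' w (transition c c' y)
        (set_row j (second_jac c c' y u (row j W)) W *m jac c c' y).
  apply: (congr1 (A y)); rewrite set_row_mulmx /second_jac (mulmxKV uJ).
  apply: (congr1 (fun t => set_row j t (U y))); apply/rowP => l.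
  rewrite [LHS]mxE [RHS]mxE; apply: etrans (@derive_val _ _ _ _ _ _ _ (dU j l)) _.
  apply: eq_bigr => m _.
  by apply: (congr1 ( *%R^~ ('D_u (fun z => jac c c' z m l) y))); rewrite mxE.
exact: (congr2 +%R H1 (eq_bigr _ (fun j _ => H2 j))).
Qed.

(** The inhomogeneous terms of [derive_local_change] cancel in the alternating sum,
    as second derivatives are symmetric. *)
Lemma local_ext_change c c' y V : atlas c -> atlas c' -> overlap c c' y ->
  local_ext c y V = local_ext c' (transition c c' y) (V *m jac c c' y).
Proof.
move=> ac ac' yo; rewrite /local_ext /alt_sum.
have H (i : 'I_k.+1) := etrans (congr1 (fun t => (-1) ^+ i * t)
  (derive_local_change (row i V) (row' i V) ac ac' yo)) (mulrDr _ _ _).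
apply: etrans (eq_bigr _ (fun i _ => H i)) _ => {H}.
rewrite big_split /= -[RHS]addr0; apply: congr2.
  apply: eq_bigr => i _; apply: congr1.
  rewrite row_mul.
  apply: (congr1 (fun M => 'D_(row i V *m jac c c' y) (local_form c' w ^~ M) _)).
  by apply/row_matrixP => l; rewrite row_mul !row_row' row_mul.
have alt : alternating_form
    (fun W => local_form c' w (transition c c' y) (W *m jac c c' y)).
  exact/alternating_precomp/alternating_local_form.
exact: (alt_sum_symmetric V alt (fun u v => second_jacC u v ac ac' yo)).
Qed.

Lemma local_form_ext c y V : atlas c -> cimage c y ->
  local_form c (ext_d w) y V = local_ext c y V.
Proof.
move=> ac yc; have yo := overlap_chart_at yc.
rewrite (local_ext_change _ ac (chart_at_atlas _) yo) /local_form ext_dE.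
by rewrite (tangent_changeE yc).
Qed.

(** In a fixed chart, [ext_d] becomes an expression in the derivatives of the local
    components, by [local_form_ext]. *)
Lemma smooth_ext_d : smooth_form (ext_d w).
Proof.
split=> [x|c ac V].
  apply: alternating_local_ext; first exact: chart_at_atlas.
  exact/cimage_coord/chart_at_dom.
have oc := cimage_isopen c.
have E y : cimage c y -> local_form c (ext_d w) y V =
    \sum_(i < k.+1) (-1) ^+ i * 'D_(row i V) (local_form c w ^~ (row' i V)) y.
  exact: local_form_ext.
apply: (smooth_on_eq oc E); apply: (smooth_sum oc) => i; apply: (smoothZ oc).
by apply: (smooth_derive oc); exact: smooth_local_form.
Qed.

End Form.
End ExteriorDerivative.

(** * The operator dd^phi *)

Section SmoothFunctions.
Context {R : realType} {n : nat} (X : smooth_manifold R n).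
Implicit Types f h : X -> R.

Lemma smooth_fun_cst (a : R) : smooth_fun (X := X) (cst a).
Proof. by move=> c ac; exact: (smooth_cst (cimage_isopen c)). Qed.

Lemma smooth_funD f h : smooth_fun f -> smooth_fun h ->
  smooth_fun (fun x => f x + h x).
Proof. by move=> sf sh c ac; exact: (smoothD (cimage_isopen c) (sf c ac) (sh c ac)). Qed.

Lemma smooth_funM f h : smooth_fun f -> smooth_fun h ->
  smooth_fun (fun x => f x * h x).
Proof. by move=> sf sh c ac; exact: (smoothM (cimage_isopen c) (sf c ac) (sh c ac)). Qed.

Lemma smooth_funV f : smooth_fun f -> (forall x, f x != 0) ->
  smooth_fun (fun x => (f x)^-1).
Proof.
by move=> sf f0 c ac; apply: (smoothV (cimage_isopen c) (sf c ac)) => y _; exact: f0.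
Qed.

Lemma smooth_fun_comp1 (theta : R -> R) f : smooth1 theta -> smooth_fun f ->
  smooth_fun (theta \o f).
Proof. by move=> st sf c ac; exact: (smooth_comp1 (cimage_isopen c) st (sf c ac)). Qed.

Lemma smooth_formZ k (w : diff_form X k) f : smooth_fun f -> smooth_form w ->
  smooth_form (fun x V => f x * w x V).
Proof.
move=> sf [alt sw]; split=> [x|c ac V].
  apply: alternatingP => [i a b u v W|V i j ij E].
    by rewrite (alternating_multilinear (alt x)); ring.
  by rewrite ((alt x).2 V i j ij E) mulr0.
exact: (smoothM (cimage_isopen c) (sf c ac) (sw c ac V)).
Qed.

End SmoothFunctions.

Section DPhi.
Context {R : realType} {n p : nat} (X : smooth_manifold R n).
Context (g : metric_tensor X) (rg : riemannian g).
Context (phi : diff_form X p.+1) (sphi : smooth_form phi).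
Implicit Types (c : chart R n X) (x : X) (y : 'rV[R]_n) (f h : X -> R).

Lemma col_mx_set_row (u : 'rV[R]_n) (V : 'M[R]_(p, n)) :
  col_mx u V = set_row (0 : 'I_p.+1) u (col_mx (0 : 'rV[R]_n) V).
Proof.
apply/matrixP => i j; rewrite set_rowE.
case: (splitP (i : 'I_(1 + p))) => [m im|m im].
  have -> : i = lshift p (0 : 'I_1) by apply: val_inj; rewrite /= im ord1.
  exact: col_mxEu.
have -> : i = rshift 1 m by apply: val_inj.
by rewrite col_mxEd [in RHS](@col_mxEd R 1 p n 0 V m j).
Qed.

Lemma head_sum (a : 'M[R]_(p.+1, n) -> R) (I : Type) (s : seq I) (b : I -> R)
    (u : I -> 'rV[R]_n) (V : 'M[R]_(p, n)) : multilinear a ->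
  a (col_mx (\sum_(j <- s) b j *: u j) V) = \sum_(j <- s) b j * a (col_mx (u j) V).
Proof.
move=> lin; rewrite col_mx_set_row multilinear_sum //.
by apply: eq_bigr => j _; rewrite -col_mx_set_row.
Qed.

Lemma head_lin (a : 'M[R]_(p.+1, n) -> R) b d (u v : 'rV[R]_n) (V : 'M[R]_(p, n)) :
  multilinear a ->
  a (col_mx (b *: u + d *: v) V) = b * a (col_mx u V) + d * a (col_mx v V).
Proof.
by move=> lin; rewrite (col_mx_set_row (b *: u + d *: v)) lin -!col_mx_set_row.
Qed.

Lemma phi_multilinear x : multilinear (phi x).
Proof. by apply: alternating_multilinear; case: sphi. Qed.

Lemma dphi_local f c y V : smooth_fun f -> atlas c -> cimage c y ->
  local_form c (dphi g phi f) y V =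
  local_form c phi y (col_mx (local_gradient g c f y) V).
Proof.
move=> sf ac yc; rewrite /local_form /dphi (gradient_local rg sf ac yc).
by rewrite -mul_col_mx.
Qed.

Lemma smooth_dphi f : smooth_fun f -> smooth_form (dphi g phi f).
Proof.
move=> sf; split=> [x|c ac V].
  by apply: alternating_tail; case: sphi.
have oc := cimage_isopen c.
have E y : cimage c y -> local_form c (dphi g phi f) y V =
   \sum_j local_gradient g c f y 0 j * local_form c phi y
     (col_mx (delta_mx 0 j : 'rV[R]_n) V).
  move=> yc; rewrite dphi_local // {1}(row_sum_delta (local_gradient g c f y)).
  by rewrite head_sum //; exact: (alternating_multilinear (alternating_local_form sphi c y)).
apply: (smooth_on_eq oc E); apply: (smooth_sum oc) => j; apply: (smoothM oc).
  exact: smooth_local_gradient.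
exact: smooth_local_form.
Qed.

Lemma smooth_ddphi f : smooth_fun f -> smooth_form (ddphi g phi f).
Proof. by move=> sf; apply: smooth_ext_d; exact: smooth_dphi. Qed.

Lemma gradient_eq f h x : (forall i,
    'D_(delta_mx 0 i) (f \o param (chart_at x)) (coord (chart_at x) x) =
    'D_(delta_mx 0 i) (h \o param (chart_at x)) (coord (chart_at x) x)) ->
  gradient g f x = gradient g h x.
Proof.
move=> E; apply: (congr1 (mulmx^~ (invmx (g x)))).
by apply/rowP => i; rewrite [LHS]mxE [RHS]mxE.
Qed.

Lemma gradient_comp1 (theta : R -> R) f x : smooth1 theta -> smooth_fun f ->
  gradient g (theta \o f) x = theta^`()%classic (f x) *: gradient g f x.
Proof.
move=> st sf; have ac := chart_at_atlas x; have xc := chart_at_dom x.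
have df := differentiable_local sf ac (cimage_coord xc).
rewrite scalemxAl; apply: (congr1 (mulmx^~ (invmx (g x)))).
apply/rowP => i; rewrite [LHS]mxE [RHS]mxE mxE.
have := @is_derive_comp1 _ _ theta _ _ (delta_mx 0 i) (st 0%N _) df.
move=> D; apply: etrans (@derive_val _ _ _ _ _ _ _ D) _.
by rewrite /= coordK.
Qed.

Lemma gradient_lin f h a x : smooth_fun f -> smooth_fun h ->
  gradient g (fun z => f z + a * h z) x = gradient g f x + a *: gradient g h x.
Proof.
move=> sf sh; have ac := chart_at_atlas x; have yc := cimage_coord (chart_at_dom x).
rewrite scalemxAl -mulmxDl; apply: (congr1 (mulmx^~ (invmx (g x)))).
apply/rowP => i; rewrite [LHS]mxE [RHS]mxE [X in X + _]mxE [X in _ + X]mxE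
  [X in _ + _ * X]mxE.
apply: etrans (derive_lincomb (a := 1) (b := a)
  (f := f \o param (chart_at x)) (g := h \o param (chart_at x)) _ _ _) _.
- by move=> z /=; rewrite mul1r.
- exact: diff_derivable (differentiable_local sf ac yc).
- exact: diff_derivable (differentiable_local sh ac yc).
by rewrite mul1r.
Qed.

Lemma dphi_comp1 (theta : R -> R) f x V : smooth1 theta -> smooth_fun f ->
  dphi g phi (theta \o f) x V = theta^`()%classic (f x) * dphi g phi f x V.
Proof.
move=> st sf; rewrite /dphi gradient_comp1 //.
have := head_lin (theta^`()%classic (f x)) 0 (gradient g f x) 0 V (@phi_multilinear x).
by rewrite scale0r addr0 mul0r addr0.
Qed.

Lemma dphi_lin f h a x V : smooth_fun f -> smooth_fun h ->
  dphi g phi (fun z => f z + a * h z) x V = 1 * dphi g phi f x V + a * dphi g phi h x V.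
Proof.
move=> sf sh; rewrite /dphi gradient_lin //.
by rewrite -[gradient g f x in LHS]scale1r head_lin //; exact: phi_multilinear.
Qed.

Lemma ddphiE f x V : ddphi g phi f x V =
  \sum_(i < p.+1) (-1) ^+ i * 'D_(row i V)
     (local_form (chart_at x) (dphi g phi f) ^~ (row' i V)) (coord (chart_at x) x).
Proof. by []. Qed.

Lemma ddphi_lin f h a x V : smooth_fun f -> smooth_fun h ->
  ddphi g phi (fun z => f z + a * h z) x V = ddphi g phi f x V + a * ddphi g phi h x V.
Proof.
move=> sf sh; have ac := chart_at_atlas x; have yc := cimage_coord (chart_at_dom x).
rewrite !ddphiE mulr_sumr -big_split /=; apply: eq_bigr => i _.
rewrite mulrCA -mulrDr; apply: (congr1 ( *%R ((-1) ^+ i))).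
rewrite -[X in X + _]mul1r; apply: derive_lincomb => [z||].
- exact: dphi_lin.
- exact: (derivable_local_form (smooth_dphi sf) ac yc).
- exact: (derivable_local_form (smooth_dphi sh) ac yc).
Qed.

Lemma gradient_local_eq f h (N : set X) x : open N ->
  (forall z, N z -> f z = h z) -> N x -> gradient g f x = gradient g h x.
Proof.
move=> oN fh Nx; have xc := chart_at_dom x; apply: gradient_eq => i.
apply: near_eq_derive.
have pc := continuous_param (cimage_coord xc).
have : \forall z \near coord (chart_at x) x, N (param (chart_at x) z).
  by apply: pc; rewrite coordK //; exact: (open_nbhs_nbhs (conj oN Nx)).
by apply: filterS => z Nz; exact: fh.
Qed.

Lemma ddphi_local_eq f h (N : set X) x V : open N ->
  (forall z, N z -> f z = h z) -> N x -> ddphi g phi f x V = ddphi g phi h x V.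
Proof.
move=> oN fh Nx; have xc := chart_at_dom x.
rewrite !ddphiE; apply: eq_bigr => i _; apply: (congr1 ( *%R ((-1) ^+ i))).
apply: near_eq_derive.
have pc := continuous_param (cimage_coord xc).
have : \forall z \near coord (chart_at x) x, N (param (chart_at x) z).
  by apply: pc; rewrite coordK //; exact: (open_nbhs_nbhs (conj oN Nx)).
apply: filterS => z Nz; rewrite /local_form /dphi.
by rewrite (gradient_local_eq oN fh Nz).
Qed.

Lemma metric_gradient f x (u : 'rV[R]_n) : smooth_fun f ->
  (u *m g x *m (gradient g f x)^T) 0 0 =
  'D_u (f \o param (chart_at x)) (coord (chart_at x) x).
Proof.
move=> sf; have ac := chart_at_atlas x; have yc := cimage_coord (chart_at_dom x).
rewrite (derive_drow sf u ac yc); apply: (congr1 (fun M : 'M[R]_1 => M 0 0)).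
have [sg _] := posdef_metric rg x; have uG := posdef_unit (posdef_metric rg x).
by rewrite trmx_mul trmx_inv sg mulmxA (mulmxK uG).
Qed.

(** As d^phi (theta o f) = theta'(f) d^phi f, the Leibniz rule gives
    theta'(f) dd^phi f and d(theta'(f)) /\ d^phi f. The alternating sum is
    df /\ d^phi f, the differential of f being read as the inner product with
    its gradient. *)
Lemma ddphi_comp1 (theta : R -> R) f x V : smooth1 theta -> smooth_fun f ->
  ddphi g phi (theta \o f) x V = theta^`()%classic (f x) * ddphi g phi f x V +
    theta^`()%classic^`()%classic (f x) *
      alt_sum (fun u W => (u *m g x *m (gradient g f x)^T) 0 0 *
                          phi x (col_mx (gradient g f x) W)) V.
Proof.
move=> st sf; have ac := chart_at_atlas x; have xc := chart_at_dom x.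
have yc := cimage_coord xc; have sd := smooth_dphi sf.
set c := chart_at x in ac xc yc *; set y := coord c x in yc *.
have st' := smooth1_derive st.
have df := differentiable_local sf ac yc.
rewrite !ddphiE /alt_sum !mulr_sumr -big_split /=; apply: eq_bigr => i _.
have D := is_deriveM
  (@is_derive_comp1 _ _ _ _ _ (row i V) (st' 0%N _) df)
  (derivableP (derivable_local_form sd (V := row' i V) ac yc)).
have E : local_form c (dphi g phi (theta \o f)) ^~ (row' i V) =
  (theta^`()%classic \o (f \o param c)) * (local_form c (dphi g phi f) ^~ (row' i V)).
  by apply/funext => z; rewrite /local_form dphi_comp1.
rewrite E (@derive_val _ _ _ _ _ _ _ D) metric_gradient //.
rewrite (@local_form_self _ _ _ _ (dphi g phi f)) /GRing.scale /= coordK //.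
rewrite -/c -/y -/(dphi g phi f x (row' i V)).
move: ('D_(row i V) (f \o param c) y) => B; move: ('D_(row i V) _ y) => A.
by ring.
Qed.

End DPhi.

(** * Openness of strict positivity on calibrated planes *)

Section Calculus.
Context {R : realType}.

Lemma cvg_bigsum (T : Type) (F : set_system T) {FF : Filter F} (I : Type)
    (r : seq I) (f : I -> T -> R) (l : I -> R) :
  (forall i, f i t @[t --> F] --> l i) ->
  (\sum_(i <- r) f i t) @[t --> F] --> \sum_(i <- r) l i.
Proof.
move=> fl; elim: r => [|i r IHr].
  by rewrite big_nil; under eq_fun do rewrite big_nil; exact: cvg_cst.
by rewrite big_cons; under eq_fun do rewrite big_cons; exact: cvgD.
Qed.

Lemma cvg_bigprod (T : Type) (F : set_system T) {FF : Filter F} (I : Type)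
    (r : seq I) (f : I -> T -> R) (l : I -> R) :
  (forall i, f i t @[t --> F] --> l i) ->
  (\prod_(i <- r) f i t) @[t --> F] --> \prod_(i <- r) l i.
Proof.
move=> fl; elim: r => [|i r IHr].
  by rewrite big_nil; under eq_fun do rewrite big_nil; exact: cvg_cst.
by rewrite big_cons; under eq_fun do rewrite big_cons; exact: cvgM.
Qed.

Lemma cvg_neq (T : Type) (F : set_system T) {FF : Filter F} (f : T -> R) (l b : R) :
  f t @[t --> F] --> l -> l != b -> \forall t \near F, f t != b.
Proof.
move=> fl lb; have : \forall z \near l, z != b.
  by apply: open_nbhs_nbhs; split => //; exact: open_neq.
by move=> /fl.
Qed.

Section StrictPositivity.
Context {n k : nat} (G : 'rV[R]_n -> 'M[R]_n) (Phi Psi : 'rV[R]_n -> 'M[R]_(k, n) -> R).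
Context (y0 : 'rV[R]_n).
Hypotheses (cG : forall i j, {for y0, continuous (fun y => G y i j)}).
Hypotheses (cH : forall i j, {for y0, continuous (fun y => invmx (G y) i j)}).
Hypothesis (pG : \forall y \near y0, posdef (G y)).
Hypotheses (altPhi : forall y, alternating_form (Phi y)).
Hypotheses (altPsi : forall y, alternating_form (Psi y)).
Hypotheses (cPhi : forall V, {for y0, continuous (Phi ^~ V)}).
Hypotheses (cPsi : forall V, {for y0, continuous (Psi ^~ V)}).

Let E := 'rV[R]_(k * n).

Lemma cvg_vec_mx (v0 : E) i j :
  vec_mx q.1 i j @[q --> (nbhs v0, nbhs y0)] --> vec_mx v0 i j.
Proof.
rewrite mxE; under eq_fun do rewrite mxE.
apply: (@cvg_comp _ _ _ fst (fun v : E => v 0 (mxvec_index i j)) _ (nbhs v0)).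
  exact: cvg_fst.
exact: (differentiable_continuous (differentiable_coord v0 0 (mxvec_index i j))).
Qed.

Lemma cvg_at_y0 (f : 'rV[R]_n -> R) (v0 : E) : {for y0, continuous f} ->
  f q.2 @[q --> (nbhs v0, nbhs y0)] --> f y0.
Proof.
move=> cf; apply: (@cvg_comp _ _ _ snd f _ (nbhs y0)); last exact: cf.
exact: cvg_snd.
Qed.

Lemma cvg_form (A : 'rV[R]_n -> 'M[R]_(k, n) -> R) (v0 : E) :
  (forall y, alternating_form (A y)) -> (forall V, {for y0, continuous (A ^~ V)}) ->
  A q.2 (vec_mx q.1) @[q --> (nbhs v0, nbhs y0)] --> A y0 (vec_mx v0).
Proof.
move=> alt cA; rewrite (multilinear_expand (alternating_multilinear (alt y0))).
under eq_fun do rewrite (multilinear_expand (alternating_multilinear (alt _))).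
apply: cvg_bigsum => I; apply: cvgM; last exact: (cvg_at_y0 v0 (cA (rowsub I 1%:M))).
by apply: cvg_bigprod => i; exact: cvg_vec_mx.
Qed.

Lemma cvg_gram (v0 : E) i j :
  gram (G q.2) (vec_mx q.1) i j @[q --> (nbhs v0, nbhs y0)] -->
  gram (G y0) (vec_mx v0) i j.
Proof.
have ge (H : 'M[R]_n) (V : 'M[R]_(k, n)) : gram H V i j =
    \sum_m (\sum_l V i l * H l m) * V j m.
  by rewrite mxE; apply: eq_bigr => m _; rewrite !mxE.
rewrite ge; under eq_fun do rewrite ge.
apply: cvg_bigsum => m; apply: cvgM; last exact: cvg_vec_mx.
apply: cvg_bigsum => l; apply: cvgM; first exact: cvg_vec_mx.
exact: (cvg_at_y0 v0 (@cG l m)).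
Qed.

(** Calibrated planes have orthonormal frames, whose entries are bounded uniformly
    near y0 by [unit_vector_bound]. So the claim for y near y0 concerns only
    frames in a compact set K, and the tube lemma extends it from y0: a frame in
    K is either not orthonormal at y0, or not calibrated, or Psi is positive
    there, and each of these is an open condition. *)
Lemma strict_positivity_open :
  (forall V, gram (G y0) V = 1%:M -> Phi y0 V = 1 -> 0 < Psi y0 V) ->
  \forall y \near y0, forall V, \det (gram (G y) V) = 1 -> Phi y V = 1 -> 0 < Psi y V.
Proof.
move=> pos.
(* The sum bounds each diagonal entry of the inverse metric near y0, and 1 <= M
   allows one to pass from squares of coordinates to coordinates. *)
pose M : R := 1 + \sum_j (`|invmx (G y0) j j| + 1).
have M1 : 1 <= M by rewrite lerDl; apply: sumr_ge0 => j _; rewrite addr_ge0.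
pose K : set E := [set v | forall i, `[- M, M]%classic (v 0 i)].
have cK : compact K.
  by apply: (@rV_compact R (k * n) (fun=> `[- M, M]%classic)) => i; exact: segment_compact.
pose P (y : 'rV[R]_n) (v : E) := gram (G y) (vec_mx v) = 1%:M ->
  Phi y (vec_mx v) = 1 -> 0 < Psi y (vec_mx v).
have tube : \forall y \near y0, K `<=` P y.
  apply: ((compact_near_coveringP K).1 cK 'rV[R]_n (nbhs y0) P (nbhs_filter y0)) => v Kv.
  have FF : Filter (nbhs (nbhs v, nbhs y0)) by exact: filter_prod_filter.
  have [[i [j gij]]|g1] := pselect (exists i j, gram (G y0) (vec_mx v) i j !=
      (1%:M : 'M[R]_k) i j).
    have := @cvg_neq _ _ FF _ _ _ (@cvg_gram v i j) gij.
    by apply: filterS => q /= ng gq; rewrite gq eqxx in ng.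
  have {}g1 : gram (G y0) (vec_mx v) = 1%:M.
    apply/matrixP => i j; apply/eqP; apply: contraT => gij.
    by case: g1; exists i, j.
  have [Phi1|Phi1] := eqVneq (Phi y0 (vec_mx v)) 1; last first.
    have := @cvg_neq _ _ FF _ _ _ (@cvg_form Phi v altPhi cPhi) Phi1.
    by apply: filterS => q /= nP _ Pq; rewrite Pq eqxx in nP.
  have := @cvg_form Psi v altPsi cPsi => /cvgr_gt/(_ 0 (pos _ g1 Phi1)).
  by apply: filterS => q /= Pq _ _.
have bndj j : \forall y \near y0, invmx (G y) j j <= M.
  have /cvgr_lt/(_ (invmx (G y0) j j + 1)) := @cH j j.
  rewrite ltrDl ltr01 => /(_ isT); apply: filterS => y /ltW /le_trans; apply.
  rewrite /M (bigD1 j) //=; set S := \sum_(_ | _) _.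
  have S0 : 0 <= S by apply: sumr_ge0 => l _; rewrite addr_ge0.
  by have := ler_norm (invmx (G y0) j j); lra.
have bnd : \forall y \near y0, forall j, invmx (G y) j j <= M.
  exact: (filter_forall _ bndj).
apply: filterS3 tube bnd pG => y Ky By pGy V d1 Phi1.
have [A A1 AV] := orthonormal_frame pGy d1.
have inv (F : 'rV[R]_n -> 'M[R]_(k, n) -> R) : alternating_form (F y) ->
    F y (A *m V) = F y V.
  by move=> alt; rewrite alternating_mulmx // A1 mul1r.
(* Replacing V by the orthonormal frame A V changes neither form. *)
rewrite -(inv _ (altPsi y)) -[A *m V]mxvecK.
apply: Ky; rewrite ?mxvecK ?inv // => i.
rewrite /= in_itv /= -ler_norml.
case/mxvec_indexP: i => a j; rewrite mxvecE.
have rv : (row a (A *m V) *m G y *m (row a (A *m V))^T) 0 0 = 1.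
  by rewrite -/(inner _ _ _) -gram_inner AV mxE eqxx.
have := unit_vector_bound j pGy rv; rewrite mxE => vb.
have : `|(A *m V) a j| ^+ 2 <= M ^+ 2.
  rewrite real_normK ?num_real // (le_trans vb) // (le_trans (By j)) //.
  by rewrite expr2 ler_peMr // (le_trans _ M1).
by rewrite ler_pXn2r // nnegrE // (le_trans _ M1).
Qed.

End StrictPositivity.
End Calculus.

(** * Forms on phi-planes *)

Lemma near_coord (R : realType) n (X : smooth_manifold R n) (c : chart R n X) x
    (Q : 'rV[R]_n -> Prop) : cdom c x ->
  (\forall y \near coord c x, Q y) -> \forall z \near x, Q (coord c z).
Proof. by move=> xc nQ; have := continuous_coord xc; apply. Qed.

Section Planes.
Context {R : realType} {n p : nat} (X : smooth_manifold R n).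
Context (g : metric_tensor X) (rg : riemannian g).
Context (phi : diff_form X p.+1) (cal : calibration g phi).
Implicit Types (c : chart R n X) (x : X) (y : 'rV[R]_n) (f h : X -> R).

Let sphi : smooth_form phi. Proof. by case: cal. Qed.

Lemma pairing_lin k (a : 'M[R]_(k, n) -> R) (b d : R) (xi eta : multivector R n k) :
  pairing a (b *: xi + d *: eta) = b * pairing a xi + d * pairing a eta.
Proof.
rewrite /pairing !(mulrCA _ (_^-1)) -mulrDr; congr (_ * _).
rewrite !mulr_sumr -big_split /=; apply: eq_bigr => I _.
by rewrite !ffunE /GRing.scale /=; ring.
Qed.

Lemma pairing_form_lin k (a1 a2 : 'M[R]_(k, n) -> R) (b : R) (xi : multivector R n k) :
  pairing (fun V => a1 V + b * a2 V) xi = pairing a1 xi + b * pairing a2 xi.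
Proof.
rewrite /pairing mulrCA -mulrDr; congr (_ * _).
rewrite mulr_sumr -big_split /=; apply: eq_bigr => I _; ring.
Qed.

Lemma pairing_formZ k (a : 'M[R]_(k, n) -> R) (b : R) (xi : multivector R n k) :
  pairing (fun V => b * a V) xi = b * pairing a xi.
Proof.
rewrite /pairing mulrCA; congr (_ * _).
by rewrite mulr_sumr; apply: eq_bigr => I _; ring.
Qed.

(** The pairing is linear in the multivector. *)
Lemma convex_hull_pairing k (a : 'M[R]_(k, n) -> R) (A : set (multivector R n k))
    (Q : R -> Prop) :
  (forall s t l, 0 <= l -> l <= 1 -> Q s -> Q t -> Q (l * s + (1 - l) * t)) ->
  (forall xi, A xi -> Q (pairing a xi)) ->
  forall xi, convex_hull A xi -> Q (pairing a xi).
Proof.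
move=> cQ AQ xi; apply: (_ : _ `<=` [set xi | Q (pairing a xi)]).
apply: smallest_sub => // u v l; rewrite !inE => Qu Qv.
by rewrite /= [pairing _ _]pairing_lin; apply: cQ => //; exact: le1.
Qed.

Lemma phi_planeP x xi : phi_planes g phi x xi <->
  exists2 V, xi = wedge V & \det (gram (g x) V) = 1 /\ phi x V = 1.
Proof.
have alt : alternating_form (phi x) by case: sphi.
split=> [[[V V1 <-]]|[V -> [V1 phi1]]].
  by rewrite pairing_wedge // => phi1; exists V.
by split; [exists V|rewrite pairing_wedge].
Qed.

Lemma comass_le1 x W : \det (gram (g x) W) = 1 -> phi x W <= 1.
Proof.
have alt : alternating_form (phi x) by case: sphi.
move=> W1; rewrite -(pairing_wedge alt); case: cal => _ _; apply.
by exists W.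
Qed.

Lemma alternating_ddphi f x : smooth_fun f -> alternating_form (ddphi g phi f x).
Proof. by move=> sf; case: (smooth_ddphi rg sphi sf). Qed.

(** The term theta''(f) df /\ d^phi f is nonnegative on phi-planes. *)
Lemma pairing_ddphi_comp1 (theta : R -> R) f x xi :
  smooth1 theta -> smooth_fun f -> 0 <= theta^`()%classic^`()%classic (f x) ->
  phi_planes g phi x xi ->
  theta^`()%classic (f x) * pairing (ddphi g phi f x) xi <=
  pairing (ddphi g phi (theta \o f) x) xi.
Proof.
move=> st sf th2 /phi_planeP[V -> [V1 phi1]].
have eqle (s t : R) : s = t -> s <= t by move=> ->.
have E1 := pairing_wedge (alternating_ddphi x sf) V.
have E2 := pairing_wedge (alternating_ddphi x (smooth_fun_comp1 st sf)) V.
apply: le_trans (eqle _ _ (congr1 ( *%R (theta^`()%classic (f x))) E1)) _.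
apply: le_trans _ (eqle _ _ (esym E2)).
apply: le_trans _ (eqle _ _ (esym (ddphi_comp1 rg sphi x V st sf))).
rewrite lerDl; apply: (mulr_ge0 th2).
apply: (first_cousin_ge0 (posdef_metric rg x) _ _ V1 phi1); last exact: comass_le1.
by case: sphi.
Qed.

Lemma pairing_ddphi_lin f h a x xi : smooth_fun f -> smooth_fun h ->
  pairing (ddphi g phi (fun z => f z + a * h z) x) xi =
  pairing (ddphi g phi f x) xi + a * pairing (ddphi g phi h x) xi.
Proof.
move=> sf sh; rewrite -pairing_form_lin; congr (pairing _ _).
by apply/funext => V; exact: ddphi_lin.
Qed.

(** Read in one chart, where [strict_positivity_open] applies. *)
Lemma strictly_psh_open f x : smooth_fun f -> strictly_psh_at g phi f x ->
  \forall z \near x, strictly_psh_at g phi f z.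
Proof.
move=> sf fx; have ac := chart_at_atlas x; have xc := chart_at_dom x.
set c := chart_at x in ac xc; pose y0 := coord c x.
have yc : cimage c y0 by exact: cimage_coord.
have oc := cimage_isopen c.
have sdd := smooth_ddphi rg sphi sf.
have near_c := open_nbhs_nbhs (conj oc yc).
have metric_gram y V : gram (local_metric g c y) V =
    gram (g (param c y)) (V *m tangent_change c (param c y)).
  by rewrite /gram /local_metric trmx_mul !mulmxA.
have pos := @strict_positivity_open R n p.+1 (local_metric g c)
  (local_form c phi) (local_form c (ddphi g phi f)) y0.
pose Q y := forall V,
    \det (gram (local_metric g c y) V) = 1 -> local_form c phi y V = 1 ->
    0 < local_form c (ddphi g phi f) y V.
have {}pos : \forall y \near y0, Q y.
  apply: pos.
  - by move=> i j; exact: (smooth_continuous (smooth_local_metric rg i j ac) yc).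
  - move=> i j.
    have sinv : smooth_on (cimage c) (fun y => invmx (local_metric g c y) i j).
      apply: (smooth_invmx oc) => [a b|y yc'].
        exact: (smooth_local_metric rg a b ac).
      exact: (posdef_unit (posdef_local_metric rg ac yc')).
    exact: (smooth_continuous sinv yc).
  - by apply: filterS near_c => y yc'; exact: posdef_local_metric.
  - by move=> y; exact: alternating_local_form.
  - by move=> y; exact: alternating_local_form.
  - by move=> V; exact: (smooth_continuous (smooth_local_form sphi V ac) yc).
  - by move=> V; exact: (smooth_continuous (smooth_local_form sdd V ac) yc).
  move=> V V1; rewrite !local_form_self => phi1.
  rewrite -(pairing_wedge (alternating_ddphi x sf)); apply: fx.
  apply/phi_planeP; exists V => //; split => //.
  by move: V1; rewrite metric_gram coordK // tangent_change_self mulmx1 => ->; rewrite det1.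
have npos : \forall z \near x, Q (coord c z) by exact: near_coord xc pos.
have near_x : \forall z \near x, cdom c z.
  exact: (open_nbhs_nbhs (conj (@cdom_open _ _ _ c) xc)).
apply: filterS2 near_x npos => z zc zpos xi /phi_planeP[V -> [V1 phi1]].
have zi := cimage_coord zc; have uT := tangent_change_unit ac zi.
rewrite coordK // in uT.
pose W := V *m invmx (tangent_change c z).
have WE : W *m tangent_change c z = V by rewrite mulmxKV.
have lE (w : diff_form X p.+1) : local_form c w (coord c z) W = w z V.
  by rewrite /local_form coordK // WE.
rewrite (pairing_wedge (alternating_ddphi z sf)) -lE; apply: zpos.
  by rewrite metric_gram coordK // WE.
by rewrite lE.
Qed.

End Planes.

(** * Bump functions and cutoffs *)

Section Cutoff.
Context {R : realType} {n : nat} (X : smooth_manifold R n).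
Implicit Types (c : chart R n X) (x : X) (y : 'rV[R]_n) (f : X -> R).

Lemma open_superlevel f b : smooth_fun f -> open [set z | b < f z].
Proof.
move=> /smooth_fun_continuous cf.
have cf' : {in f @^-1` [set t | b < t], continuous f} by move=> z _; exact: cf.
by have := open_comp cf' (@open_gt _ b).
Qed.

Lemma closed_superlevel f b : smooth_fun f -> closed [set z | b <= f z].
Proof.
move=> /smooth_fun_continuous cf.
have cf' : {in ~` f @^-1` [set t | b <= t], continuous f} by move=> z _; exact: cf.
by have := preimage_closed cf' (@closed_ge _ b).
Qed.

Lemma param_preimage_open c (N : set X) : open N ->
  open [set y | cimage c y /\ N (param c y)].
Proof.
move=> oN; rewrite openE => y [yc Ny]; rewrite /interior.
have n1 := open_nbhs_nbhs (conj (cimage_isopen c) yc).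
have n2 : \forall z \near y, N (param c z).
  by have := continuous_param yc; apply; exact: (open_nbhs_nbhs (conj oN Ny)).
exact: (filterI n1 n2).
Qed.

(** K is closed, so each point of another chart either lies over the domain of c or
    has a neighbourhood where f is 0. *)
Lemma smooth_fun_patch c (K : set X) f : atlas c -> compact K -> K `<=` cdom c ->
  (forall x, ~ K x -> f x = 0) -> smooth_on (cimage c) (f \o param c) ->
  smooth_fun f.
Proof.
move=> ac cK Kc f0 sf c' ac'; apply: smooth_on_local => y yc'.
have [yc|yc] := pselect (cdom c (param c' y)).
  exists (overlap c' c) => //.
  have oO := overlap_open c' c.
  apply: (@smooth_on_eq _ _ _ _ ((f \o param c) \o transition c' c) oO).
    by move=> z zo /=; rewrite (param_transition zo).
  apply: (smooth_comp oO (cimage_isopen c) sf).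
    by move=> z; exact: overlap_cimage.
  by move=> j; exact: smooth_transition_coord.
have oK : open (~` K).
  by apply: closed_openC; apply: compact_closed => //; exact: manifold_hausdorff.
have oV := param_preimage_open (c := c') oK.
exists [set z | cimage c' z /\ (~` K) (param c' z)].
  by split => // /Kc.
apply: (@smooth_on_eq _ _ _ _ (cst 0) oV); last exact: smooth_cst.
by move=> z [_ /f0].
Qed.

(** In a chart, apply [ramp] to r^2 minus the squared distance to the image of x. *)
Lemma bump_exists x (U : set X) : open U -> U x ->
  exists rho, [/\ smooth_fun rho, forall z, 0 <= rho z, 1 < rho x
    & exists2 K, compact K & K `<=` U /\ forall z, ~ K z -> rho z = 0].
Proof.
move=> oU Ux; have ac := chart_at_atlas x; have xc := chart_at_dom x.
set c := chart_at x in ac xc; pose y0 := coord c x.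
have y0c : cimage c y0 by exact: cimage_coord.
have oV := param_preimage_open (c := c) oU.
set V := [set y | _] in oV.
have Vy0 : V y0 by split => //; rewrite /y0 coordK.
have [r /= r0 rV] : exists2 r : R, 0 < r & closed_ball y0 r `<=` V.
  have nV : nbhs y0 V by exact: (open_nbhs_nbhs (conj oV Vy0)).
  by have [r rV] := iffLR (nbhs_closedballP V y0) nV; exists r%:num.
pose q y := ramp (r ^+ 2 - \sum_i (y 0 i - y0 0 i) ^+ 2).
pose B := [set y : 'rV[R]_n | forall i, `[y0 0 i - r, y0 0 i + r]%classic (y 0 i)].
have cB : compact B.
  apply: (@rV_compact _ _ (fun i => `[y0 0 i - r, y0 0 i + r]%classic)) => i.
  exact: segment_compact.
have BV : B `<=` V.
  move=> y By; apply: rV; rewrite closed_ballE // /closed_ball_ /=.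
  apply: norm_le_coord => [|i]; first exact: ltW.
  by have := By i; rewrite !mxE /= in_itv /= ler_norml => /andP[]; lra.
have q0 y : ~ B y -> q y = 0.
  move=> /existsNP[i Bi]; apply: ramp_eq0; rewrite subr_le0.
  rewrite (bigD1 i) //= ler_wpDr //; first by apply: sumr_ge0 => j _; exact: sqr_ge0.
  have : r < `|y 0 i - y0 0 i|.
    rewrite ltNge; apply: contra_notN Bi => Bi.
    by move: Bi; rewrite ler_norml /= in_itv /= => /andP[]; lra.
  move=> /ltW h; rewrite -[leRHS]real_normK ?num_real //.
  by apply: lerXn2r => //; rewrite nnegrE ?normr_ge0 // ltW.
pose K := param c @` B.
have cK : compact K.
  apply: continuous_compact => //.
  apply: continuous_in_subspaceT => y /set_mem /BV[yc _].
  exact: continuous_param.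
have Kc : K `<=` cdom c by move=> _ [y /BV[yc _] <-]; have [] := cimageP yc.
have KU : K `<=` U by move=> _ [y /BV[_ ?] <-].
pose f z := if asbool (cdom c z) then q (coord c z) else 0.
have f0 z : ~ K z -> f z = 0.
  rewrite /f; case: asboolP => // zc Kz; apply: q0 => Bz; apply: Kz.
  by exists (coord c z) => //; rewrite coordK.
have fx : 0 < f x.
  rewrite /f; case: asboolP => // _; apply: ramp_gt0.
  rewrite big1 ?subr0 ?exprn_gt0 // => i _.
  by rewrite subrr expr0n.
have fge z : 0 <= f z by rewrite /f; case: asboolP => // _; exact: ramp_ge0.
have sf : smooth_fun f.
  apply: (smooth_fun_patch ac cK Kc f0).
  have oc := cimage_isopen c.
  apply: (@smooth_on_eq _ _ _ _ q oc) => [y yc|].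
    have [d e] := cimageP yc.
    by rewrite /= /f; case: asboolP => // _; rewrite e.
  apply: (smooth_comp1 oc (theta := ramp)); first exact: ramp_smooth.
  apply: (smoothD oc); first exact: smooth_cst.
  have S1 : smooth_on (cimage c) (fun y => -1 * \sum_i (y 0 i - y0 0 i) ^+ 2).
    apply: (smoothZ oc); apply: (smooth_sum oc) => i.
    have S2 : smooth_on (cimage c) (fun y => y 0 i - y0 0 i).
      by apply: (smoothD oc); [exact: smooth_coord|exact: smooth_cst].
    exact: (smoothM oc S2 S2).
  by apply: (smooth_on_eq oc _ S1) => y _; rewrite mulN1r.
(* The factor makes the value at x equal to 2. *)
exists (fun z => (2 / f x) * f z); split.
- exact: smooth_funM (smooth_fun_cst _) sf.
- by move=> z; rewrite mulr_ge0 // divr_ge0 // ltW.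
- by rewrite divfK ?gt_eqF // ltr1n.
- by exists K => //; split => // z /f0 ->; rewrite mulr0.
Qed.

Lemma smooth_fun_sum (I : Type) (s : seq I) (F : I -> X -> R) :
  (forall i, smooth_fun (F i)) -> smooth_fun (fun x => \sum_(i <- s) F i x).
Proof.
move=> sF c ac; exact: (smooth_sum (cimage_isopen c) s (fun i => sF i c ac)).
Qed.

Lemma fun_support_sub f (K : set X) : compact K -> (forall z, ~ K z -> f z = 0) ->
  fun_support f `<=` K.
Proof.
move=> cK f0; have cl : closed K by apply: compact_closed => //; exact: manifold_hausdorff.
rewrite /fun_support [in X in _ `<=` X](iffLR (closure_id K) cl).
apply: closureS => z /=; apply: contra_neqP; exact: f0.
Qed.

Lemma fun_support_compact f (K : set X) : compact K ->
  (forall z, ~ K z -> f z = 0) -> compact (fun_support f).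
Proof.
move=> cK f0; apply: (subclosed_compact _ cK (fun_support_sub cK f0)).
exact: closed_closure.
Qed.

(** Finitely many bumps have a sum s > 1 on C. Then s / (s + ramp (1 - s)) is 1
    where s > 1 and 0 where s = 0. *)
Lemma cutoff_exists (C : set X) : compact C ->
  exists eta, [/\ test_fun eta, forall z, 0 <= eta z
    & exists N : set X, [/\ open N, C `<=` N & forall z, N z -> eta z = 1]].
Proof.
move=> cC.
have /choice[rho Hrho] (x : X) : exists rho : X -> R, [/\ smooth_fun rho,
    forall z, 0 <= rho z, 1 < rho x
    & exists2 K, compact K & forall z, ~ K z -> rho z = 0].
  have [rho [? ? ? [K cK [_ ?]]]] := @bump_exists x setT openT I.
  by exists rho; split => //; exists K.
have /choice[L HL] (x : X) : exists K : set X, compact K /\ forall z, ~ K z -> rho x z = 0.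
  by have [_ _ _ [K cK K0]] := Hrho x; exists K.
have cov : C `<=` cover C (fun x => [set z | 1 < rho x z]).
  by move=> x Cx; exists x => //=; have [] := Hrho x.
have oW x : C x -> open [set z | 1 < rho x z].
  by move=> _; apply: open_superlevel; case: (Hrho x).
rewrite compact_cover in cC; have [D _ CD] := cC _ C _ oW cov.
pose s z := \sum_(i <- finmap.enum_fset D) rho i z.
have ss : smooth_fun s by apply: smooth_fun_sum => i; have [] := Hrho i.
have rho0 i z : 0 <= rho i z by have [] := Hrho i.
have s0 z : 0 <= s z by apply: sumr_ge0.
(* The denominator is positive: the second term is so where s is 0. *)
pose d z := s z + ramp (1 - s z).
have d0 z : 0 < d z.
  rewrite /d; have [->|sz] := eqVneq (s z) 0.
    by rewrite add0r subr0 ramp_gt0.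
  by rewrite ltr_wpDr ?ramp_ge0 // lt_def sz s0.
have sd : smooth_fun d.
  have S1 : smooth_fun (fun z => 1 + (-1) * s z).
    exact: smooth_funD (smooth_fun_cst 1) (smooth_funM (smooth_fun_cst _) ss).
  have E : (fun z => 1 - s z) = (fun z => 1 + (-1) * s z).
    by apply/funext => z; rewrite mulN1r.
  rewrite -E in S1.
  exact: smooth_funD ss (smooth_fun_comp1 ramp_smooth S1).
have d_neq0 z : d z != 0 by rewrite gt_eqF.
pose KK := \big[setU/set0]_(i <- finmap.enum_fset D) L i.
have cKK : compact KK by apply: bigsetU_compact => i _; have [] := HL i.
have sKK z : ~ KK z -> s z = 0.
  move=> Kz; apply: big1_seq => i /andP[_ iD]; apply: (HL i).2 => Lz; apply: Kz.
  by rewrite /KK -bigcup_seq; exists i.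
exists (fun z => s z * (d z)^-1); split.
- split; first exact: smooth_funM ss (smooth_funV sd d_neq0).
  by apply: (fun_support_compact cKK) => z /sKK ->; rewrite mul0r.
- by move=> z; rewrite divr_ge0 // ltW.
exists [set z | 1 < s z]; split; first exact: open_superlevel.
  move=> z /CD[i iD /= iz]; apply: (lt_le_trans iz).
  rewrite /s (big_rem i) //= ler_wpDr //.
  by apply: sumr_ge0.
move=> z /= sz; rewrite /d ramp_eq0 ?addr0; last by rewrite subr_le0 ltW.
by rewrite mulfV // gt_eqF // (lt_trans ltr01).
Qed.

End Cutoff.

(** * Null sets *)

Section Measure.

Lemma ae_imply d (T : measurableType d) (R : realType)
    (mu : {measure set T -> \bar R}) (P Q : T -> Prop) :
  (forall x, P x -> Q x) -> {ae mu, forall x, P x} -> {ae mu, forall x, Q x}.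
Proof. by move=> PQ; exact: filterS. Qed.

Lemma ae_imply2 d (T : measurableType d) (R : realType)
    (mu : {measure set T -> \bar R}) (P Q S : T -> Prop) :
  (forall x, P x -> Q x -> S x) ->
  {ae mu, forall x, P x} -> {ae mu, forall x, Q x} -> {ae mu, forall x, S x}.
Proof. by move=> PQS; exact: filterS2. Qed.

Lemma ae_eq0_of_integral_le0 d (T : measurableType d) (R : realType)
    (mu : {measure set T -> \bar R}) (f : T -> R) :
  mu.-integrable setT (fun x => (f x)%:E) -> {ae mu, forall x, 0 <= f x} ->
  (\int[mu]_x (f x)%:E <= 0)%E -> {ae mu, forall x, f x = 0}.
Proof.
move=> fi f0 If.
have mf := measurable_int _ fi.
have E : (\int[mu]_x `|(f x)%:E| = \int[mu]_x (f x)%:E)%E.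
  apply: ae_eq_integral => //; first exact: measurableT_comp.
  by apply: filterS f0 => x fx _ /=; rewrite ger0_norm.
have I0 : (\int[mu]_x `|(f x)%:E| = 0)%E.
  by apply/eqP; rewrite eq_le {1}E If /= integral_ge0.
have := (ae_eq_integral_abs mu measurableT mf).1 I0.
by apply: filterS => x /(_ I) [].
Qed.

Context {R : realType} {n : nat} (X : smooth_manifold R n).
Variable mu : {measure set (borel X) -> \bar R}.

(** The manifold is second countable, and a countable union of null sets is null. *)
Lemma negligible_local (S : set X) :
  (forall x, S x -> exists U : set X, [/\ open U, U x & mu.-negligible (U : set (borel X))]) ->
  mu.-negligible (S : set (borel X)).
Proof.
move=> loc; have [B cB [oB bB]] := manifold_second_countable X.
have [i] := @pcard_leP _ _ _ _ cB.
pose F k : set (borel X) :=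
  \bigcup_(U in [set U | B U /\ mu.-negligible (U : set (borel X)) /\ i U = k]) U.
apply: (@negligibleS _ _ _ mu (\bigcup_k F k)); last first.
  apply: negligible_bigcup => k.
  have [[U [BU [nU iU]]]|no] := pselect
    (exists U, B U /\ mu.-negligible (U : set (borel X)) /\ i U = k).
    apply: (negligibleS _ nU) => x [V [BV [_ iV]] Vx].
    have iUV : i U = i V by rewrite iU.
    have -> : U = V by apply: (inj (f := i) (mem_set BU) (mem_set BV) iUV).
    by [].
  apply: (negligibleS _ (negligible_set0 _)) => x [V HV _]; apply: no.
  by exists V.
move=> x Sx; have [U [oU Ux nU]] := loc x Sx.
have [V [BV Vx] VU] := bB x U (open_nbhs_nbhs (conj oU Ux)).
exists (i V) => //; exists V => //; split=> //; split=> //.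
exact: negligibleS nU.
Qed.

End Measure.

(** * Positive currents *)

Section PositiveCurrents.
Context {R : realType} {n p : nat} (X : smooth_manifold R n).
Context (g : metric_tensor X) (rg : riemannian g).
Context (phi : diff_form X p.+1) (cal : calibration g phi).
Implicit Types (x : X) (f : X -> R) (U : set X).

Let sphi : smooth_form phi. Proof. by case: cal. Qed.

Lemma form_support_sub k (w : diff_form X k) (C : set X) : closed C ->
  (forall z V, ~ C z -> w z V = 0) -> form_support w `<=` C.
Proof.
move=> cC w0; rewrite /form_support [in X in _ `<=` X](iffLR (closure_id C) cC).
apply: closureS => z /= [V]; apply: contra_neqP; exact: w0.
Qed.

Lemma form_support_eq0 k (w : diff_form X k) z V : ~ form_support w z -> w z V = 0.
Proof.
by move=> nz; apply: contra_notP nz => wz; apply: subset_closure; exists V; exact/eqP.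
Qed.

Lemma fun_support_eq0 f z : ~ fun_support f z -> f z = 0.
Proof.
by move=> nz; apply: contra_notP nz => fz; apply: subset_closure; exact/eqP.
Qed.

Lemma form_supportZ f : form_support (fun x V => f x * phi x V) `<=` fun_support f.
Proof.
apply: form_support_sub; first exact: closed_closure.
by move=> z V /fun_support_eq0 ->; rewrite mul0r.
Qed.

Lemma test_formZ f : test_fun f -> test_form (fun x V => f x * phi x V).
Proof.
move=> [sf cf]; split; first exact: smooth_formZ.
by apply: (subclosed_compact _ cf (@form_supportZ f)); exact: closed_closure.
Qed.

Lemma ddphi0 x V : ddphi g phi (cst 0) x V = 0.
Proof.
have s0 : smooth_fun (X := X) (cst 0) by exact: smooth_fun_cst.
have := ddphi_lin rg sphi 1 x V s0 s0.
have -> : (fun z : X => cst 0 z + 1 * cst 0 z) = cst 0 :> (X -> R).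
  by apply/funext => z /=; rewrite mulr0 addr0.
by rewrite mul1r => /eqP; rewrite -subr_eq subrr => /eqP.
Qed.

Lemma form_support_ddphi f : form_support (ddphi g phi f) `<=` fun_support f.
Proof.
apply: form_support_sub; first exact: closed_closure.
move=> z V nz; rewrite -[RHS](ddphi0 z V).
apply: (@ddphi_local_eq _ _ _ _ _ _ _ _ (~` fun_support f)) => //.
  exact/closed_openC/closed_closure.
by move=> y /fun_support_eq0.
Qed.

Lemma test_ddphi f : test_fun f -> test_form (ddphi g phi f).
Proof.
move=> [sf cf]; split; first exact: smooth_ddphi.
by apply: (subclosed_compact _ cf (@form_support_ddphi f)); exact: closed_closure.
Qed.

Section Representation.
Context (T : diff_form X p.+1 -> R) (mu : {measure set (borel X) -> \bar R})
  (Tvec : X -> multivector R n p.+1).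
Hypothesis hull : {ae mu, forall x : X, convex_hull (phi_planes g phi x) (Tvec x)}.
Hypothesis rep : forall w : diff_form X p.+1, test_form w ->
  mu.-integrable setT (fun x : borel X => (pairing (w x) (Tvec x))%:E) /\
  (T w)%:E = (\int[mu]_(x in setT) (pairing (w x) (Tvec x))%:E)%E.

Lemma current_ae_eq0 (w : diff_form X p.+1) : test_form w ->
  {ae mu, forall x : X, 0 <= pairing (w x) (Tvec x)} -> T w <= 0 ->
  {ae mu, forall x : X, pairing (w x) (Tvec x) = 0}.
Proof.
move=> tw w0 Tw; have [iw Ew] := rep tw.
apply: (ae_eq0_of_integral_le0 iw w0).
by rewrite -Ew lee_fin.
Qed.

Lemma pairing_eq0 k (a : 'M[R]_(k, n) -> R) xi :
  (forall V, a V = 0) -> pairing a xi = 0.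
Proof. by move=> a0; rewrite /pairing big1 ?mulr0 // => I _; rewrite a0 mulr0. Qed.

Lemma current_null_open (U : set X) (w : diff_form X p.+1) :
  mu.-negligible (U : set (borel X)) -> test_form w -> form_support w `<=` U ->
  T w = 0.
Proof.
move=> nU tw wU; have [iw Ew] := rep tw.
apply: EFin_inj; apply: etrans Ew _.
apply: etrans (_ : _ = \int[mu]_(x in setT) cst 0%E x)%E _; last exact: integral0.
apply: ae_eq_integral => //; first exact: (measurable_int _ iw).
apply: (negligibleS _ nU) => x /= nx; apply: contrapT => nUx; apply: nx => _.
by rewrite pairing_eq0 // => V; apply: form_support_eq0 => /wU.
Qed.

(** If T vanishes on the forms supported in U, apply it to rho phi where rho is a
    bump in U. The integrand is rho almost everywhere, since phi is 1 on the
    convex hull of phi-planes; so rho is 0 almost everywhere. *)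
Lemma null_off_support :
  mu.-negligible (~` current_support T : set (borel X)).
Proof.
apply: negligible_local => x /existsNP[U /not_implyP[oU /not_implyP[Ux noU]]].
have {}noU w : test_form w -> form_support w `<=` U -> T w = 0.
  by move=> tw wU; apply: contrapT => /eqP Tw; apply: noU; exists w.
have [rho [srho rho0 rhox [K cK [KU Krho]]]] := bump_exists oU Ux.
have trho : test_fun rho by split => //; exact: (fun_support_compact cK).
exists [set z | 1 < rho z]; split => //.
  exact: open_superlevel.
have tw := test_formZ trho.
have hullE x' : convex_hull (phi_planes g phi x') (Tvec x') ->
    pairing (fun V => rho x' * phi x' V) (Tvec x') = rho x'.
  move=> hx; rewrite pairing_formZ -[RHS]mulr1; congr (_ * _).
  apply: (convex_hull_pairing (Q := fun t => t = 1) _ _ hx).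
    by move=> s t l _ _ -> ->; ring.
  by move=> xi [].
have /(current_ae_eq0 tw) :
    {ae mu, forall x : X, 0 <= pairing (fun V => rho x * phi x V) (Tvec x)}.
  by apply: (ae_imply _ hull) => z /hullE ->.
have -> : T (fun x V => rho x * phi x V) = 0.
  apply: noU => //; apply: (subset_trans (@form_supportZ rho)).
  by apply: (subset_trans _ KU); exact: (fun_support_sub cK).
move=> /(_ (lexx 0)) H; have no : {ae mu, forall z : X, ~ 1 < rho z}.
  by apply: (ae_imply2 _ hull H) => z /hullE -> ->; rewrite ltr10.
by apply: (negligibleS _ no) => z /= rz; exact.
Qed.

End Representation.

End PositiveCurrents.

(** * Separating a point from the hull *)

Section Separation.
Context {R : realType} {n p : nat} (X : smooth_manifold R n).
Context (g : metric_tensor X) (rg : riemannian g).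
Context (phi : diff_form X p.+1) (cal : calibration g phi).
Implicit Types (x : X) (f F : X -> R) (K : set X).

Lemma not_hull_gap K x : ~ psh_hull g phi K x ->
  exists f a, [/\ PSH g phi f, forall y, K y -> f y <= a & a < f x].
Proof.
move=> /existsNP[f /not_implyP[pf /negP]]; rewrite -ltNge.
have ub y : K y -> ((f y)%:E <= ereal_sup [set (f z)%:E | z in K])%E.
  by move=> Ky; apply: ereal_sup_ubound; exists y.
case: (ereal_sup _) ub => [a| |] ub sx.
- by exists f, a; split.
- by move: sx; rewrite ltNge leey.
(* The supremum is -oo: K is empty, and any bound below f x will do. *)
- exists f, (f x - 1); split => //; last by rewrite ltrBlDr ltrDl.
  by move=> y /ub; rewrite leNgt ltNyr.
Qed.

Lemma continuous_bounded_on K f : compact K -> continuous f ->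
  exists2 M, 0 < M & forall y, K y -> `|f y| <= M.
Proof.
move=> cK cf.
have : compact (f @` K).
  by apply: continuous_compact => //; exact: continuous_subspaceT.
move=> /compact_bounded/ex_strict_bound_gt0[M M0 HM].
by exists M => // y Ky; apply/ltW/HM; exists y.
Qed.

Lemma strict_separation K x : compact K -> ~ psh_hull g phi K x ->
  ~ Core g phi x -> exists F a b,
  [/\ PSH g phi F, strictly_psh_at g phi F x, forall y, K y -> F y <= a, a < b
    & b < F x].
Proof.
move=> cK /not_hull_gap[f [a [[sf pf] fK fx]]] /contrapT[h [sh ph] hx].
have [M M0 hM] := continuous_bounded_on cK (smooth_fun_continuous sh).
pose N := M + `|h x|; have N0 : 0 < N by rewrite ltr_pwDl.
(* With this choice |e h| is at most a quarter of the gap f x - a, on K and at x. *)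
pose e := (f x - a) / (4 * N).
have e0 : 0 < e by rewrite divr_gt0 ?subr_gt0 // mulr_gt0.
have eN : e * N = (f x - a) / 4 by rewrite /e; field; rewrite gt_eqF.
have bound t : `|t| <= N -> e * t <= (f x - a) / 4 /\ - ((f x - a) / 4) <= e * t.
  rewrite -eN -mulrN => tN; rewrite !ler_pM2l //.
  by move: tN; rewrite ler_norml => /andP[].
exists (fun z => f z + e * h z), (a + (f x - a) / 4), (a + (f x - a) / 2).
split.
- split.
    exact: smooth_funD sf (smooth_funM (smooth_fun_cst e) sh).
  move=> y xi yxi; have := pairing_ddphi_lin rg cal e y xi sf sh => ->.
  by apply: addr_ge0; [exact: pf|apply: (mulr_ge0 (ltW e0)); exact: ph].
- move=> xi xxi; have := pairing_ddphi_lin rg cal e x xi sf sh => ->.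
  by apply: ltr_wpDl; [exact: pf|apply: (mulr_gt0 e0); exact: hx].
- move=> y Ky; apply: lerD; first exact: fK.
  have hN : `|h y| <= N by apply: (le_trans (hM y Ky)); rewrite lerDl.
  by have [] := bound (h y) hN.
- by lra.
have hN : `|h x| <= N by rewrite lerDr ltW.
have [_ h2] := bound (h x) hN; lra.
Qed.

Lemma psh_hull_le K F a : PSH g phi F -> (forall y, K y -> F y <= a) ->
  forall z, psh_hull g phi K z -> F z <= a.
Proof.
move=> pF FK z /(_ F pF) /le_trans Hz; rewrite -lee_fin; apply: Hz.
by apply: ge_ereal_sup => _ [y /FK + <-]; rewrite lee_fin.
Qed.

(** Compose F with [ramp] shifted by b: convexity and monotonicity preserve
    plurisubharmonicity, and the derivative is positive where F > b. *)
Lemma psh_truncation F b : PSH g phi F ->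
  exists u, [/\ PSH g phi u, forall z, 0 <= u z, forall z, F z <= b -> u z = 0
    & forall z, b < F z -> strictly_psh_at g phi F z -> strictly_psh_at g phi u z].
Proof.
move=> [sF pF]; pose th t := ramp (t - b).
have sth : smooth1 th by apply: smooth1_translate; exact: ramp_smooth.
have dth : th^`()%classic = (fun t => ramp^`()%classic (t - b)).
  exact: derive1_translate.
have ddth : th^`()%classic^`()%classic = (fun t => ramp^`()%classic^`()%classic (t - b)).
  by rewrite dth; exact: derive1_translate.
have comp z xi : phi_planes g phi z xi ->
    th^`()%classic (F z) * pairing (ddphi g phi F z) xi <=
    pairing (ddphi g phi (th \o F) z) xi.
  move=> zxi; have convex : 0 <= th^`()%classic^`()%classic (F z).
    by rewrite ddth; exact: ddramp_ge0.
  exact: (pairing_ddphi_comp1 rg cal sth sF convex zxi).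
exists (th \o F); split.
- split; first exact: smooth_fun_comp1.
  move=> z xi zxi; apply: le_trans (comp z xi zxi); apply: mulr_ge0.
    by rewrite dth; exact: dramp_ge0.
  exact: pF.
- by move=> z; exact: ramp_ge0.
- by move=> z zb; apply: ramp_eq0; rewrite subr_le0.
- move=> z bz sz xi zxi; apply: lt_le_trans (comp z xi zxi).
  apply: mulr_gt0; last exact: sz.
  by rewrite dth; apply: dramp_gt0; rewrite subr_gt0.
Qed.

Lemma phi_planes_hull_ge0 x (a : 'M[R]_(p.+1, n) -> R) xi :
  (forall eta, phi_planes g phi x eta -> 0 <= pairing a eta) ->
  convex_hull (phi_planes g phi x) xi -> 0 <= pairing a xi.
Proof.
move=> a0; apply: (convex_hull_pairing (Q := fun t => 0 <= t)) => //.
by move=> s t l l0 l1 s0 t0; rewrite addr_ge0 // mulr_ge0 // subr_ge0.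
Qed.

Lemma phi_planes_hull_gt0 x (a : 'M[R]_(p.+1, n) -> R) xi :
  (forall eta, phi_planes g phi x eta -> 0 < pairing a eta) ->
  convex_hull (phi_planes g phi x) xi -> 0 < pairing a xi.
Proof.
move=> a0; apply: (convex_hull_pairing (Q := fun t => 0 < t)) => //.
move=> s t l l0 l1 s0 t0; have [->|ln0] := eqVneq l 0.
  by rewrite mul0r add0r subr0 mul1r.
by rewrite ltr_pwDl // ?mulr_gt0 ?mulr_ge0 ?subr_ge0 // ?lt_def ?ln0 // ltW.
Qed.

End Separation.

Theorem lemma6p2 (R : realType) (n p : nat) (X : smooth_manifold R n)
    (g : metric_tensor X) (phi : diff_form X p.+1)
    (hg : riemannian g) (hcal : calibration g phi)
    (hpar : parallel_form g phi)
    (hconn : connected [set: X]) (hnc : ~ compact [set: X])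
    (K : set X) (hK : compact K)
    (T : diff_form X p.+1 -> R) (hT : positive_current g phi T)
    (hTc : compact (current_support T))
    (hneg : nonpositive_on (~` psh_hull g phi K) (dphi_d g phi T)) :
  current_support T `<=` psh_hull g phi K `|` Core g phi.
Proof.
move=> x Tx; apply: contrapT => /not_orP[xK xC].
have [F [a [b [pF Fx FK ab bx]]]] := strict_separation hg hcal hK xK xC.
have sF := pF.1.
have [_ [mu [Tvec [_ hull rep]]]] := hT.
have [u [[su pu] u0 u_eq0 u_strict]] := psh_truncation hg hcal b pF.
have [eta [[seta ceta] eta0 [N [oN TN N1]]]] := cutoff_exists hTc.
have [psi psiE] : exists psi : X -> R, psi = (fun z => eta z * u z) by eexists.
have spsi : smooth_fun psi by rewrite psiE; exact: smooth_funM.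
have psi_eta : fun_support psi `<=` fun_support eta.
  by apply: closureS => z /=; rewrite psiE mulf_eq0 negb_or => /andP[].
have tpsi : test_fun psi.
  split; first exact: spsi.
  exact: (subclosed_compact (@closed_closure _ _) ceta psi_eta).
have cb : closed [set z | b <= F z] by exact: closed_superlevel.
have psiK : fun_support psi `<=` ~` psh_hull g phi K.
  have psib : fun_support psi `<=` [set z | b <= F z].
    rewrite /fun_support [in X in _ `<=` X](iffLR (closure_id _) cb).
    apply: closureS => z /=; apply: contra_neqT; rewrite -ltNge => /ltW zb.
    by rewrite psiE u_eq0 // mulr0.
  move=> z /psib /= bz /(psh_hull_le pF FK) za.
  by have := lt_le_trans ab (le_trans bz za); rewrite ltxx.
have psi0 z : 0 <= psi z by rewrite psiE; exact: mulr_ge0 (eta0 z) (u0 z).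
have Tpsi : T (ddphi g phi psi) <= 0 by exact: (hneg psi tpsi psiK psi0).
have psi_u z V : N z -> ddphi g phi psi z V = ddphi g phi u z V.
  have psi_eq y : N y -> psi y = u y by move=> /N1 ey; rewrite psiE ey mul1r.
  by move=> Nz; exact: (ddphi_local_eq g phi V oN psi_eq Nz).
have psi_uE z : N z -> ddphi g phi psi z = ddphi g phi u z.
  by move=> Nz; apply/funext => V; exact: psi_u.
have nN : {ae mu, forall z : X, N z}.
  by apply: (negligibleS _ (null_off_support hcal hull rep)); exact: subsetC.
have tdd := test_ddphi hg hcal tpsi.
have ae0 : {ae mu, forall z : X, pairing (ddphi g phi psi z) (Tvec z) = 0}.
  apply: (current_ae_eq0 rep tdd _ Tpsi).
  apply: (ae_imply2 _ hull nN) => z hz Nz; rewrite psi_uE //.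
  exact: (phi_planes_hull_ge0 (pu z) hz).
have nx : \forall z \near x, [/\ strictly_psh_at g phi F z, b < F z & N z].
  have n1 := strictly_psh_open hg hcal sF Fx.
  have oF : open [set z | b < F z] by exact: open_superlevel.
  have n2 := open_nbhs_nbhs (conj oF bx).
  have n3 := open_nbhs_nbhs (conj oN (TN x Tx)).
  by apply: filterS3 n1 n2 n3.
have [U [oU Ux HU]] : exists U : set X, [/\ open U, U x &
    forall z, U z -> [/\ strictly_psh_at g phi F z, b < F z & N z]].
  exists (interior [set z | [/\ strictly_psh_at g phi F z, b < F z & N z]]).
  by split=> [|//|]; [exact: open_interior|exact: interior_subset].
have nU : mu.-negligible (U : set (borel X)).
  have noU : {ae mu, forall z : X, ~ U z}.
    apply: (ae_imply2 _ hull ae0) => z hz z0 /HU[sz bz Nz].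
    have : 0 < pairing (ddphi g phi psi z) (Tvec z).
      by rewrite psi_uE //; exact: (phi_planes_hull_gt0 (u_strict z bz sz) hz).
    by rewrite z0 ltxx.
  by apply: (negligibleS _ noU) => z /= Uz; exact.
have [w [tw wU /eqP]] := Tx U oU Ux; apply.
exact: (current_null_open rep nU tw wU).
Qed.
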